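(* Let $M$ be the 5-manifold with coordinates $(\psi,\theta,\phi,x,q)$ on the domain $\sin\theta\neq0$, $\cos(\frac x3)\neq0$. With $\sigma_i,E^i$ the left-invariant 1-forms and dual vector fields of $SU(2)$ in Euler angles $(\psi,\theta,\phi)$ (see context), let $D_{\mathbb{R}}$ be the real rank 2 distribution spanned by $$X^1=\partial_x+E^2,\qquad X^2=\partial_q+\cos\left(\tfrac{x}{3}\right)E^1-\tfrac{1}{3}\sin\left(\tfrac{x}{3}\right)E^3 .$$ Let $$o_1=\sigma_1-\cos\left(\tfrac{x}{3}\right)dq,\quad o_2=\sigma_2-dx,\quad o_3=\sigma_3+\tfrac{1}{3}\sin\left(\tfrac{x}{3}\right)dq,\quad o_4=-dx,\quad o_5=\cos\left(\tfrac{x}{3}\right)dq$$ (so that $o_1,o_2,o_3$ span the annihilator of $D_{\mathbb{R}}$) and $$\tilde o_1=\sigma_1+\cos\left(\tfrac{x}{3}\right)dq,\quad \tilde o_2=\sigma_2+dx,\quad \tilde o_3=o_3$$ (which span the annihilator of the sign-reversed distribution $\tilde D_{\mathbb{R}}$ spanned by $\partial_x-E^2$ and $\partial_q-\cos(\frac x3)E^1-\frac13\sin(\frac x3)E^3$). Then $D_{\mathbb{R}}$ is a maximally symmetric $(2,3,5)$-distribution and a representative metric of Nurowski's conformal class associated to $D_{\mathbb{R}}$ is $$g_{\mathbb{R}}=-2(o_4 o_4+o_5o_5)+\tfrac{1}{2}(\tilde{o}_1\tilde{o}_1+\tilde{o}_2\tilde{o}_2+\tilde o_3\tilde o_3)+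 (o_1o_1+o_2 o_2+o_3 o_3)$$ $$=\chi_1^2+\chi_2^2-(\chi_3^2+\chi_4^2)+\tfrac{1}{2}(\omega_1^2+\omega_2^2)+\tfrac{3}{2}\omega_3^2 .$$ The conformal structure determined by $g_{\mathbb{R}}$ is conformally flat and $D_{\mathbb{R}}$ has the split real form of $G_2$ as its group of (local) symmetries.
   Context: Products of 1-forms are symmetric products, and $\omega^2=\omega\omega$. Left-invariant forms and vector fields on $SU(2)\cong S^3$ in Euler angles $(\psi,\theta,\phi)$: $$\sigma_1=\sin\psi\,d\theta-\cos\psi\sin\theta\,d\phi,\quad \sigma_2=\cos\psi\,d\theta+\sin\psi\sin\theta\,d\phi,\quad \sigma_3=-d\psi-\cos\theta\,d\phi,$$ with dual vector fields $$E^1=\sin\psi\,\partial_\theta+\cos\psi\left(\cot\theta\,\partial_\psi-\tfrac{1}{\sin\theta}\partial_\phi\right),\quad E^2=\cos\psi\,\partial_\theta-\sin\psi\left(\cot\theta\,\partial_\psi-\tfrac{1}{\sin\theta}\partial_\phi\right),\quad E^3=-\partial_\psi .$$ Rolling forms: with $f(\theta)=-\sin\theta$ and $h(x)=\cos(\frac x3)$, $$\chi_1=d\theta,\quad \chi_2=f\,d\phi,\quad \chi_3=dx,\quad \chi_4=h\,dq,$$ $$\omega_1=\chi_1-\cos\psi\,\chi_3-\sin\psi\,\chi_4,\quad \omega_2=\chi_2+\sin\psi\,\chi_3-\cos\psi\,\chi_4,\quad \omega_3=d\psi+\tfrac{h_x}{h}\chi_4-\tfrac{f_\theta}{f}\chi_2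 .$$ A $(2,3,5)$-distribution on a 5-manifold $M$ is a rank 2 distribution $D\subset TM$ with $[D,D]$ of rank 3 and $[[D,D],D]=TM$. Nurowski's conformal class of $D$: locally there exist a coframe $(\theta_1,\dots,\theta_5)$ with $D=\ker(\theta_1,\theta_2,\theta_3)$ and 1-forms $\Omega_1,\dots,\Omega_7$ satisfying Cartan's structure equations $$d\theta_1=\theta_1\wedge(2\Omega_1+\Omega_4)+\theta_2\wedge\Omega_2+\theta_3\wedge\theta_4,$$ $$d\theta_2=\theta_1\wedge\Omega_3+\theta_2\wedge(\Omega_1+2\Omega_4)+\theta_3\wedge\theta_5,$$ $$d\theta_3=\theta_1\wedge\Omega_5+\theta_2\wedge\Omega_6+\theta_3\wedge(\Omega_1+\Omega_4)+\theta_4\wedge\theta_5,$$ $$d\theta_4=\theta_1\wedge\Omega_7+\tfrac43\theta_3\wedge\Omega_6+\theta_4\wedge\Omega_1+\theta_5\wedge\Omega_2,$$ $$d\theta_5=\theta_2\wedge\Omega_7-\tfrac43\theta_3\wedge\Omega_5+\theta_4\wedge\Omega_3+\theta_5\wedge\Omega_4,$$ and the class is that of $g=2\theta_1\theta_5-2\theta_2\theta_4+\frac43\theta_3\theta_3$ (signature $(2,3)$), which depends only on $D$ up to conformal rescaling (rescaling by a nonzero function of either sign is allowed). $D$ is called maximally symmetric when $g$ has vanishing Weyl tensor; its local infinitesimal symmetries then form the split real form of $\mathfrak{g}_2$. *)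

(* Defs.v *)
From HB Require Import structures.
From mathcomp Require Import all_boot all_order all_algebra.
From mathcomp Require Import all_classical all_reals all_analysis.
Set Implicit Arguments. Unset Strict Implicit. Unset Printing Implicit Defensive.
Import Order.TTheory GRing.Theory Num.Theory.
Import numFieldNormedType.Exports.
Local Open Scope classical_set_scope.
Local Open Scope ring_scope.

(* Points and tangent vectors are rows, covectors are columns, so that the
    pairing of [v] with [a] is [v *m a].  Vector fields, 1-forms and (0,2)
    tensors are total functions of the point; only their values on the open set
    under consideration matter. *)

Section Calculus.
Context {R : realType} {n : nat}.
Local Notation pt := 'rV[R]_n.+1.

Definition scalar_field := pt -> R.
Definition vector_field := pt -> 'rV[R]_n.+1.
Definition one_form := pt -> 'cV[R]_n.+1.
Definition tensor2 := pt -> 'M[R]_n.+1.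

Definition partial (i : 'I_n.+1) (f : scalar_field) : scalar_field :=
  fun p => 'D_(delta_mx 0 i) f p.

Fixpoint iter_partial (s : seq 'I_n.+1) (f : scalar_field) : scalar_field :=
  if s is i :: s' then partial i (iter_partial s' f) else f.

(* C^oo: since differentiable functions are continuous, this says that partial
   derivatives of all orders exist and are continuous. *)
Definition smooth (U : set pt) (f : scalar_field) :=
  forall s p, U p -> differentiable (iter_partial s f) p.

Definition smooth_vf (U : set pt) (X : vector_field) :=
  forall i, smooth U (fun p => X p 0 i).

Definition smooth_form (U : set pt) (w : one_form) :=
  forall i, smooth U (fun p => w p i 0).

Definition differential (f : scalar_field) : one_form :=
  fun p => \col_i partial i f p.

Definition lie_bracket (X Y : vector_field) : vector_field := fun p =>
  \row_j \sum_i (X p 0 i * partial i (fun y => Y y 0 j) p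
                 - Y p 0 i * partial i (fun y => X y 0 j) p).

(* 2-forms are given by their antisymmetric matrices: [b i j] is the value on
   the pair of the i-th and j-th coordinate vector fields. *)
Definition ext_d (w : one_form) : tensor2 := fun p =>
  \matrix_(i, j) (partial i (fun y => w y j 0) p - partial j (fun y => w y i 0) p).

Definition wedge (a b : 'cV[R]_n.+1) : 'M[R]_n.+1 := a *m b^T - b *m a^T.

Definition sprod (a b : 'cV[R]_n.+1) : 'M[R]_n.+1 :=
  2^-1 *: (a *m b^T + b *m a^T).

Definition distribution := pt -> set 'rV[R]_n.+1.

Definition rank_distribution (k : nat) (M : set pt) (D : distribution) :=
  forall p, M p -> exists (U : set pt) (X : 'I_k -> vector_field),
    [/\ open U, U p, forall i, smooth_vf U (X i) &
      forall y, U y -> free [tuple X i y | i < k] /\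
        D y = [set v | v \in <<[tuple X i y | i < k]>>%VS]].

Definition section_of (U : set pt) (D : distribution) (X : vector_field) :=
  smooth_vf U X /\ forall p, U p -> D p (X p).

Definition linear_span (S : set 'rV[R]_n.+1) : set 'rV[R]_n.+1 :=
  [set v | exists s : seq 'rV[R]_n.+1, (forall u, u \in s -> S u) /\ v \in span s].

(* [[D, E]] at p: the span of the values at p of the brackets of local sections
   of D with local sections of E. *)
Definition bracket_distribution (D E : distribution) : distribution := fun p =>
  linear_span [set v | exists (U : set pt) (X Y : vector_field),
    [/\ open U, U p, section_of U D X, section_of U E Y & v = lie_bracket X Y p]].

Definition spans_annihilator (M : set pt) (D : distribution) (s : seq one_form) :=
  forall p, M p -> forall a : 'cV[R]_n.+1,
    (forall v, D p v -> v *m a = 0) <-> a \in <<[seq w p | w : one_form <- s]>>%VS.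

Definition christoffel (g : tensor2) (k i j : 'I_n.+1) : scalar_field := fun p =>
  2^-1 * \sum_l invmx (g p) k l *
    (partial i (fun y => g y j l) p + partial j (fun y => g y i l) p
     - partial l (fun y => g y i j) p).

(* R^l_{kij}, the d_l-component of R(d_i, d_j) d_k for the Levi-Civita
   connection. *)
Definition riemann_up (g : tensor2) (l k i j : 'I_n.+1) : scalar_field := fun p =>
  partial i (christoffel g l j k) p - partial j (christoffel g l i k) p
  + \sum_m (christoffel g l i m p * christoffel g m j k p
            - christoffel g l j m p * christoffel g m i k p).

Definition riemann (g : tensor2) (l k i j : 'I_n.+1) : scalar_field := fun p =>
  \sum_m g p l m * riemann_up g m k i j p.

Definition ricci (g : tensor2) (k j : 'I_n.+1) : scalar_field := fun p =>
  \sum_i riemann_up g i k i j p.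

Definition scalar_curvature (g : tensor2) : scalar_field := fun p =>
  \sum_k \sum_j invmx (g p) k j * ricci g k j p.

Definition weyl (g : tensor2) (l k i j : 'I_n.+1) : scalar_field := fun p =>
  let N : R := n.+1%:R in
  riemann g l k i j p
  - (N - 2)^-1 * (g p l i * ricci g k j p - g p l j * ricci g k i p
                  - g p k i * ricci g l j p + g p k j * ricci g l i p)
  + scalar_curvature g p / ((N - 1) * (N - 2))
    * (g p l i * g p k j - g p l j * g p k i).

(* Around each point there are coordinates y_i, i.e. functions with linearly
   independent differentials, in which g is a multiple of a constant
   pseudo-Euclidean metric. *)
Definition conformally_flat (M : set pt) (g : tensor2) :=
  forall p, M p -> exists (U : set pt) (y : 'I_n.+1 -> scalar_field)
      (lambda : scalar_field) (eps : 'I_n.+1 -> R),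
    [/\ [/\ open U, U p & U `<=` M],
        (forall i, smooth U (y i)) /\ smooth U lambda,
        forall i, eps i = 1 \/ eps i = -1 &
        forall z, U z ->
          [/\ free [tuple differential (y i) z | i < n.+1], lambda z != 0 &
              g z = lambda z *: \sum_i eps i *:
                      sprod (differential (y i) z) (differential (y i) z)]].

Definition infinitesimal_symmetry (U : set pt) (D : distribution) (X : vector_field) :=
  smooth_vf U X /\
  forall (V : set pt) (Y : vector_field), open V -> V `<=` U ->
    section_of V D Y -> forall p, V p -> D p (lie_bracket X Y p).

(* For every p in M, the Lie algebra of germs at p of infinitesimal symmetries
   of D is isomorphic to the Lie algebra G of endomorphisms of V (with the
   commutator as bracket).  The isomorphism is given by representatives [rho a]
   on a fixed ball; uniqueness and existence of [a] on all smaller balls express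
   injectivity and surjectivity onto germs. *)
Definition local_symmetry_algebra (M : set pt) (D : distribution)
    (V : vectType R) (G : set 'End(V)) :=
  forall p, M p -> exists (r : R) (rho : 'End(V) -> vector_field),
    [/\ 0 < r /\ ball p r `<=` M,
        forall a, G a -> infinitesimal_symmetry (ball p r) D (rho a),
        forall (c : R) a b, G a -> G b -> forall y, ball p r y ->
          rho (c *: a + b) y = c *: rho a y + rho b y,
        forall a b, G a -> G b -> forall y, ball p r y ->
          rho ((a \o b)%VF - (b \o a)%VF) y = lie_bracket (rho a) (rho b) y &
        forall s, 0 < s -> s <= r -> forall X,
          infinitesimal_symmetry (ball p s) D X ->
          exists! a, G a /\ forall y, ball p s y -> X y = rho a y].

End Calculus.

Arguments scalar_field : clear implicits.
Arguments vector_field : clear implicits.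
Arguments one_form : clear implicits.
Arguments tensor2 : clear implicits.
Arguments distribution : clear implicits.

Section SplitG2.
Variable R : realType.

Definition split_octonion : vectType R := ('M[R]_2 * 'M[R]_2)%type.

(* Cayley-Dickson double of the split quaternions M_2(R), whose conjugation is
   the adjugate. *)
Definition oct_mul (x y : split_octonion) : split_octonion :=
  (x.1 *m y.1 + \adj y.2 *m x.2, y.2 *m x.1 + x.2 *m \adj y.1).

(* These derivations form the split real form of g_2. *)
Definition split_g2 : set 'End(split_octonion) :=
  [set d | forall x y, d (oct_mul x y) = oct_mul (d x) y + oct_mul x (d y)].

End SplitG2.

Arguments split_g2 : clear implicits.

Section Distributions235.
Context {R : realType}.
Local Notation pt := 'rV[R]_5.
Local Notation form := (one_form R 4).

Definition is_235 (M : set pt) (D : distribution R 4) :=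
  let D1 := bracket_distribution D D in
  [/\ rank_distribution 2 M D, rank_distribution 3 M D1 &
      forall p, M p -> bracket_distribution D1 D p = setT].

Definition cartan_structure_equations (U : set pt)
    (t1 t2 t3 t4 t5 O1 O2 O3 O4 O5 O6 O7 : form) :=
  forall p, U p ->
  [/\ ext_d t1 p = wedge (t1 p) (2 *: O1 p + O4 p) + wedge (t2 p) (O2 p)
                   + wedge (t3 p) (t4 p),
      ext_d t2 p = wedge (t1 p) (O3 p) + wedge (t2 p) (O1 p + 2 *: O4 p)
                   + wedge (t3 p) (t5 p),
      ext_d t3 p = wedge (t1 p) (O5 p) + wedge (t2 p) (O6 p)
                   + wedge (t3 p) (O1 p + O4 p) + wedge (t4 p) (t5 p),
      ext_d t4 p = wedge (t1 p) (O7 p) + (4 / 3) *: wedge (t3 p) (O6 p)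
                   + wedge (t4 p) (O1 p) + wedge (t5 p) (O2 p) &
      ext_d t5 p = wedge (t2 p) (O7 p) - (4 / 3) *: wedge (t3 p) (O5 p)
                   + wedge (t4 p) (O3 p) + wedge (t5 p) (O4 p)].

Definition cartan_coframe (U : set pt) (D : distribution R 4)
    (t1 t2 t3 t4 t5 : form) :=
  [/\ [/\ smooth_form U t1, smooth_form U t2, smooth_form U t3, smooth_form U t4
        & smooth_form U t5],
      forall p, U p -> free [:: t1 p; t2 p; t3 p; t4 p; t5 p],
      forall p, U p ->
        D p = [set v | [/\ v *m t1 p = 0, v *m t2 p = 0 & v *m t3 p = 0]] &
      exists O1 O2 O3 O4 O5 O6 O7 : form,
        [/\ smooth_form U O1, smooth_form U O2, smooth_form U O3
          & smooth_form U O4] /\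
        [/\ smooth_form U O5, smooth_form U O6 & smooth_form U O7] /\
        cartan_structure_equations U t1 t2 t3 t4 t5 O1 O2 O3 O4 O5 O6 O7].

Definition nurowski_metric (t1 t2 t3 t4 t5 : form) : tensor2 R 4 := fun p =>
  2 *: sprod (t1 p) (t5 p) - 2 *: sprod (t2 p) (t4 p)
  + (4 / 3) *: sprod (t3 p) (t3 p).

Definition represents_nurowski_class (M : set pt) (D : distribution R 4)
    (g : tensor2 R 4) :=
  forall p, M p -> exists (U : set pt) (t1 t2 t3 t4 t5 : form) (lambda : pt -> R),
    [/\ [/\ open U, U p & U `<=` M], cartan_coframe U D t1 t2 t3 t4 t5,
        smooth U lambda &
        forall y, U y ->
          lambda y != 0 /\ g y = lambda y *: nurowski_metric t1 t2 t3 t4 t5 y].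

Definition maximally_symmetric (M : set pt) (D : distribution R 4) :=
  exists g, represents_nurowski_class M D g /\
    forall l k i j p, M p -> weyl g l k i j p = 0.

End Distributions235.

(* Coordinates on R^5 are ordered as (psi, theta, phi, x, q). *)

Section Rolling.
Context {R : realType}.
Local Notation pt := 'rV[R]_5.
Local Notation form := (one_form R 4).
Local Notation vf := (vector_field R 4).

Definition i_psi : 'I_5 := @Ordinal 5 0 isT.
Definition i_theta : 'I_5 := @Ordinal 5 1 isT.
Definition i_phi : 'I_5 := @Ordinal 5 2 isT.
Definition i_x : 'I_5 := @Ordinal 5 3 isT.
Definition i_q : 'I_5 := @Ordinal 5 4 isT.

Definition psi (p : pt) : R := p 0 i_psi.
Definition theta (p : pt) : R := p 0 i_theta.
Definition xx (p : pt) : R := p 0 i_x.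

Definition d_psi : 'cV[R]_5 := delta_mx i_psi 0.
Definition d_theta : 'cV[R]_5 := delta_mx i_theta 0.
Definition d_phi : 'cV[R]_5 := delta_mx i_phi 0.
Definition d_x : 'cV[R]_5 := delta_mx i_x 0.
Definition d_q : 'cV[R]_5 := delta_mx i_q 0.

Definition v_psi : 'rV[R]_5 := delta_mx 0 i_psi.
Definition v_theta : 'rV[R]_5 := delta_mx 0 i_theta.
Definition v_phi : 'rV[R]_5 := delta_mx 0 i_phi.
Definition v_x : 'rV[R]_5 := delta_mx 0 i_x.
Definition v_q : 'rV[R]_5 := delta_mx 0 i_q.

Definition domain : set pt :=
  [set p | sin (theta p) != 0 /\ cos (xx p / 3) != 0].

Definition sigma1 : form := fun p =>
  sin (psi p) *: d_theta - (cos (psi p) * sin (theta p)) *: d_phi.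
Definition sigma2 : form := fun p =>
  cos (psi p) *: d_theta + (sin (psi p) * sin (theta p)) *: d_phi.
Definition sigma3 : form := fun p => - d_psi - cos (theta p) *: d_phi.

Definition E1 : vf := fun p =>
  sin (psi p) *: v_theta
  + cos (psi p) *: ((cos (theta p) / sin (theta p)) *: v_psi
                    - (sin (theta p))^-1 *: v_phi).
Definition E2 : vf := fun p =>
  cos (psi p) *: v_theta
  - sin (psi p) *: ((cos (theta p) / sin (theta p)) *: v_psi
                    - (sin (theta p))^-1 *: v_phi).
Definition E3 : vf := fun=> - v_psi.

Definition X1 : vf := fun p => v_x + E2 p.
Definition X2 : vf := fun p =>
  v_q + cos (xx p / 3) *: E1 p - (3^-1 * sin (xx p / 3)) *: E3 p.
Definition D_R : distribution R 4 := fun p =>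
  [set v | v \in <<[:: X1 p; X2 p]>>%VS].

Definition X1t : vf := fun p => v_x - E2 p.
Definition X2t : vf := fun p =>
  v_q - cos (xx p / 3) *: E1 p - (3^-1 * sin (xx p / 3)) *: E3 p.
Definition Dt_R : distribution R 4 := fun p =>
  [set v | v \in <<[:: X1t p; X2t p]>>%VS].

Definition o1 : form := fun p => sigma1 p - cos (xx p / 3) *: d_q.
Definition o2 : form := fun p => sigma2 p - d_x.
Definition o3 : form := fun p => sigma3 p + (3^-1 * sin (xx p / 3)) *: d_q.
Definition o4 : form := fun=> - d_x.
Definition o5 : form := fun p => cos (xx p / 3) *: d_q.

Definition o1t : form := fun p => sigma1 p + cos (xx p / 3) *: d_q.
Definition o2t : form := fun p => sigma2 p + d_x.
Definition o3t : form := o3.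

Definition f_roll (t : R) : R := - sin t.
Definition h_roll (x : R) : R := cos (x / 3).

Definition chi1 : form := fun=> d_theta.
Definition chi2 : form := fun p => f_roll (theta p) *: d_phi.
Definition chi3 : form := fun=> d_x.
Definition chi4 : form := fun p => h_roll (xx p) *: d_q.

Definition omega1 : form := fun p =>
  chi1 p - cos (psi p) *: chi3 p - sin (psi p) *: chi4 p.
Definition omega2 : form := fun p =>
  chi2 p + sin (psi p) *: chi3 p - cos (psi p) *: chi4 p.
Definition omega3 : form := fun p =>
  d_psi + (derive1 h_roll (xx p) / h_roll (xx p)) *: chi4 p
  - (derive1 f_roll (theta p) / f_roll (theta p)) *: chi2 p.

Local Notation sq w p := (sprod (w p) (w p)).

Definition g_R : tensor2 R 4 := fun p =>
  (- 2) *: (sq o4 p + sq o5 p)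
  + 2^-1 *: (sq o1t p + sq o2t p + sq o3t p)
  + (sq o1 p + sq o2 p + sq o3 p).

Definition g_rolling : tensor2 R 4 := fun p =>
  sq chi1 p + sq chi2 p - (sq chi3 p + sq chi4 p)
  + 2^-1 *: (sq omega1 p + sq omega2 p) + (3 / 2) *: sq omega3 p.

End Rolling.

(* Main.v *)
Require Import Defs.
From HB Require Import structures.
From mathcomp Require Import all_boot all_order all_algebra.
From mathcomp Require Import all_classical all_reals all_analysis.
From mathcomp Require Import ring lra.
Set Implicit Arguments. Unset Strict Implicit. Unset Printing Implicit Defensive.
Import Order.TTheory GRing.Theory Num.Theory.
Import numFieldNormedType.Exports.
Local Open Scope classical_set_scope.
Local Open Scope ring_scope.

(* The point (psi, theta, phi, x, q) is sent to the line of imaginary split octonions spanned by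
   (r e3 r^*, s r^* ), where the unit quaternion r depends on (x, q) only and s on the Euler angles.
   The norm of the split octonions has opposite signs on the two summands, so this vector Y is null, and
   it turns out that g_R is -6 times the norm evaluated on dY, while D_R consists of the directions v with
   Y dY(v) = 0, i.e. those for which Y and dY(v) span a subalgebra with zero product.

   In an affine chart of the projectivised null cone these directions form the (2,3,5)-distribution with
   polynomial coefficients whose adapted coframe satisfies Cartan's structure equations with all
   Omega_i = 0 and whose Nurowski metric is flat; this gives the conformal class and its flatness.  The
   Weyl tensor of g_R vanishes by the Gauss equation, since g_R is induced on a section of a null cone of
   a flat space.  Derivations of the split octonions act on the null cone by infinitesimal symmetries;
   conversely, the symmetry equations prolong to a closed linear system for 14 functions, so a symmetry is
   determined by 14 numbers at a point, and 14 is the dimension of the algebra of derivations. *)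

(** * Smooth functions and directional derivatives *)

(** The ratio 1:3 of the two spheres enters through quaternions. The sphere with metric [chi3]^2 +
    [chi4]^2 has radius 3 and unit normal r e3 r^-1. With x = r^-1 dr and x + y = s^-1 ds, the
    equations of [D_R] read y = 2 x1 e1 + 2 x2 e2, and this is what makes the product of Y and dY
    vanish.

    Conformal flatness and the vanishing of the Weyl tensor are proved separately. Deducing one from
    the other would require the behaviour of curvature under changes of coordinates and of scale,
    while the Gauss equation works in the given coordinates: one of the two null normals contributes
    only the metric itself, so the curvature is pure trace.

    No single affine chart covers the cone. An automorphism of the octonions of order 6 moves any
    point into the chart where a fixed coordinate is nonzero.

    The number 14 arises as 2+1+2+4+2+1+2, the graded dimensions of g2. Both the closed system and
    the explicit family of derivations have 14 parameters, so injectivity alone gives surjectivity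
    onto germs of symmetries. *)

Section Partials.
Context {R : realType} {n : nat}.
Local Notation pt := 'rV[R]_n.+1.
Implicit Types (U V : set pt) (f g : pt -> R) (i j : 'I_n.+1) (p : pt).

Lemma partial_cst i (c : R) p : partial i (fun=> c) p = 0.
Proof. exact: derive_cst. Qed.

Lemma partialD i f g p : differentiable f p -> differentiable g p ->
  partial i (fun z => f z + g z) p = partial i f p + partial i g p.
Proof. by move=> df dg; apply: deriveD; exact: diff_derivable. Qed.

Lemma partialN i f p : differentiable f p ->
  partial i (fun z => - f z) p = - partial i f p.
Proof. by move=> df; apply: deriveN; exact: diff_derivable. Qed.

Lemma partialB i f g p : differentiable f p -> differentiable g p ->
  partial i (fun z => f z - g z) p = partial i f p - partial i g p.
Proof. by move=> df dg; apply: deriveB; exact: diff_derivable. Qed.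

Lemma partialM i f g p : differentiable f p -> differentiable g p ->
  partial i (fun z => f z * g z) p = partial i f p * g p + f p * partial i g p.
Proof.
move=> df dg; have df' : derivable f p (delta_mx 0 i) by exact: diff_derivable.
have dg' : derivable g p (delta_mx 0 i) by exact: diff_derivable.
refine (etrans (deriveM df' dg') _).
by rewrite /GRing.scale /= addrC [g p * _]mulrC.
Qed.

Lemma partialV i f p : differentiable f p -> f p != 0 ->
  partial i (fun z => (f z)^-1) p = - ((f p)^-1 * (f p)^-1) * partial i f p.
Proof.
move=> df f0; have df' : derivable f p (delta_mx 0 i) by exact: diff_derivable.
refine (etrans (deriveV f0 df') _).
by rewrite expr2 invfM.
Qed.

Lemma partial_sum i (I : eqType) (s : seq I) (F : I -> pt -> R) p :
  (forall k, differentiable (F k) p) ->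
  partial i (fun z => \sum_(k <- s) F k z) p = \sum_(k <- s) partial i (F k) p.
Proof.
move=> dF; suff: differentiable (fun z => \sum_(k <- s) F k z) p /\
  partial i (fun z => \sum_(k <- s) F k z) p = \sum_(k <- s) partial i (F k) p by case.
elim: s => [|k s [IHd IH]].
  under eq_fun do rewrite big_nil.
  by rewrite big_nil partial_cst; split=> //; exact: differentiable_cst.
under eq_fun do rewrite big_cons.
rewrite big_cons partialD // IH; split => //.
exact: differentiableD.
Qed.

Lemma partial_near i U f g p : open U -> U p -> (forall z, U z -> f z = g z) ->
  partial i f p = partial i g p.
Proof.
move=> oU Up fg; apply: near_eq_derive.
by apply: filterS (open_nbhs_nbhs (conj oU Up)) => z /fg.
Qed.

(** [g] is [f] plus a function vanishing near [p]; the differential of the latter is the zero map,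
    by uniqueness of the differential. *)
Lemma near_differentiable U f g p : open U -> U p ->
  (forall z, U z -> f z = g z) -> differentiable f p -> differentiable g p.
Proof.
move=> oU Up fg df.
have Efg : g = f + (fun z => g z - f z) by apply/funext => z; rewrite /GRing.add/= addrC subrK.
rewrite Efg; apply: differentiableD => //; set h := fun z => g z - f z.
have nh : \forall z \near p, h z = 0.
  by apply: filterS (open_nbhs_nbhs (conj oU Up)) => z /fg; rewrite /h => ->; rewrite subrr.
have hp : h p = 0 by exact: nbhs_singleton nh.
pose z0 : {linear pt -> R^o} := \0.
have ho : (h : pt -> R^o) \o shift p = cst (h p : R^o) + z0 +o_ (0 : pt) id.
  apply/eqaddoP => _/posnumP[e]; rewrite hp.
  have : \forall z \near (0 : pt), h (z + p) = 0 by move: nh; rewrite [X in X -> _](near_shift (0 : pt)) subr0.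
  apply: filterS => z /= hz; rewrite /GRing.add /GRing.opp /GRing.zero /=.
  by rewrite hz !addr0 subr0 normr0 mulr_ge0.
have z0c : continuous z0 by move=> x; exact: cst_continuous.
have h0 := diff_unique z0c ho.
by apply/diff_locallyP; rewrite h0; split.
Qed.

End Partials.

(** * Closure properties of smooth functions *)

Section Smooth.
Context {R : realType} {n : nat}.
Local Notation pt := 'rV[R]_n.+1.
Implicit Types (U V : set pt) (f g : pt -> R) (i j : 'I_n.+1) (p : pt).

Lemma iter_partial_rcons s i f :
  iter_partial (rcons s i) f = iter_partial s (partial i f) :> (pt -> R).
Proof. by elim: s => //= j s ->. Qed.

Lemma iter_partial_near U s f g : open U -> (forall z, U z -> f z = g z) ->
  forall z, U z -> iter_partial s f z = iter_partial s g z.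
Proof.
move=> oU fg; elim: s => //= i s IH z Uz.
exact: partial_near oU Uz IH.
Qed.

Lemma smooth_near U f g : open U -> (forall z, U z -> f z = g z) ->
  smooth U f -> smooth U g.
Proof.
move=> oU fg sf s p Up; apply: (near_differentiable oU Up _ (sf s p Up)).
exact: iter_partial_near.
Qed.

Lemma smooth_sub U V f : V `<=` U -> smooth U f -> smooth V f.
Proof. by move=> VU sf s p /VU; exact: sf. Qed.

Lemma smooth_partial U i f : smooth U f -> smooth U (partial i f).
Proof. by move=> sf s p Up; rewrite -iter_partial_rcons; exact: sf. Qed.

Lemma smooth_differentiable U f p : smooth U f -> U p -> differentiable f p.
Proof. by move=> sf; exact: (sf [::]). Qed.

(** A filtration of [smooth] by the order of differentiation. The lists in [smooth] do not lend
    themselves to proofs about products, inverses and compositions, which go by induction on the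
    order. *)
Fixpoint Ck U (k : nat) f : Prop :=
  (forall p, U p -> differentiable f p) /\
  if k is k'.+1 then forall i, Ck U k' (partial i f) else True.

Lemma smoothE U f : smooth U f <-> forall k, Ck U k f.
Proof.
split=> [sf k|Cf].
  elim: k f sf => [|k IH] f sf /=; split=> //.
  - by move=> p; exact: smooth_differentiable.
  - by move=> p; exact: smooth_differentiable.
  - by move=> i; apply/IH/smooth_partial.
(* Induction on the length: it is the last, innermost derivative of the list that has to be split
   off. *)
move=> s; elim: (size s) {-2}s (erefl (size s)) f Cf => {s} [|k IH] s.
  by move=> /size0nil -> f /(_ 0%N)[].
case/lastP: s => // s i; rewrite size_rcons => -[ss] f Cf p Up.
rewrite iter_partial_rcons; apply: (IH s ss) (Up) => m.
by case: (Cf m.+1) => _; apply.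
Qed.

Lemma Ck_near U k f g : open U -> (forall z, U z -> f z = g z) ->
  Ck U k f -> Ck U k g.
Proof.
move=> oU; elim: k f g => [|k IH] f g fg /= [df Cf]; split=> //.
- by move=> p Up; exact: (near_differentiable oU Up fg (df p Up)).
- by move=> p Up; exact: (near_differentiable oU Up fg (df p Up)).
- move=> i; apply: IH (Cf i) => z Uz; exact: partial_near oU Uz fg.
Qed.

Lemma CkW U k f : Ck U k.+1 f -> Ck U k f.
Proof.
elim: k f => [|k IH] f /= [df Cf]; split=> // i; exact/IH/Cf.
Qed.

Lemma Ck_cst U k (c : R) : Ck U k (fun=> c).
Proof.
elim: k c => [|k IH] c /=; split=> //; try by move=> p _; exact: differentiable_cst.
move=> i; by rewrite (_ : partial i _ = fun=> 0) //; apply/funext => p; exact: partial_cst.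
Qed.

Lemma CkD U k f g : open U -> Ck U k f -> Ck U k g -> Ck U k (fun z => f z + g z).
Proof.
move=> oU; elim: k f g => [|k IH] f g /= [df Cf] [dg Cg]; split=> //.
- by move=> p Up; apply: differentiableD; [exact: df|exact: dg].
- by move=> p Up; apply: differentiableD; [exact: df|exact: dg].
- move=> i; apply: Ck_near (IH _ _ (Cf i) (Cg i)) => // z Uz.
  by rewrite partialD//; [exact: df|exact: dg].
Qed.

(** The derivative of a product contains the factors themselves, now needed to one order less: hence
    [CkW]. *)
Lemma CkM U k f g : open U -> Ck U k f -> Ck U k g -> Ck U k (fun z => f z * g z).
Proof.
move=> oU; elim: k f g => [|k IH] f g Cf0 Cg0; have [/= df Cf] := Cf0;
  have [/= dg Cg] := Cg0; split=> //.
- by move=> p Up; apply: differentiableM; [exact: df|exact: dg].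
- by move=> p Up; apply: differentiableM; [exact: df|exact: dg].
- move=> i; have := CkD oU (IH _ _ (Cf i) (CkW Cg0)) (IH _ _ (CkW Cf0) (Cg i)).
  apply: Ck_near => // z Uz.
  by rewrite partialM//; [exact: df|exact: dg].
Qed.

Lemma CkV U k f : open U -> (forall p, U p -> f p != 0) -> Ck U k f ->
  Ck U k (fun z => (f z)^-1).
Proof.
move=> oU f0; elim: k => [|k IH] Cf0; have [/= df Cf] := Cf0; split=> //.
- by move=> p Up; apply: differentiableV; [exact: df|exact: f0].
- by move=> p Up; apply: differentiableV; [exact: df|exact: f0].
- move=> i; have Ci := IH (CkW Cf0).
  have := CkM oU (CkM oU (Ck_cst U k (-1)) (CkM oU Ci Ci)) (Cf i).
  apply: Ck_near => // z Uz.
  by rewrite partialV ?mulN1r//; [exact: df|exact: f0].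
Qed.

Lemma smooth_cst U (c : R) : smooth U (fun=> c).
Proof. by apply/smoothE => k; exact: Ck_cst. Qed.

Lemma smoothD U f g : open U -> smooth U f -> smooth U g ->
  smooth U (fun z => f z + g z).
Proof. by move=> oU /smoothE sf /smoothE sg; apply/smoothE => k; exact: CkD. Qed.

Lemma smoothM U f g : open U -> smooth U f -> smooth U g ->
  smooth U (fun z => f z * g z).
Proof. by move=> oU /smoothE sf /smoothE sg; apply/smoothE => k; exact: CkM. Qed.

Lemma smoothZ U c f : open U -> smooth U f -> smooth U (fun z => c * f z).
Proof. by move=> oU sf; apply: smoothM => //; exact: smooth_cst. Qed.

Lemma smoothN U f : open U -> smooth U f -> smooth U (fun z => - f z).
Proof.
move=> oU sf; refine (smooth_near oU _ (smoothZ (-1) oU sf)) => z _.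
by rewrite mulN1r.
Qed.

Lemma smoothB U f g : open U -> smooth U f -> smooth U g ->
  smooth U (fun z => f z - g z).
Proof. by move=> oU sf sg; apply: smoothD => //; exact: smoothN. Qed.

Lemma smoothV U f : open U -> (forall p, U p -> f p != 0) -> smooth U f ->
  smooth U (fun z => (f z)^-1).
Proof. by move=> oU f0 /smoothE sf; apply/smoothE => k; exact: CkV. Qed.

Lemma smooth_sum U (I : Type) (s : seq I) (P : pred I) (F : I -> pt -> R) :
  open U -> (forall k, P k -> smooth U (F k)) -> smooth U (fun z => \sum_(k <- s | P k) F k z).
Proof.
move=> oU sF; elim: s => [|k s IH].
  by refine (smooth_near oU _ (smooth_cst (U:=U) 0)) => z _; rewrite big_nil.
case Pk: (P k).
  by refine (smooth_near oU _ (smoothD oU (sF k Pk) IH)) => z _; rewrite big_cons Pk.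
by refine (smooth_near oU _ IH) => z _; rewrite big_cons Pk.
Qed.

Lemma smooth_prod U (I : Type) (s : seq I) (F : I -> pt -> R) :
  open U -> (forall k, smooth U (F k)) -> smooth U (fun z => \prod_(k <- s) F k z).
Proof.
move=> oU sF; elim: s => [|k s IH].
  by refine (smooth_near oU _ (smooth_cst (U:=U) 1)) => z _; rewrite big_nil.
by refine (smooth_near oU _ (smoothM oU (sF k) IH)) => z _; rewrite big_cons.
Qed.

Lemma differentiable_coordinate i p : differentiable (fun z : pt => z 0 i) p.
Proof. exact: differentiable_coord. Qed.

Lemma partial_coordinate i j p : partial i (fun z : pt => z 0 j) p = (i == j)%:R.
Proof.
rewrite /partial deriveE; last exact: differentiable_coordinate.
pose f (z : pt) := z 0 j.
have fl : linear (f : pt -> R^o) by move=> c x y; rewrite /f !mxE.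
pose flM := GRing.isLinear.Build _ _ _ _ _ fl.
pose fL : {linear pt -> R^o} := HB.pack f flM.
rewrite -[fun z => _]/(fL : pt -> R^o) diff_lin; last exact: coord_continuous.
by rewrite /= /f mxE eqxx eq_sym.
Qed.

Lemma smooth_coordinate U i : smooth U (fun z : pt => z 0 i).
Proof.
apply/smoothE => -[|k] /=; split=> //; try by move=> p _; exact: differentiable_coordinate.
by move=> j; rewrite (_ : partial j _ = fun=> (j == i)%:R);
  [exact: Ck_cst|apply/funext => p; exact: partial_coordinate].
Qed.

Lemma differentiable_compR (h : R -> R) f p : derivable h (f p) 1 ->
  differentiable f p -> differentiable (fun z => h (f z)) p.
Proof. by move=> /derivable1_diffP dh df; exact: differentiable_comp. Qed.

Lemma partial_compR i (h : R -> R) (dh : R) f p : is_derive (f p) 1 h dh ->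
  differentiable f p -> partial i (fun z => h (f z)) p = dh * partial i f p.
Proof.
move=> hd df; have dhf : derivable h (f p) 1 by [].
have dh' : differentiable h (f p) by exact/derivable1_diffP.
rewrite /partial deriveE; last exact: differentiable_compR.
transitivity ('d h (f p) ('d f p (delta_mx 0 i))).
  by rewrite -[fun z => _]/(h \o f) diff_comp.
rewrite (deriveE _ df) [RHS]mulrC; set w := 'd f p _.
have /(congr1 (fun F => F w)) /= -> := deriv1E dhf.
by rewrite derive1E derive_val.
Qed.

Lemma partial_sin i f p : differentiable f p ->
  partial i (fun z => sin (f z)) p = cos (f p) * partial i f p.
Proof. exact: partial_compR. Qed.

Lemma partial_cos i f p : differentiable f p ->
  partial i (fun z => cos (f z)) p = - sin (f p) * partial i f p.
Proof. exact: partial_compR. Qed.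

Lemma differentiable_sin f p : differentiable f p -> differentiable (fun z => sin (f z)) p.
Proof. by apply: differentiable_compR; exact: derivable_sin. Qed.

Lemma differentiable_cos f p : differentiable f p -> differentiable (fun z => cos (f z)) p.
Proof. by apply: differentiable_compR; exact: derivable_cos. Qed.

(** Sine and cosine need a simultaneous induction, since differentiating one produces the other. *)
Lemma Ck_trig U k f : open U -> smooth U f ->
  Ck U k (fun z => sin (f z)) /\ Ck U k (fun z => cos (f z)).
Proof.
move=> oU sf; have df p : U p -> differentiable f p by exact: smooth_differentiable.
elim: k => [|k [IHs IHc]] /=; do 2![split].
- by move=> p /df; exact: differentiable_sin.
- by [].
- by move=> p /df; exact: differentiable_cos.
- by [].
- by move=> p /df; exact: differentiable_sin.
- move=> i; have /smoothE/(_ k) Cf := smooth_partial i sf.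
  apply: Ck_near (CkM oU IHc Cf) => // z Uz; rewrite partial_sin//; exact: df.
- by move=> p /df; exact: differentiable_cos.
- move=> i; have /smoothE/(_ k) Cf := smooth_partial i sf.
  apply: Ck_near (CkM oU (CkM oU (Ck_cst U k (-1)) IHs) Cf) => // z Uz.
  rewrite partial_cos ?mulN1r//; exact: df.
Qed.

Lemma smooth_sin U f : open U -> smooth U f -> smooth U (fun z => sin (f z)).
Proof. by move=> oU sf; apply/smoothE => k; case: (Ck_trig k oU sf). Qed.

Lemma smooth_cos U f : open U -> smooth U f -> smooth U (fun z => cos (f z)).
Proof. by move=> oU sf; apply/smoothE => k; case: (Ck_trig k oU sf). Qed.

Lemma smooth_det U m (A : pt -> 'M[R]_m) : open U ->
  (forall k l : 'I_m, smooth U (fun z => A z k l)) -> smooth U (fun z => \det (A z)).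
Proof.
move=> oU sA; apply: smooth_sum => // s _; apply: smoothZ => //.
by apply: smooth_prod.
Qed.

(** Cramer's rule: the entries of the inverse are cofactors divided by the determinant. *)
Lemma smooth_invmx U m (A : pt -> 'M[R]_m) : open U ->
  (forall k l : 'I_m, smooth U (fun z => A z k l)) -> (forall z, U z -> A z \in unitmx) ->
  forall k l : 'I_m, smooth U (fun z => invmx (A z) k l).
Proof.
move=> oU sA uA k l.
refine (@smooth_near _ (fun z => (\det (A z))^-1 * cofactor (A z) l k) _ oU _ _).
  by move=> z Uz; rewrite /invmx uA// !mxE.
apply: smoothM => //.
  apply: smoothV => //; last exact: smooth_det.
  by move=> z /uA; rewrite unitmxE unitfE.
apply: smoothZ => //; apply: smooth_det => // a b.
by rewrite (_ : (fun z => _) = fun z => A z (lift l a) (lift k b)) //;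
   apply/funext => z; rewrite !mxE.
Qed.

End Smooth.

(** * Derivatives along vector fields and symmetry of second derivatives *)

Section Directional.
Context {R : realType} {n : nat}.
Local Notation pt := 'rV[R]_n.+1.
Implicit Types (U V : set pt) (f g : pt -> R) (i j : 'I_n.+1) (p : pt).
Implicit Types X Y : vector_field R n.

Lemma is_derive_line f (q v : pt) (t : R) : differentiable f (q + t *: v) ->
  is_derive t 1 (fun s : R => f (q + s *: v)) ('D_v f (q + t *: v)).
Proof.
move=> df.
have E : (fun h : R => h^-1 *: (((fun s : R => f (q + s *: v)) \o shift t) (h *: 1) - f (q + t *: v)))
   = (fun h : R => h^-1 *: ((f \o shift (q + t *: v)) (h *: v) - f (q + t *: v))).
  apply/funext => h /=; congr (_ *: (f _ - _)).
  by rewrite /GRing.scale /= mulr1 -/(GRing.scale _ _) scalerDl addrCA.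
have dv : derivable f (q + t *: v) v by exact: diff_derivable.
apply: DeriveDef; last by rewrite /derive E.
by rewrite /derivable E.
Qed.

Lemma mx_ballP p (r : R) (y : pt) : 0 < r -> (forall i, `|p 0 i - y 0 i| < r) -> ball p r y.
Proof. by move=> r0 H; split=> // a b; rewrite ord1; exact: H. Qed.

Lemma mx_ballE p (r : R) (y : pt) i : ball p r y -> `|p 0 i - y 0 i| < r.
Proof. by case=> _ /(_ 0 i). Qed.

(** The alternating sum of [f] over the corners of a parallelogram. It is symmetric in [i] and [j],
    which is the source of [partialC]. *)
Let second_difference f p i j (h : R) :=
  f (p + h *: delta_mx 0 i + h *: delta_mx 0 j) - f (p + h *: delta_mx 0 i)
  - f (p + h *: delta_mx 0 j) + f p.

(** Two uses of the mean value theorem: first for the increment in direction [j] as a function of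
    the displacement in direction [i], then for the partial derivative so obtained. *)
Let second_difference_MVT f p i j (r h : R) : smooth (ball p r) f -> 0 < h -> h + h < r ->
  exists y, ball p r y /\ second_difference f p i j h = h * h * partial j (partial i f) y.
Proof.
move=> sf h0 hr; set ei : pt := delta_mx 0 i; set ej : pt := delta_mx 0 j.
have inb (c d : R) : 0 <= c <= h -> 0 <= d <= h -> ball p r (p + c *: ei + d *: ej).
  move=> /andP[c0 ch] /andP[d0 dh]; apply: mx_ballP => [|k]; first lra.
  rewrite !mxE /= opprD addrA opprD addrA subrr sub0r -opprD normrN.
  rewrite ger0_norm; last by rewrite addr_ge0// mulr_ge0.
  by case: (k == i); case: (k == j); rewrite /= ?mulr1 ?mulr0; lra.
pose phi (s : R) := f (p + h *: ej + s *: ei) - f (p + s *: ei).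
have Ein (s : R) : p + h *: ej + s *: ei = p + s *: ei + h *: ej by rewrite addrAC.
have in0 (s : R) : 0 <= s <= h -> ball p r (p + s *: ei).
  by move=> sh; have := inb s 0 sh; rewrite scale0r addr0; apply; apply/andP; split; lra.
have dphi (s : R) : 0 <= s <= h -> is_derive s 1 phi
    (partial i f (p + h *: ej + s *: ei) - partial i f (p + s *: ei)).
  move=> sh; apply: is_deriveB; apply: is_derive_line.
    by apply: smooth_differentiable sf _; rewrite Ein; apply: inb => //; apply/andP; split; lra.
  by apply: smooth_differentiable sf _; exact: in0.
have [s sh phiE] : exists2 s, s \in `[0, h]%R & phi h - phi 0 =
    (partial i f (p + h *: ej + s *: ei) - partial i f (p + s *: ei)) * (h - 0).
  apply: MVT_segment; first exact: ltW.
    by move=> x; rewrite in_itv/= => /andP[/ltW ? /ltW ?]; apply: dphi; exact/andP.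
  apply: derivable_within_continuous => x; rewrite in_itv/= => xh.
  by have := dphi x xh; case.
move: sh; rewrite in_itv/= => sh.
pose chi (u : R) := partial i f (p + s *: ei + u *: ej).
have dchi (u : R) : 0 <= u <= h -> is_derive u 1 chi (partial j (partial i f) (p + s *: ei + u *: ej)).
  move=> uh; apply: is_derive_line; apply: smooth_differentiable (smooth_partial i sf) _.
  exact: inb.
have [u uh chiE] : exists2 u, u \in `[0, h]%R & chi h - chi 0 =
    partial j (partial i f) (p + s *: ei + u *: ej) * (h - 0).
  apply: MVT_segment; first exact: ltW.
    by move=> x; rewrite in_itv/= => /andP[/ltW ? /ltW ?]; apply: dchi; exact/andP.
  apply: derivable_within_continuous => x; rewrite in_itv/= => xh.
  by have := dchi x xh; case.
move: uh; rewrite in_itv/= => uh.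
exists (p + s *: ei + u *: ej); split.
  exact: inb.
rewrite !subr0 in phiE chiE; rewrite mulrC mulrA -chiE.
move: phiE; rewrite /phi /chi !scale0r !addr0 -!Ein => phiE.
have -> : second_difference f p i j h = phi h - phi 0.
  by rewrite /second_difference /phi -Ein !scale0r !addr0 opprB addrA addrAC.
by rewrite /phi !scale0r !addr0 phiE.
Qed.

Let near_diff (a b c d e : R) : `|a - c| < e / 2 -> `|b - d| < e / 2 -> c = d -> `|a - b| <= e.
Proof.
rewrite !ltr_norml ler_norml => /andP[? ?] /andP[? ?] ?; apply/andP; split; lra.
Qed.

(** Schwarz: the same second difference equals the square of the side times either mixed derivative,
    at two points near [p]; continuity of both derivatives lets these points tend to [p]. *)
Lemma partialC U f p i j : open U -> smooth U f -> U p ->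
  partial i (partial j f) p = partial j (partial i f) p.
Proof.
move=> oU sf Up; apply/eqP; rewrite -subr_eq0 -normr_le0.
apply/ler_addgt0Pl => e e0; rewrite addr0.
have cij : {for p, continuous (partial i (partial j f))}.
  apply: differentiable_continuous.
  exact: (smooth_differentiable (smooth_partial i (smooth_partial j sf)) Up).
have cji : {for p, continuous (partial j (partial i f))}.
  apply: differentiable_continuous.
  exact: (smooth_differentiable (smooth_partial j (smooth_partial i sf)) Up).
have e2 : 0 < e / 2 by lra.
have nU : \forall y \near p, U y by exact: open_nbhs_nbhs.
have nij : \forall y \near p, `|partial i (partial j f) p - partial i (partial j f) y| < e / 2.
  by move/cvgrPdist_lt : cij => /(_ _ e2).
have nji : \forall y \near p, `|partial j (partial i f) p - partial j (partial i f) y| < e / 2.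
  by move/cvgrPdist_lt : cji => /(_ _ e2).
have nF : Filter (nbhs p) by exact: nbhs_filter.
have := @filterI _ (nbhs p) nF _ _ nU (@filterI _ (nbhs p) nF _ _ nij nji).
move=> /nbhs_ballP[r /= r0 rU'].
have rU y : ball p r y -> [/\ U y, `|partial i (partial j f) p - partial i (partial j f) y| < e / 2 &
     `|partial j (partial i f) p - partial j (partial i f) y| < e / 2] by move=> /rU'[? []].
have sr : smooth (ball p r) f by apply: smooth_sub sf => y /rU[].
(* With this side the parallelogram stays in the ball even when [i = j], where the two displacements
   add up. *)
have h0 : 0 < r / 3 by lra.
have hr : r / 3 + r / 3 < r by lra.
have [y [/rU[_ Hy _] Ey]] := second_difference_MVT j i sr h0 hr.
have [z [/rU[_ _ Hz] Ez]] := second_difference_MVT i j sr h0 hr.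
have E : second_difference f p j i (r / 3) = second_difference f p i j (r / 3).
  by rewrite /second_difference (addrAC p); congr (_ + f p); rewrite (addrAC (f _)).
have {Ey Ez E}Eyz : partial i (partial j f) y = partial j (partial i f) z.
  have rr : r / 3 * (r / 3) != 0 by apply: lt0r_neq0; exact: mulr_gt0.
  by apply: (mulfI rr); exact: (etrans (etrans (esym Ey) E) Ez).
exact: near_diff Hy Hz Eyz.
Qed.

(** The coordinate sum, unlike ['D_(X p)], is linear in the vector without any differentiability of
    [f]; [along_derive] relates the two. *)
Definition along X f p := \sum_i X p 0 i * partial i f p.

Lemma along_derive X f p : differentiable f p -> along X f p = 'D_(X p) f p.
Proof.
move=> df; rewrite deriveE // [in RHS](row_sum_delta (X p)) linear_sum /=.
by apply: eq_bigr => i _; rewrite linearZ /= -deriveE.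
Qed.

Lemma along_near U X f g p : open U -> U p -> (forall z, U z -> f z = g z) ->
  along X f p = along X g p.
Proof.
move=> oU Up fg; apply: eq_bigr => i _; congr (_ * _).
exact: partial_near oU Up fg.
Qed.

Lemma along_cst X (c : R) p : along X (fun=> c) p = 0.
Proof. by apply: big1 => i _; rewrite partial_cst mulr0. Qed.

Lemma alongD X f g p : differentiable f p -> differentiable g p ->
  along X (fun z => f z + g z) p = along X f p + along X g p.
Proof.
by move=> df dg; rewrite -big_split; apply: eq_bigr => i _; rewrite partialD // mulrDr.
Qed.

Lemma alongM X f g p : differentiable f p -> differentiable g p ->
  along X (fun z => f z * g z) p = along X f p * g p + f p * along X g p.
Proof.
move=> df dg; rewrite mulr_suml mulr_sumr -big_split; apply: eq_bigr => i _ /=.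
by rewrite partialM //; ring.
Qed.

Lemma alongZ X c f p : differentiable f p ->
  along X (fun z => c * f z) p = c * along X f p.
Proof.
by move=> df; rewrite alongM ?along_cst ?mul0r ?add0r.
Qed.

Lemma alongN X f p : differentiable f p -> along X (fun z => - f z) p = - along X f p.
Proof.
move=> df; rewrite -mulN1r -alongZ //; congr along.
by apply/funext => z; rewrite mulN1r.
Qed.

Lemma alongB X f g p : differentiable f p -> differentiable g p ->
  along X (fun z => f z - g z) p = along X f p - along X g p.
Proof. by move=> df dg; rewrite alongD ?alongN //; exact: differentiableN. Qed.

Lemma along_sum X (I : eqType) (s : seq I) (F : I -> pt -> R) p :
  (forall k, differentiable (F k) p) ->
  along X (fun z => \sum_(k <- s) F k z) p = \sum_(k <- s) along X (F k) p.
Proof.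
move=> dF; rewrite /along exchange_big /=; apply: eq_bigr => i _.
by rewrite partial_sum // mulr_sumr.
Qed.

Lemma along_lin X Y (c : R) f p Z : (Z p = c *: X p + Y p) ->
  along Z f p = c * along X f p + along Y f p.
Proof.
move=> E; rewrite /along E mulr_sumr -big_split; apply: eq_bigr => i _ /=.
by rewrite !mxE; ring.
Qed.

Lemma smooth_along U X f : open U -> smooth_vf U X -> smooth U f -> smooth U (along X f).
Proof.
move=> oU sX sf; apply: smooth_sum => // i _.
by apply: smoothM => //; exact: smooth_partial.
Qed.

(** The second derivatives of [f] cancel by [partialC]; the first-order terms left over are the
    components of the bracket. *)
Lemma along_bracket U X Y f p : open U -> smooth_vf U X -> smooth_vf U Y ->
  smooth U f -> U p ->
  along (lie_bracket X Y) f p = along X (along Y f) p - along Y (along X f) p.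
Proof.
move=> oU sX sY sf Up.
have E X' Y' : smooth_vf U Y' -> along X' (along Y' f) p =
    \sum_j (\sum_i X' p 0 i * partial i (fun y => Y' y 0 j) p) * partial j f p
    + \sum_i \sum_j X' p 0 i * (Y' p 0 j * partial i (partial j f) p).
  move=> sY'; rewrite {1}/along.
  under [X in _ = X + _]eq_bigr do rewrite mulr_suml.
  rewrite [X in _ = X + _]exchange_big -big_split; apply: eq_bigr => i _ /=.
  have dY j : differentiable (fun y => Y' y 0 j) p := smooth_differentiable (sY' j) Up.
  have df j : differentiable (partial j f) p := smooth_differentiable (smooth_partial j sf) Up.
  rewrite partial_sum; last by move=> j; exact: differentiableM.
  rewrite mulr_sumr -big_split; apply: eq_bigr => j _ /=.
  by rewrite partialM //; ring.
rewrite (E X Y sY) (E Y X sX) [X in _ = _ - (_ + X)]exchange_big /=.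
rewrite opprD addrACA -[X in _ = _ + X]sumrB [X in _ + X]big1 ?addr0; last first.
  move=> i _; rewrite -sumrB big1 // => j _.
  by rewrite (partialC j i oU sf Up); ring.
rewrite -sumrB; apply: eq_bigr => j _.
by rewrite !mxE sumrB; ring.
Qed.

(** Balls are convex, so [f] can be compared with its value at the centre along a segment, by the
    mean value theorem. *)
Lemma constant_on_ball p (r : R) f : smooth (ball p r) f ->
  (forall i y, ball p r y -> partial i f y = 0) -> forall y, ball p r y -> f y = f p.
Proof.
move=> sf f0 y py.
have r0 : 0 < r by case: py.
have line (s : R) : 0 <= s <= 1 -> ball p r (p + s *: (y - p)).
  move=> /andP[s0 s1]; apply: mx_ballP => // k; have := mx_ballE k py.
  rewrite !mxE opprD addrA subrr sub0r normrN normrM ger0_norm // distrC.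
  by apply: le_lt_trans; rewrite ler_piMl.
have df (s : R) : 0 <= s <= 1 -> is_derive s 1 (fun t : R => f (p + t *: (y - p))) 0.
  move=> s01; have ds := smooth_differentiable sf (line s s01).
  have := is_derive_line ds; rewrite -(along_derive (fun=> y - p)) // /along.
  by rewrite big1 // => i _; rewrite f0 ?mulr0 //; exact: line.
have g1 (x : R) : x \in `]0, 1[%R -> is_derive x 1 (fun t : R => f (p + t *: (y - p))) 0.
  by rewrite in_itv/= => /andP[/ltW ? /ltW ?]; apply: df; exact/andP.
have g2 : {within `[0, 1], continuous (fun t : R => f (p + t *: (y - p)))}.
  apply: derivable_within_continuous => x; rewrite in_itv/= => xh.
  by have := df x xh; case.
have [s _] := MVT_segment ler01 g1 g2.
by rewrite mul0r scale1r scale0r addr0 [p + _]addrC subrK => /eqP; rewrite subr_eq0 => /eqP.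
Qed.

End Directional.

(** * Differentiation of functions with values in a finite-dimensional space *)

Section VectorValued.
Context {R : realType} {n : nat} {W : vectType R}.
Local Notation pt := 'rV[R]_n.+1.
Implicit Types (U V : set pt) (F G : pt -> W) (X Y : vector_field R n).
Local Notation bas := (vbasis (fullv : {vspace W})).
Local Notation dimW := (\dim (fullv : {vspace W})).

Definition vsmooth U F := forall k, smooth U (fun z => coord bas k (F z)).

(** Defined in the basis [vbasis]; [along_functional] shows that this choice does not matter, since
    the derivative commutes with every linear functional, in particular with the octonion
    coordinates. *)
Definition valong X F p : W := \sum_k along X (fun z => coord bas k (F z)) p *: bas`_k.

Lemma coord_decomp (w : W) : w = \sum_k coord bas k w *: bas`_k.
Proof. by apply: coord_vbasis; rewrite memvf. Qed.

Lemma coord_valong X F p k : coord bas k (valong X F p) = along X (fun z => coord bas k (F z)) p.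
Proof. by rewrite coord_sum_free // (basis_free (vbasisP _)). Qed.

Lemma vector_coordP (v w : W) : (forall k, coord bas k v = coord bas k w) -> v = w.
Proof. by move=> E; rewrite (coord_decomp v) (coord_decomp w); apply: eq_bigr => k _; rewrite E. Qed.

Lemma linear_coordE (l : W -> R) : linear (l : W -> R^o) ->
  forall w, l w = \sum_(k < dimW) l bas`_k * coord bas k w.
Proof.
move=> ll w; rewrite [in LHS](coord_decomp w).
have l0 : l 0 = 0.
  by have := ll (-1) 0 0; rewrite scaler0 addr0 scaleN1r addNr.
elim/big_rec2: _ => [//|k x y _ <-].
by rewrite ll mulrC.
Qed.

Lemma smooth_functional U F (l : W -> R) : open U -> linear (l : W -> R^o) ->
  vsmooth U F -> smooth U (fun z => l (F z)).
Proof.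
move=> oU ll sF.
have sS : smooth U (fun z => \sum_(k < dimW) l bas`_k * coord bas k (F z)).
  by apply: smooth_sum => // k _; apply: smoothZ.
refine (smooth_near oU _ sS) => z _; exact/esym/linear_coordE.
Qed.

Lemma along_functional U X F (l : W -> R) p : open U -> linear (l : W -> R^o) ->
  vsmooth U F -> U p -> along X (fun z => l (F z)) p = l (valong X F p).
Proof.
move=> oU ll sF Up; have dF k := smooth_differentiable (sF k) Up.
rewrite (along_near (g := fun z => \sum_(k < dimW) l bas`_k * coord bas k (F z)) X oU Up); last first.
  by move=> z _; exact: linear_coordE.
rewrite along_sum; last first.
  by move=> k; apply: differentiableM => //; exact: differentiable_cst.
rewrite [RHS]linear_coordE //; apply: eq_bigr => k _.
by rewrite alongZ // coord_valong.
Qed.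

Lemma vsmooth_near U F G : open U -> (forall z, U z -> F z = G z) -> vsmooth U F -> vsmooth U G.
Proof.
move=> oU FG sF k; refine (smooth_near oU _ (sF k)) => z Uz.
by rewrite FG.
Qed.

Lemma vsmooth_sub U V F : V `<=` U -> vsmooth U F -> vsmooth V F.
Proof. by move=> VU sF k; exact: smooth_sub VU (sF k). Qed.

Lemma vsmooth_cst U (w : W) : vsmooth U (fun=> w).
Proof. by move=> k; exact: smooth_cst. Qed.

Lemma vsmoothD U F G : open U -> vsmooth U F -> vsmooth U G -> vsmooth U (fun z => F z + G z).
Proof.
move=> oU sF sG k; refine (smooth_near oU _ (smoothD oU (sF k) (sG k))) => z _.
by rewrite linearD.
Qed.

Lemma vsmoothZ U (f : pt -> R) F : open U -> smooth U f -> vsmooth U F ->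
  vsmooth U (fun z => f z *: F z).
Proof.
move=> oU sf sF k; refine (smooth_near oU _ (smoothM oU sf (sF k))) => z _.
by rewrite linearZ.
Qed.

Lemma vsmoothN U F : open U -> vsmooth U F -> vsmooth U (fun z => - F z).
Proof.
move=> oU sF k; refine (smooth_near oU _ (smoothN oU (sF k))) => z _.
by rewrite linearN.
Qed.

Lemma vsmooth_valong U X F : open U -> smooth_vf U X -> vsmooth U F -> vsmooth U (valong X F).
Proof.
move=> oU sX sF k; refine (smooth_near oU _ (smooth_along oU sX (sF k))) => z _.
by rewrite coord_valong.
Qed.

Lemma valong_near U X F G p : open U -> U p -> (forall z, U z -> F z = G z) ->
  valong X F p = valong X G p.
Proof.
move=> oU Up FG; apply: eq_bigr => k _; congr (_ *: _).
by apply: (along_near _ oU Up) => z Uz; rewrite FG.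
Qed.

Lemma valong_cst X (w : W) p : valong X (fun=> w) p = 0.
Proof. by rewrite /valong big1 // => k _; rewrite along_cst scale0r. Qed.

Lemma valongD U X F G p : vsmooth U F -> vsmooth U G -> U p ->
  valong X (fun z => F z + G z) p = valong X F p + valong X G p.
Proof.
move=> sF sG Up; apply: vector_coordP => k; rewrite linearD /= !coord_valong.
refine (etrans _ (alongD _ (smooth_differentiable (sF k) Up) (smooth_differentiable (sG k) Up))).
by congr along; apply/funext => z; rewrite linearD.
Qed.

Lemma valongN U X F p : vsmooth U F -> U p ->
  valong X (fun z => - F z) p = - valong X F p.
Proof.
move=> sF Up; apply: vector_coordP => k; rewrite linearN /= !coord_valong.
refine (etrans _ (alongN _ (smooth_differentiable (sF k) Up))).
by congr along; apply/funext => z; rewrite linearN.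
Qed.

Lemma valongZ U X (f : pt -> R) F p : smooth U f -> vsmooth U F -> U p ->
  valong X (fun z => f z *: F z) p = along X f p *: F p + f p *: valong X F p.
Proof.
move=> sf sF Up; apply: vector_coordP => k; rewrite linearD !linearZ /= !coord_valong.
refine (etrans _ (alongM _ (smooth_differentiable sf Up) (smooth_differentiable (sF k) Up))).
by congr along; apply/funext => z; rewrite linearZ.
Qed.

Lemma valong_bracket U X Y F p : open U -> smooth_vf U X -> smooth_vf U Y ->
  vsmooth U F -> U p ->
  valong (lie_bracket X Y) F p = valong X (valong Y F) p - valong Y (valong X F) p.
Proof.
move=> oU sX sY sF Up; apply: vector_coordP => k; rewrite linearB /= !coord_valong.
rewrite (along_bracket oU sX sY (sF k) Up).
have E Z : along Z (fun z => coord bas k (F z)) = fun z => coord bas k (valong Z F z).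
  by apply/funext => z; rewrite coord_valong.
by rewrite !E.
Qed.

Lemma vsmooth_linear U F (L : 'End(W)) : open U -> vsmooth U F -> vsmooth U (fun z => L (F z)).
Proof.
move=> oU sF k; apply: (smooth_functional (l := fun w => coord bas k (L w))) => //.
by move=> c u v; rewrite !linearP.
Qed.

Lemma valong_linear U X F (L : 'End(W)) p : open U -> vsmooth U F -> U p ->
  valong X (fun z => L (F z)) p = L (valong X F p).
Proof.
move=> oU sF Up; apply: vector_coordP => k; rewrite coord_valong.
apply: (along_functional (l := fun w => coord bas k (L w)) _ oU _ sF Up).
by move=> c u v; rewrite !linearP.
Qed.

Section Bilinear.
Variable B : W -> W -> W.
Hypothesis Bl : forall w, linear (B^~ w).
Hypothesis Br : forall w, linear (B w).

Lemma bilinear_expand v w : B v w =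
  \sum_(i < dimW) \sum_(j < dimW) (coord bas i v * coord bas j w) *: B bas`_i bas`_j.
Proof.
have B0 w' : B 0 w' = 0 by have := Bl w' (-1) 0 0; rewrite scaler0 addr0 scaleN1r addNr.
have B0' w' : B w' 0 = 0 by have := Br w' (-1) 0 0; rewrite scaler0 addr0 scaleN1r addNr.
rewrite [in LHS](coord_decomp v).
elim/big_rec2: _ => [|i x y _ <-]; first exact: B0.
rewrite Bl; congr (_ + _); rewrite [in LHS](coord_decomp w).
elim/big_rec2: _ => [|j x' y' _ <-]; first by rewrite B0' scaler0.
by rewrite Br scalerDr scalerA.
Qed.

Lemma coord_bilinear k v w : coord bas k (B v w) =
  \sum_(i < dimW) \sum_(j < dimW) coord bas k (B bas`_i bas`_j) * (coord bas i v * coord bas j w).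
Proof.
rewrite bilinear_expand linear_sum; apply: eq_bigr => i _.
by rewrite linear_sum; apply: eq_bigr => j _; rewrite linearZ /= mulrC.
Qed.

Lemma valong_bilinear U X F G p : open U -> vsmooth U F -> vsmooth U G -> U p ->
  valong X (fun z => B (F z) (G z)) p = B (valong X F p) (G p) + B (F p) (valong X G p).
Proof.
move=> oU sF sG Up; apply: vector_coordP => k; rewrite linearD /= coord_valong.
under eq_fun do rewrite coord_bilinear.
have dF i := smooth_differentiable (sF i) Up.
have dG i := smooth_differentiable (sG i) Up.
have d1 i j : differentiable (fun z => coord bas i (F z) * coord bas j (G z)) p.
  exact: differentiableM.
have d2 (i j : 'I_dimW) : differentiable (fun z => coord bas k (B bas`_i bas`_j) *
    (coord bas i (F z) * coord bas j (G z))) p.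
  by apply: differentiableM => //; exact: differentiable_cst.
rewrite along_sum; last first.
  move=> i; have S : forall s : seq 'I_dimW, differentiable (fun z => \sum_(j <- s)
    coord bas k (B bas`_i bas`_j) * (coord bas i (F z) * coord bas j (G z))) p.
    elim=> [|j s IH].
      by under eq_fun do rewrite big_nil; exact: differentiable_cst.
    by under eq_fun do rewrite big_cons; exact: differentiableD.
  exact: S.
rewrite !coord_bilinear -big_split; apply: eq_bigr => i _ /=.
rewrite along_sum // -big_split; apply: eq_bigr => j _ /=.
by rewrite alongZ // alongM // !coord_valong mulrDr.
Qed.

End Bilinear.

End VectorValued.

(** * Affine charts of the null cone of the imaginary split octonions *)

Section Spans.
Context {R : realType} {W : vectType R}.
Implicit Types (u v w : W).

Lemma span2P v a b : reflect (exists x y : R, v = x *: a + y *: b) (v \in <<[:: a; b]>>%VS).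
Proof.
rewrite span_cons span_seq1; apply: (iffP memv_addP) => [[_ /vlineP[x ->] [_ /vlineP[y ->] ->]]|[x [y ->]]].
  by exists x, y.
by exists (x *: a); [by apply/vlineP; exists x|exists (y *: b) => //; apply/vlineP; exists y].
Qed.

Lemma span3P v a b c : reflect (exists x y z : R, v = x *: a + y *: b + z *: c)
  (v \in <<[:: a; b; c]>>%VS).
Proof.
rewrite span_cons; apply: (iffP memv_addP).
  move=> [_ /vlineP[x ->] [w /span2P[y [z ->]] ->]].
  by exists x, y, z; rewrite addrA.
move=> [x [y [z ->]]]; exists (x *: a); first by apply/vlineP; exists x.
by exists (y *: b + z *: c); [apply/span2P; exists y, z|rewrite addrA].
Qed.

End Spans.

(** * Coordinates and multiplication table of the split octonions *)

Section OctonionCoordinates.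
Context {R : realType}.
Local Notation O := (split_octonion R).
Implicit Types x y w : O.

Definition oc11 x : R := x.1 0 0.
Definition oc12 x : R := x.1 0 1.
Definition oc21 x : R := x.1 1 0.
Definition oc22 x : R := x.1 1 1.
Definition od11 x : R := x.2 0 0.
Definition od12 x : R := x.2 0 1.
Definition od21 x : R := x.2 1 0.
Definition od22 x : R := x.2 1 1.

Definition mx2 (a b c d : R) : 'M[R]_2 :=
  \matrix_(i, j) if i == 0 then if j == 0 then a else b else if j == 0 then c else d.

Definition oct (a b c d e f g k : R) : O := (mx2 a b c d, mx2 e f g k).

Lemma mx2E a b c d : (mx2 a b c d 0 0 = a) * (mx2 a b c d 0 1 = b) *
  (mx2 a b c d 1 0 = c) * (mx2 a b c d 1 1 = d).
Proof. by rewrite !mxE. Qed.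

Lemma octE a b c d e f g k (w := oct a b c d e f g k) :
  (oc11 w = a) * (oc12 w = b) * (oc21 w = c) * (oc22 w = d) *
  (od11 w = e) * (od12 w = f) * (od21 w = g) * (od22 w = k).
Proof. by rewrite /w /oct /oc11 /oc12 /oc21 /oc22 /od11 /od12 /od21 /od22 /= !mx2E. Qed.

Lemma ord2 (i : 'I_2) : i = 0 \/ i = 1.
Proof. by case: i => -[|[|//]] ?; [left|right]; exact: val_inj. Qed.

Lemma mx2P (A B : 'M[R]_2) : A 0 0 = B 0 0 -> A 0 1 = B 0 1 -> A 1 0 = B 1 0 ->
  A 1 1 = B 1 1 -> A = B.
Proof.
move=> ? ? ? ?; apply/matrixP => i j.
by case: (ord2 i) => ->; case: (ord2 j) => ->.
Qed.

Lemma octP x y : oc11 x = oc11 y -> oc12 x = oc12 y -> oc21 x = oc21 y -> oc22 x = oc22 y ->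
  od11 x = od11 y -> od12 x = od12 y -> od21 x = od21 y -> od22 x = od22 y -> x = y.
Proof.
case: x => x1 x2; case: y => y1 y2.
by move=> *; congr pair; exact: mx2P.
Qed.

Lemma octK x : x = oct (oc11 x) (oc12 x) (oc21 x) (oc22 x) (od11 x) (od12 x) (od21 x) (od22 x).
Proof. by apply: octP; rewrite octE. Qed.

Lemma adj2E (A : 'M[R]_2) : \adj A = mx2 (A 1 1) (- A 0 1) (- A 1 0) (A 0 0).
Proof.
have l00 : lift (0 : 'I_2) 0 = 1 by exact: val_inj.
have l10 : lift (1 : 'I_2) 0 = 0 by exact: val_inj.
by apply: mx2P; rewrite mx2E !mxE /cofactor det_mx11 !mxE ?l00 ?l10 /= ?expr0 ?expr1 ?sqrr_sign
  ?mul1r ?mulN1r //= expr2 mulrNN mulr1 mul1r.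
Qed.

Lemma oct_mulE x y : oct_mul x y = oct
  (oc11 x * oc11 y + oc12 x * oc21 y + (od22 y * od11 x - od12 y * od21 x))
  (oc11 x * oc12 y + oc12 x * oc22 y + (od22 y * od12 x - od12 y * od22 x))
  (oc21 x * oc11 y + oc22 x * oc21 y + (od11 y * od21 x - od21 y * od11 x))
  (oc21 x * oc12 y + oc22 x * oc22 y + (od11 y * od22 x - od21 y * od12 x))
  (od11 y * oc11 x + od12 y * oc21 x + (od11 x * oc22 y - od12 x * oc21 y))
  (od11 y * oc12 x + od12 y * oc22 x + (od12 x * oc11 y - od11 x * oc12 y))
  (od21 y * oc11 x + od22 y * oc21 x + (od21 x * oc22 y - od22 x * oc21 y))
  (od21 y * oc12 x + od22 y * oc22 x + (od22 x * oc11 y - od21 x * oc12 y)).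
Proof.
apply: octP; rewrite octE /oct_mul /oc11 /oc12 /oc21 /oc22 /od11 /od12 /od21 /od22 /=
  !mxE !big_ord_recl !big_ord0 !adj2E !mx2E.
all: have -> : lift (0 : 'I_2) 0 = 1 by exact: val_inj.
all: rewrite !mx2E; ring.
Qed.

Lemma oc_linear : [/\ linear (oc11 : O -> R^o), linear (oc12 : O -> R^o),
  linear (oc21 : O -> R^o) & linear (oc22 : O -> R^o)].
Proof. by split=> c x y; rewrite /oc11 /oc12 /oc21 /oc22 /= !mxE. Qed.

Lemma od_linear : [/\ linear (od11 : O -> R^o), linear (od12 : O -> R^o),
  linear (od21 : O -> R^o) & linear (od22 : O -> R^o)].
Proof. by split=> c x y; rewrite /od11 /od12 /od21 /od22 /= !mxE. Qed.

Lemma ocD x y : (oc11 (x + y) = oc11 x + oc11 y) * (oc12 (x + y) = oc12 x + oc12 y) *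
 (oc21 (x + y) = oc21 x + oc21 y) * (oc22 (x + y) = oc22 x + oc22 y) *
 (od11 (x + y) = od11 x + od11 y) * (od12 (x + y) = od12 x + od12 y) *
 (od21 (x + y) = od21 x + od21 y) * (od22 (x + y) = od22 x + od22 y).
Proof. by rewrite /oc11 /oc12 /oc21 /oc22 /od11 /od12 /od21 /od22 /= !mxE. Qed.

Lemma ocZ c x : (oc11 (c *: x) = c * oc11 x) * (oc12 (c *: x) = c * oc12 x) *
 (oc21 (c *: x) = c * oc21 x) * (oc22 (c *: x) = c * oc22 x) *
 (od11 (c *: x) = c * od11 x) * (od12 (c *: x) = c * od12 x) *
 (od21 (c *: x) = c * od21 x) * (od22 (c *: x) = c * od22 x).
Proof. by rewrite /oc11 /oc12 /oc21 /oc22 /od11 /od12 /od21 /od22 /= !mxE. Qed.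

Lemma ocN x : (oc11 (- x) = - oc11 x) * (oc12 (- x) = - oc12 x) *
 (oc21 (- x) = - oc21 x) * (oc22 (- x) = - oc22 x) *
 (od11 (- x) = - od11 x) * (od12 (- x) = - od12 x) *
 (od21 (- x) = - od21 x) * (od22 (- x) = - od22 x).
Proof. by rewrite /oc11 /oc12 /oc21 /oc22 /od11 /od12 /od21 /od22 /= !mxE. Qed.

Lemma oc0 : (oc11 (0 : O) = 0) * (oc12 (0 : O) = 0) * (oc21 (0 : O) = 0) * (oc22 (0 : O) = 0) *
 (od11 (0 : O) = 0) * (od12 (0 : O) = 0) * (od21 (0 : O) = 0) * (od22 (0 : O) = 0).
Proof. by rewrite /oc11 /oc12 /oc21 /oc22 /od11 /od12 /od21 /od22 /= !mxE. Qed.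

Lemma oct_mul_linearl y : linear (fun x : O => oct_mul x y).
Proof. by move=> c x x'; rewrite !oct_mulE; apply: octP; rewrite !(ocD, ocZ, octE); ring. Qed.

Lemma oct_mul_linearr x : linear (oct_mul x).
Proof. by move=> c y y'; rewrite !oct_mulE; apply: octP; rewrite !(ocD, ocZ, octE); ring. Qed.

End OctonionCoordinates.

Section Chart.
Context {R : realType}.
Local Notation pt := 'rV[R]_5.
Local Notation O := (split_octonion R).

Definition vec5 (a b c d e : R) : 'rV[R]_5 := \row_j nth 0 [:: a; b; c; d; e] j.

Lemma vec5E a b c d e (v := vec5 a b c d e) :
  (v 0 i_psi = a) * (v 0 i_theta = b) * (v 0 i_phi = c) * (v 0 i_x = d) * (v 0 i_q = e).
Proof. by rewrite /v !mxE. Qed.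

Lemma ord5 (P : 'I_5 -> Prop) : P i_psi -> P i_theta -> P i_phi -> P i_x -> P i_q ->
  forall i, P i.
Proof.
move=> P0 P1 P2 P3 P4 [[|[|[|[|[|//]]]]] lti].
- by rewrite (_ : Ordinal lti = i_psi) //; exact: val_inj.
- by rewrite (_ : Ordinal lti = i_theta) //; exact: val_inj.
- by rewrite (_ : Ordinal lti = i_phi) //; exact: val_inj.
- by rewrite (_ : Ordinal lti = i_x) //; exact: val_inj.
- by rewrite (_ : Ordinal lti = i_q) //; exact: val_inj.
Qed.

Lemma sum5 (V : zmodType) (f : 'I_5 -> V) :
  \sum_i f i = f i_psi + f i_theta + f i_phi + f i_x + f i_q.
Proof.
rewrite !big_ord_recl big_ord0 addr0 !addrA.
by do !congr (_ + _); congr (f _); exact: val_inj.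
Qed.

Lemma row5P (v w : 'rV[R]_5) : v 0 i_psi = w 0 i_psi -> v 0 i_theta = w 0 i_theta ->
  v 0 i_phi = w 0 i_phi -> v 0 i_x = w 0 i_x -> v 0 i_q = w 0 i_q -> v = w.
Proof. by move=> *; apply/rowP; exact: ord5. Qed.

Variables (U : set pt) (F : pt -> O).

Definition ch z := oc11 (F z).
Definition ce z := od11 (F z).
Definition cf z := od12 (F z).
Definition cg z := od21 (F z).
Definition ck z := od22 (F z).

(* [ord5]-indexed by (h, e, f, g, k). *)
Definition chart_jacobian (z : pt) : 'M[R]_5 := \matrix_(i, j)
  nth 0 [:: partial i ch z; partial i ce z; partial i cf z; partial i cg z; partial i ck z] j.

(* The null cone of the norm form is normalised by [oc12 = 1]. *)
Definition null_chart := [/\ open U, vsmooth U F,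
  forall z, U z -> [/\ oc12 (F z) = 1, oc22 (F z) = - ch z &
     oc21 (F z) = - (ch z * ch z) - ce z * ck z + cf z * cg z] &
  forall z, U z -> chart_jacobian z \in unitmx].

Hypothesis chartF : null_chart.

Let oU : open U. Proof. by case: chartF. Qed.
Let sF : vsmooth U F. Proof. by case: chartF. Qed.
Let F12 z : U z -> oc12 (F z) = 1. Proof. by case: chartF => _ _ H _ /H[]. Qed.
Let F22 z : U z -> oc22 (F z) = - ch z. Proof. by case: chartF => _ _ H _ /H[]. Qed.
Let F21 z : U z -> oc21 (F z) = - (ch z * ch z) - ce z * ck z + cf z * cg z.
Proof. by case: chartF => _ _ H _ /H[]. Qed.
Let uJ z : U z -> chart_jacobian z \in unitmx. Proof. by case: chartF => _ _ _; apply. Qed.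

Lemma smooth_ch : smooth U ch.
Proof. by apply: smooth_functional => //; case: (@oc_linear R). Qed.
Lemma smooth_ce : smooth U ce.
Proof. by apply: smooth_functional => //; case: (@od_linear R). Qed.
Lemma smooth_cf : smooth U cf.
Proof. by apply: smooth_functional => //; case: (@od_linear R). Qed.
Lemma smooth_cg : smooth U cg.
Proof. by apply: smooth_functional => //; case: (@od_linear R). Qed.
Lemma smooth_ck : smooth U ck.
Proof. by apply: smooth_functional => //; case: (@od_linear R). Qed.

Let dch z (Uz : U z) : differentiable ch z := smooth_differentiable smooth_ch Uz.
Let dce z (Uz : U z) : differentiable ce z := smooth_differentiable smooth_ce Uz.
Let dcf z (Uz : U z) : differentiable cf z := smooth_differentiable smooth_cf Uz.
Let dcg z (Uz : U z) : differentiable cg z := smooth_differentiable smooth_cg Uz.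
Let dck z (Uz : U z) : differentiable ck z := smooth_differentiable smooth_ck Uz.

Lemma mul_jacobian (v : pt) z : v *m chart_jacobian z =
  vec5 (along (fun=> v) ch z) (along (fun=> v) ce z) (along (fun=> v) cf z)
       (along (fun=> v) cg z) (along (fun=> v) ck z).
Proof. by apply: row5P; rewrite vec5E !mxE /along; apply: eq_bigr => i _; rewrite !mxE. Qed.

Lemma chart_vector_inj (v w : pt) z : U z ->
  along (fun=> v) ch z = along (fun=> w) ch z -> along (fun=> v) ce z = along (fun=> w) ce z ->
  along (fun=> v) cf z = along (fun=> w) cf z -> along (fun=> v) cg z = along (fun=> w) cg z ->
  along (fun=> v) ck z = along (fun=> w) ck z -> v = w.
Proof.
move=> Uz e1 e2 e3 e4 e5; rewrite -(mulmxK (uJ Uz) v) -(mulmxK (uJ Uz) w).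
by rewrite !mul_jacobian e1 e2 e3 e4 e5.
Qed.

(** The vector field with prescribed derivatives of the chart functions (h, e, f, g, k). Fields are
    handled only through their action on these five functions, never through the coordinates of the
    base point. *)
Definition pull (w : pt -> pt) : vector_field R 4 := fun z => w z *m invmx (chart_jacobian z).

Let along_of_jacobian (X : vector_field R 4) a b c d e z :
  X z *m chart_jacobian z = vec5 a b c d e ->
  (along X ch z = a) * (along X ce z = b) * (along X cf z = c) *
  (along X cg z = d) * (along X ck z = e).
Proof.
rewrite mul_jacobian => E.
have [e1 e2 e3 e4 e5] : [/\ along (fun=> X z) ch z = a, along (fun=> X z) ce z = b,
    along (fun=> X z) cf z = c, along (fun=> X z) cg z = d & along (fun=> X z) ck z = e].
  by have Ei i := congr1 (fun v : pt => v 0 i) E; split;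
    [move: (Ei i_psi)|move: (Ei i_theta)|move: (Ei i_phi)|move: (Ei i_x)|move: (Ei i_q)];
    rewrite /= !mxE.
exact: (e1, e2, e3, e4, e5).
Qed.

Lemma along_pull a b c d e z (X := pull (fun z => vec5 (a z) (b z) (c z) (d z) (e z))) : U z ->
  (along X ch z = a z) * (along X ce z = b z) * (along X cf z = c z) *
  (along X cg z = d z) * (along X ck z = e z).
Proof. by move=> Uz; apply: along_of_jacobian; rewrite mulmxKV ?uJ. Qed.

Lemma smooth_pull (w : pt -> pt) : smooth_vf U w -> smooth_vf U (pull w).
Proof.
move=> sw j.
have sJ i k : smooth U (fun z => chart_jacobian z i k).
  move: k; apply: ord5.
  - refine (smooth_near oU _ (smooth_partial i smooth_ch)) => z _; by rewrite mxE.
  - refine (smooth_near oU _ (smooth_partial i smooth_ce)) => z _; by rewrite mxE.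
  - refine (smooth_near oU _ (smooth_partial i smooth_cf)) => z _; by rewrite mxE.
  - refine (smooth_near oU _ (smooth_partial i smooth_cg)) => z _; by rewrite mxE.
  - refine (smooth_near oU _ (smooth_partial i smooth_ck)) => z _; by rewrite mxE.
have sI := smooth_invmx oU sJ uJ.
have sS : smooth U (fun z => \sum_k w z 0 k * invmx (chart_jacobian z) k j).
  by apply: smooth_sum => // k _; exact: smoothM.
by refine (smooth_near oU _ sS) => z _; rewrite mxE.
Qed.

Lemma smooth_vf5 a b c d e : smooth U a -> smooth U b -> smooth U c -> smooth U d ->
  smooth U e -> smooth_vf U (fun z : pt => vec5 (a z) (b z) (c z) (d z) (e z)).
Proof.
move=> *; apply: ord5.
- refine (smooth_near oU _ (_ : smooth U a)) => // z _; by rewrite mxE.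
- refine (smooth_near oU _ (_ : smooth U b)) => // z _; by rewrite mxE.
- refine (smooth_near oU _ (_ : smooth U c)) => // z _; by rewrite mxE.
- refine (smooth_near oU _ (_ : smooth U d)) => // z _; by rewrite mxE.
- refine (smooth_near oU _ (_ : smooth U e)) => // z _; by rewrite mxE.
Qed.

Lemma valong_chart X z : U z -> valong X F z =
  oct (along X ch z) 0
   (- (2 * ch z * along X ch z) - along X ce z * ck z - ce z * along X ck z
    + along X cf z * cg z + cf z * along X cg z) (- along X ch z)
   (along X ce z) (along X cf z) (along X cg z) (along X ck z).
Proof.
move=> Uz; have [l11 l12 l21 l22] := @oc_linear R; have [m11 m12 m21 m22] := @od_linear R.
apply: octP; rewrite octE -(along_functional (U := U) X) //.
- by rewrite (along_near X oU Uz F12) along_cst.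
- have := dch Uz; have := dce Uz; have := dcf Uz; have := dcg Uz; have := dck Uz.
  move=> ? ? ? ? ?; rewrite (along_near X oU Uz F21).
  by rewrite !(alongD, alongB, alongN, alongM) //; do ?[exact: differentiableM|
    apply: differentiableD|apply: differentiableB|apply: differentiableN]; do ?[exact: differentiableM];
    ring.
- by rewrite (along_near X oU Uz F22) alongN //; exact: dch.
Qed.

Definition null_direction (z v : pt) := oct_mul (F z) (valong (fun=> v) F z) = 0.

(** The three equations are the coordinates [oc12], [od12] and [od22] of the product; they imply the
    vanishing of the other five. The derivatives of f and k remain free, so the null directions form
    a plane. *)
Lemma null_directionP z v : U z -> null_direction z v <->
  [/\ along (fun=> v) ch z = cf z * along (fun=> v) ck z - ck z * along (fun=> v) cf z,
      along (fun=> v) ce z = ch z * along (fun=> v) cf z - cf z * along (fun=> v) ch z &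
      along (fun=> v) cg z = ch z * along (fun=> v) ck z - ck z * along (fun=> v) ch z].
Proof.
move=> Uz; rewrite /null_direction valong_chart // oct_mulE !octE.
rewrite F12 // F22 // F21 // -/(ch z) -/(ce z) -/(cf z) -/(cg z) -/(ck z).
move: (along _ ch z) (along _ ce z) (along _ cf z) (along _ cg z) (along _ ck z) => h' e' f' g' k'.
move: (ch z) (ce z) (cf z) (cg z) (ck z) => h e f g k; split.
  move=> E0.
  have := congr1 oc12 E0; have := congr1 od12 E0; have := congr1 od22 E0.
  by rewrite !octE !oc0 => *; split; lra.
move=> [-> -> ->]; apply: octP; rewrite octE oc0; ring.
Qed.

End Chart.

(** * An adapted frame and its brackets *)

Section Frame.
Context {R : realType}.
Local Notation pt := 'rV[R]_5.
Local Notation O := (split_octonion R).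
Variables (U : set pt) (F : pt -> O).
Hypothesis chartF : null_chart U F.

Local Notation h := (ch F).
Local Notation e := (ce F).
Local Notation f := (cf F).
Local Notation g := (cg F).
Local Notation k := (ck F).

Let oU : open U. Proof. by case: chartF. Qed.
Let dh z (Uz : U z) : differentiable h z := smooth_differentiable (smooth_ch chartF) Uz.
Let de z (Uz : U z) : differentiable e z := smooth_differentiable (smooth_ce chartF) Uz.
Let df z (Uz : U z) : differentiable f z := smooth_differentiable (smooth_cf chartF) Uz.
Let dg z (Uz : U z) : differentiable g z := smooth_differentiable (smooth_cg chartF) Uz.
Let dk z (Uz : U z) : differentiable k z := smooth_differentiable (smooth_ck chartF) Uz.

Ltac diff_tac := repeat first
  [ assumption | exact: dh | exact: de | exact: df | exact: dg | exact: dk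
  | exact: differentiable_cst | apply: differentiableD | apply: differentiableB
  | apply: differentiableN | apply: differentiableM ].

(** [fA] and [fB] are the solutions of [null_directionP] whose derivatives of (f, k) are (1, 0) and
    (0, 1). [fC], [fP], [fQ] are their successive brackets; the last two are constant in the chart,
    which is why the frame closes up. *)
Definition fA : vector_field R 4 :=
  pull F (fun z => vec5 (- k z) (h z + f z * k z) 1 (k z * k z) 0).
Definition fB : vector_field R 4 :=
  pull F (fun z => vec5 (f z) (- (f z * f z)) 0 (h z - f z * k z) 1).
Definition fC : vector_field R 4 := pull F (fun z => vec5 (- 2) (4 * f z) 0 (4 * k z) 0).
Definition fP : vector_field R 4 := pull F (fun z => vec5 0 6 0 0 0).
Definition fQ : vector_field R 4 := pull F (fun z => vec5 0 0 0 6 0).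

Let fAE z (Uz : U z) := along_pull chartF (fun z => - k z) (fun z => h z + f z * k z) (fun=> 1)
  (fun z => k z * k z) (fun=> 0) Uz.
Let fBE z (Uz : U z) := along_pull chartF f (fun z => - (f z * f z)) (fun=> 0)
  (fun z => h z - f z * k z) (fun=> 1) Uz.
Let fCE z (Uz : U z) := along_pull chartF (fun=> - 2) (fun z => 4 * f z) (fun=> 0)
  (fun z => 4 * k z) (fun=> 0) Uz.
Let fPE z (Uz : U z) := along_pull chartF (fun=> 0) (fun=> 6) (fun=> 0) (fun=> 0) (fun=> 0) Uz.
Let fQE z (Uz : U z) := along_pull chartF (fun=> 0) (fun=> 0) (fun=> 0) (fun=> 6) (fun=> 0) Uz.

Lemma frame_along z (Uz : U z) :
  ((along fA h z = - k z) * (along fA e z = h z + f z * k z) * (along fA f z = 1) * (along fA g z = k z * k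
    z) * (along fA k z = 0)) *
  ((along fB h z = f z) * (along fB e z = - (f z * f z)) * (along fB f z = 0) * (along fB g z = h z - f z *
    k z) * (along fB k z = 1)) *
  ((along fC h z = - 2) * (along fC e z = 4 * f z) * (along fC f z = 0) * (along fC g z = 4 * k z) * (along
    fC k z = 0)) *
  ((along fP h z = 0) * (along fP e z = 6) * (along fP f z = 0) * (along fP g z = 0) * (along fP k z = 0)) *
  ((along fQ h z = 0) * (along fQ e z = 0) * (along fQ f z = 0) * (along fQ g z = 6) * (along fQ k z = 0)).
Proof. exact: (fAE Uz, fBE Uz, fCE Uz, fPE Uz, fQE Uz). Qed.

Let along_at (X : vector_field R 4) phi z (c : R) : along X phi z = c -> along (fun=> X z) phi z = c.
Proof. exact: id. Qed.

Lemma frame_along_at z (Uz : U z) :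
  ((along (fun=> fA z) h z = - k z) * (along (fun=> fA z) e z = h z + f z * k z) * (along (fun=> fA z) f z
    = 1) * (along (fun=> fA z) g z = k z * k z) * (along (fun=> fA z) k z = 0)) *
  ((along (fun=> fB z) h z = f z) * (along (fun=> fB z) e z = - (f z * f z)) * (along (fun=> fB z) f z = 0)
    * (along (fun=> fB z) g z = h z - f z * k z) * (along (fun=> fB z) k z = 1)) *
  ((along (fun=> fC z) h z = - 2) * (along (fun=> fC z) e z = 4 * f z) * (along (fun=> fC z) f z = 0) *
    (along (fun=> fC z) g z = 4 * k z) * (along (fun=> fC z) k z = 0)) *
  ((along (fun=> fP z) h z = 0) * (along (fun=> fP z) e z = 6) * (along (fun=> fP z) f z = 0) * (along
    (fun=> fP z) g z = 0) * (along (fun=> fP z) k z = 0)) *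
  ((along (fun=> fQ z) h z = 0) * (along (fun=> fQ z) e z = 0) * (along (fun=> fQ z) f z = 0) * (along
    (fun=> fQ z) g z = 6) * (along (fun=> fQ z) k z = 0)).
Proof. do ?[split]; apply: along_at; rewrite (frame_along Uz) //. Qed.

Lemma smooth_frame : [/\ smooth_vf U fA, smooth_vf U fB, smooth_vf U fC, smooth_vf U fP & smooth_vf U fQ].
Proof.
have [sh se sf [sg sk]] : [/\ smooth U h, smooth U e, smooth U f & smooth U g /\ smooth U k].
  split; [exact: smooth_ch chartF|exact: smooth_ce chartF|exact: smooth_cf chartF|].
  by split; [exact: smooth_cg chartF|exact: smooth_ck chartF].
have sc c : smooth U (fun=> c) by exact: smooth_cst.
split; apply: (smooth_pull chartF); apply: (smooth_vf5 chartF); repeat first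
  [exact: sh | exact: se | exact: sf | exact: sg | exact: sk | exact: sc | exact: oU
  | apply: smoothD | apply: smoothB | apply: smoothN | apply: smoothM].
Qed.

Let bracket_along X Z (phi a b : pt -> R) z : smooth_vf U X -> smooth_vf U Z ->
  smooth U phi -> (forall y, U y -> along Z phi y = a y) ->
  (forall y, U y -> along X phi y = b y) -> U z ->
  along (fun=> lie_bracket X Z z) phi z = along X a z - along Z b z.
Proof.
move=> sX sZ sphi Ea Eb Uz.
rewrite [LHS](along_bracket oU sX sZ sphi Uz).
by rewrite (along_near _ oU Uz Ea) (along_near _ oU Uz Eb).
Qed.

Let along_zero (phi : pt -> R) z : along (fun=> 0 : pt) phi z = 0.
Proof. by apply: big1 => i _; rewrite mxE mul0r. Qed.

Ltac bracket_tac E Uz rhs :=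
  refine (etrans E (etrans _ (esym rhs)));
  have ? := dh Uz; have ? := de Uz; have ? := df Uz; have ? := dg Uz; have ? := dk Uz;
  cbv beta; rewrite ?(alongD, alongB, alongN, alongM, along_cst); diff_tac;
  rewrite ?(frame_along Uz); ring.

Let sh := smooth_ch chartF.
Let se := smooth_ce chartF.
Let sf := smooth_cf chartF.
Let sg := smooth_cg chartF.
Let sk := smooth_ck chartF.

(** With the five lemmas that follow: the brackets are those of the free nilpotent Lie algebra of
    step 3 on two generators. A field is determined by its action on the chart functions, hence five
    computations for each bracket. *)
Lemma lie_fBfA z : U z -> lie_bracket fB fA z = fC z.
Proof.
move=> Uz; have [sA sB sC sP sQ] := smooth_frame.
apply: (chart_vector_inj chartF Uz).
- bracket_tac (bracket_along sB sA sh (fun y Uy => (fAE Uy).1.1.1.1) (fun y Uy => (fBE Uy).1.1.1.1) Uz) Uz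
    ((fCE Uz).1.1.1.1).
- bracket_tac (bracket_along sB sA se (fun y Uy => (fAE Uy).1.1.1.2) (fun y Uy => (fBE Uy).1.1.1.2) Uz) Uz
    ((fCE Uz).1.1.1.2).
- bracket_tac (bracket_along sB sA sf (fun y Uy => (fAE Uy).1.1.2) (fun y Uy => (fBE Uy).1.1.2) Uz) Uz
    ((fCE Uz).1.1.2).
- bracket_tac (bracket_along sB sA sg (fun y Uy => (fAE Uy).1.2) (fun y Uy => (fBE Uy).1.2) Uz) Uz ((fCE
    Uz).1.2).
- bracket_tac (bracket_along sB sA sk (fun y Uy => (fAE Uy).2) (fun y Uy => (fBE Uy).2) Uz) Uz ((fCE Uz).2).
Qed.

Lemma lie_fAfC z : U z -> lie_bracket fA fC z = fP z.
Proof.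
move=> Uz; have [sA sB sC sP sQ] := smooth_frame.
apply: (chart_vector_inj chartF Uz).
- bracket_tac (bracket_along sA sC sh (fun y Uy => (fCE Uy).1.1.1.1) (fun y Uy => (fAE Uy).1.1.1.1) Uz) Uz
    ((fPE Uz).1.1.1.1).
- bracket_tac (bracket_along sA sC se (fun y Uy => (fCE Uy).1.1.1.2) (fun y Uy => (fAE Uy).1.1.1.2) Uz) Uz
    ((fPE Uz).1.1.1.2).
- bracket_tac (bracket_along sA sC sf (fun y Uy => (fCE Uy).1.1.2) (fun y Uy => (fAE Uy).1.1.2) Uz) Uz
    ((fPE Uz).1.1.2).
- bracket_tac (bracket_along sA sC sg (fun y Uy => (fCE Uy).1.2) (fun y Uy => (fAE Uy).1.2) Uz) Uz ((fPE
    Uz).1.2).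
- bracket_tac (bracket_along sA sC sk (fun y Uy => (fCE Uy).2) (fun y Uy => (fAE Uy).2) Uz) Uz ((fPE Uz).2).
Qed.

Lemma lie_fBfC z : U z -> lie_bracket fB fC z = fQ z.
Proof.
move=> Uz; have [sA sB sC sP sQ] := smooth_frame.
apply: (chart_vector_inj chartF Uz).
- bracket_tac (bracket_along sB sC sh (fun y Uy => (fCE Uy).1.1.1.1) (fun y Uy => (fBE Uy).1.1.1.1) Uz) Uz
    ((fQE Uz).1.1.1.1).
- bracket_tac (bracket_along sB sC se (fun y Uy => (fCE Uy).1.1.1.2) (fun y Uy => (fBE Uy).1.1.1.2) Uz) Uz
    ((fQE Uz).1.1.1.2).
- bracket_tac (bracket_along sB sC sf (fun y Uy => (fCE Uy).1.1.2) (fun y Uy => (fBE Uy).1.1.2) Uz) Uz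
    ((fQE Uz).1.1.2).
- bracket_tac (bracket_along sB sC sg (fun y Uy => (fCE Uy).1.2) (fun y Uy => (fBE Uy).1.2) Uz) Uz ((fQE
    Uz).1.2).
- bracket_tac (bracket_along sB sC sk (fun y Uy => (fCE Uy).2) (fun y Uy => (fBE Uy).2) Uz) Uz ((fQE Uz).2).
Qed.

Lemma lie_fAfP z : U z -> lie_bracket fA fP z = 0.
Proof.
move=> Uz; have [sA sB sC sP sQ] := smooth_frame.
apply: (chart_vector_inj chartF Uz).
- bracket_tac (bracket_along sA sP sh (fun y Uy => (fPE Uy).1.1.1.1) (fun y Uy => (fAE Uy).1.1.1.1) Uz) Uz
    (along_zero h z).
- bracket_tac (bracket_along sA sP se (fun y Uy => (fPE Uy).1.1.1.2) (fun y Uy => (fAE Uy).1.1.1.2) Uz) Uz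
    (along_zero e z).
- bracket_tac (bracket_along sA sP sf (fun y Uy => (fPE Uy).1.1.2) (fun y Uy => (fAE Uy).1.1.2) Uz) Uz
    (along_zero f z).
- bracket_tac (bracket_along sA sP sg (fun y Uy => (fPE Uy).1.2) (fun y Uy => (fAE Uy).1.2) Uz) Uz
    (along_zero g z).
- bracket_tac (bracket_along sA sP sk (fun y Uy => (fPE Uy).2) (fun y Uy => (fAE Uy).2) Uz) Uz (along_zero k z).
Qed.

Lemma lie_fBfP z : U z -> lie_bracket fB fP z = 0.
Proof.
move=> Uz; have [sA sB sC sP sQ] := smooth_frame.
apply: (chart_vector_inj chartF Uz).
- bracket_tac (bracket_along sB sP sh (fun y Uy => (fPE Uy).1.1.1.1) (fun y Uy => (fBE Uy).1.1.1.1) Uz) Uz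
    (along_zero h z).
- bracket_tac (bracket_along sB sP se (fun y Uy => (fPE Uy).1.1.1.2) (fun y Uy => (fBE Uy).1.1.1.2) Uz) Uz
    (along_zero e z).
- bracket_tac (bracket_along sB sP sf (fun y Uy => (fPE Uy).1.1.2) (fun y Uy => (fBE Uy).1.1.2) Uz) Uz
    (along_zero f z).
- bracket_tac (bracket_along sB sP sg (fun y Uy => (fPE Uy).1.2) (fun y Uy => (fBE Uy).1.2) Uz) Uz
    (along_zero g z).
- bracket_tac (bracket_along sB sP sk (fun y Uy => (fPE Uy).2) (fun y Uy => (fBE Uy).2) Uz) Uz (along_zero k z).
Qed.

Lemma lie_fBfQ z : U z -> lie_bracket fB fQ z = 0.
Proof.
move=> Uz; have [sA sB sC sP sQ] := smooth_frame.
apply: (chart_vector_inj chartF Uz).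
- bracket_tac (bracket_along sB sQ sh (fun y Uy => (fQE Uy).1.1.1.1) (fun y Uy => (fBE Uy).1.1.1.1) Uz) Uz
    (along_zero h z).
- bracket_tac (bracket_along sB sQ se (fun y Uy => (fQE Uy).1.1.1.2) (fun y Uy => (fBE Uy).1.1.1.2) Uz) Uz
    (along_zero e z).
- bracket_tac (bracket_along sB sQ sf (fun y Uy => (fQE Uy).1.1.2) (fun y Uy => (fBE Uy).1.1.2) Uz) Uz
    (along_zero f z).
- bracket_tac (bracket_along sB sQ sg (fun y Uy => (fQE Uy).1.2) (fun y Uy => (fBE Uy).1.2) Uz) Uz
    (along_zero g z).
- bracket_tac (bracket_along sB sQ sk (fun y Uy => (fQE Uy).2) (fun y Uy => (fBE Uy).2) Uz) Uz (along_zero k z).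
Qed.

End Frame.

(** * The growth vector (2,3,5) *)

Section Distribution235.
Context {R : realType}.
Local Notation pt := 'rV[R]_5.
Local Notation O := (split_octonion R).
Variables (U : set pt) (F : pt -> O) (D : Defs.distribution R 4).
Hypothesis chartF : null_chart U F.
Hypothesis nullD : forall z, U z -> forall v, D z v <-> null_direction F z v.

Local Notation h := (ch F).
Local Notation e := (ce F).
Local Notation f := (cf F).
Local Notation g := (cg F).
Local Notation k := (ck F).
Local Notation fA := (fA F).
Local Notation fB := (fB F).
Local Notation fC := (fC F).
Local Notation fP := (fP F).
Local Notation fQ := (fQ F).

Let oU : open U. Proof. by case: chartF. Qed.

Lemma along_vec0 (phi : pt -> R) z : along (fun=> 0 : pt) phi z = 0.
Proof. by apply: big1 => i _; rewrite mxE mul0r. Qed.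

Lemma along_vecZ (c : R) (v : pt) (phi : pt -> R) z :
  along (fun=> c *: v) phi z = c * along (fun=> v) phi z.
Proof.
rewrite (along_lin phi (c := c) (X := fun=> v) (Y := fun=> 0)) ?addr0//.
by rewrite along_vec0 addr0.
Qed.

Lemma along_vecD (v w : pt) (phi : pt -> R) z :
  along (fun=> v + w) phi z = along (fun=> v) phi z + along (fun=> w) phi z.
Proof.
by rewrite (along_lin phi (c := 1) (X := fun=> v) (Y := fun=> w)) ?scale1r// mul1r.
Qed.

Definition along_vec := (along_vecD, along_vecZ).

Lemma dist_frame z : U z -> D z = [set v | v \in <<[:: fA z; fB z]>>%VS].
Proof.
move=> Uz; apply/seteqP; split=> v.
  move=> /(nullD Uz)/(null_directionP chartF _ Uz)[Eh Ee Eg] /=; apply/span2P.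
  exists (along (fun=> v) f z), (along (fun=> v) k z).
  apply: (chart_vector_inj chartF Uz); rewrite !along_vec !(frame_along_at chartF Uz) ?Ee ?Eg ?Eh; ring.
move=> /= /span2P[x [y ->]]; apply/(nullD Uz)/(null_directionP chartF _ Uz).
by rewrite !along_vec !(frame_along_at chartF Uz); split; ring.
Qed.

(** Up to the factor 6 these are the equations [cartan1] = [cartan2] = 0 of the coframe introduced
    below. *)
Definition rank3_direction z (v : pt) :=
  along (fun=> v) e z + 2 * f z * along (fun=> v) h z - h z * along (fun=> v) f z
    - f z * f z * along (fun=> v) k z + f z * k z * along (fun=> v) f z = 0 /\
  along (fun=> v) g z + 2 * k z * along (fun=> v) h z - h z * along (fun=> v) k z
    - f z * k z * along (fun=> v) k z + k z * k z * along (fun=> v) f z = 0.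

Lemma rank3_directionP z v : U z ->
  rank3_direction z v <-> v \in <<[:: fA z; fB z; fC z]>>%VS.
Proof.
move=> Uz; split=> [[E1 E2]|/span3P[x [y [c ->]]]].
  apply/span3P; exists (along (fun=> v) f z), (along (fun=> v) k z),
    ((f z * along (fun=> v) k z - k z * along (fun=> v) f z - along (fun=> v) h z) / 2).
  apply: (chart_vector_inj chartF Uz); rewrite !along_vec !(frame_along_at chartF Uz).
  - by field.
  - by apply/eqP; rewrite -subr_eq0; apply/eqP; rewrite -[RHS]E1; field.
  - by field.
  - by apply/eqP; rewrite -subr_eq0; apply/eqP; rewrite -[RHS]E2; field.
  - by field.
by rewrite /rank3_direction !along_vec !(frame_along_at chartF Uz); split; field.
Qed.

Lemma frame_span z v : U z -> exists x1 x2 x3 x4 x5 : R,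
  v = x1 *: fA z + x2 *: fB z + x3 *: fC z + x4 *: fP z + x5 *: fQ z.
Proof.
move=> Uz; have half (a b : R) : 2 * a = b -> a = b / 2 by move=> <-; field.
set h' := along (fun=> v) h z; set e' := along (fun=> v) e z; set f' := along (fun=> v) f z.
set g' := along (fun=> v) g z; set k' := along (fun=> v) k z.
set c := (f z * k' - k z * f' - h') / 2.
exists f', k', c, ((e' - (h z + f z * k z) * f' + f z * f z * k' - 4 * f z * c) / 6),
  ((g' - k z * k z * f' - (h z - f z * k z) * k' - 4 * k z * c) / 6).
by apply: (chart_vector_inj chartF Uz); rewrite !along_vec !(frame_along_at chartF Uz)
  -/h' -/e' -/f' -/g' -/k' /c; field.
Qed.

Lemma frame_free z : U z -> forall x1 x2 x3 x4 x5 : R,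
  x1 *: fA z + x2 *: fB z + x3 *: fC z + x4 *: fP z + x5 *: fQ z = 0 ->
  [/\ x1 = 0, x2 = 0, x3 = 0, x4 = 0 & x5 = 0].
Proof.
move=> Uz x1 x2 x3 x4 x5 E.
have El phi := congr1 (fun v => along (fun=> v) phi z) E.
have := El h; have := El e; have := El f; have := El g; have := El k.
rewrite !along_vec !(frame_along_at chartF Uz) !along_vec0 => E5 E4 E3 E2 E1.
have X1 : x1 = 0 by lra.
have X2 : x2 = 0 by lra.
have X3 : x3 = 0 by move: E1; rewrite X1 X2; lra.
by split=> //; [move: E2|move: E4]; rewrite X1 X2 X3; lra.
Qed.

Lemma lie_bracket_scale (X : vector_field R 4) phi z : smooth_vf U X -> smooth U phi -> U z ->
  lie_bracket X (fun y => phi y *: X y) z = along X phi z *: X z.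
Proof.
move=> sX sphi Uz; apply/rowP => j; rewrite !mxE sumrB /=.
have E : (fun y => (phi y *: X y) 0 j) = (fun y => phi y * X y 0 j).
  by apply/funext => y; rewrite mxE.
have dphi := smooth_differentiable sphi Uz; have dX := smooth_differentiable (sX j) Uz.
rewrite -/(along X _ z) {}E alongM // -[X in _ - X]/(along (fun y => phi y *: X y) (fun y => X y 0 j) z).
have -> : along (fun y => phi y *: X y) (fun y => X y 0 j) z =
    phi z * along X (fun y => X y 0 j) z by exact: along_vecZ.
by rewrite addrK.
Qed.

Lemma lie_bracket_anti (X Y : vector_field R 4) z : lie_bracket X Y z = - lie_bracket Y X z.
Proof. by apply/rowP => j; rewrite !mxE -sumrN; apply: eq_bigr => i _; rewrite opprB. Qed.

Lemma frame_section V : V `<=` U -> section_of V D fA /\ section_of V D fB.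
Proof.
move=> VU; have [sA sB _ _ _] := smooth_frame chartF.
by split; split=> [i|y /VU Uy]; rewrite ?dist_frame //=; do ?[apply: smooth_sub VU _];
  do ?[exact: sA|exact: sB]; apply: memv_span; rewrite !inE eqxx ?orbT.
Qed.

(** The equations of [null_directionP] hold on a neighbourhood for both fields, so those of one
    field can be differentiated along the other. Inserted in the two equations, the second
    derivatives of f and k cancel, and so do the remaining products of first derivatives. *)
Lemma rank3_bracket V X Y z : open V -> V z -> U z -> section_of V D X -> section_of V D Y ->
  rank3_direction z (lie_bracket X Y z).
Proof.
move=> oV Vz Uz [sX DX] [sY DY]; set N := V `&` U.
have oN : open N by exact: openI.
have Nz : N z by [].
have NU : N `<=` U by move=> ? [].
have sXN : smooth_vf N X by move=> i; apply: smooth_sub (sX i) => ? [].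
have sYN : smooth_vf N Y by move=> i; apply: smooth_sub (sY i) => ? [].
have sh := smooth_sub NU (smooth_ch chartF); have se := smooth_sub NU (smooth_ce chartF).
have sf := smooth_sub NU (smooth_cf chartF); have sg := smooth_sub NU (smooth_cg chartF).
have sk := smooth_sub NU (smooth_ck chartF).
have dirX y : N y -> [/\ along X h y = f y * along X k y - k y * along X f y,
    along X e y = h y * along X f y - f y * along X h y &
    along X g y = h y * along X k y - k y * along X h y].
  by move=> [Vy Uy]; apply/(null_directionP chartF (X y) Uy)/nullD => //; exact: DX.
have dirY y : N y -> [/\ along Y h y = f y * along Y k y - k y * along Y f y,
    along Y e y = h y * along Y f y - f y * along Y h y &
    along Y g y = h y * along Y k y - k y * along Y h y].
  by move=> [Vy Uy]; apply/(null_directionP chartF (Y y) Uy)/nullD => //; exact: DY.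
have br phi : smooth N phi -> along (fun=> lie_bracket X Y z) phi z =
    along X (along Y phi) z - along Y (along X phi) z.
  by move=> sphi; exact: (along_bracket oN sXN sYN sphi Nz).
have along_det (Z T : vector_field R 4) a b : smooth_vf N T -> smooth N a -> smooth N b ->
    along Z (fun y => a y * along T b y - b y * along T a y) z =
    along Z a z * along T b z + a z * along Z (along T b) z
    - (along Z b z * along T a z + b z * along Z (along T a) z).
  move=> sT sa sb.
  have da := smooth_differentiable sa Nz; have db := smooth_differentiable sb Nz.
  have da' := smooth_differentiable (smooth_along oN sT sa) Nz.
  have db' := smooth_differentiable (smooth_along oN sT sb) Nz.
  by rewrite alongB ?alongM //; exact: differentiableM.
have nest (Z T : vector_field R 4) c a b : (forall y, N y -> along T c y = a y * along T b y - b y * along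
  T a y) ->
    along Z (along T c) z = along Z (fun y => a y * along T b y - b y * along T a y) z.
  by move=> E; exact: (along_near Z oN Nz E).
rewrite /rank3_direction !br //.
rewrite (nest X Y e h f) => [|y /dirY[]//]; rewrite (nest Y X e h f) => [|y /dirX[]//].
rewrite (nest X Y g h k) => [|y /dirY[]//]; rewrite (nest Y X g h k) => [|y /dirX[]//].
rewrite !along_det //.
rewrite (nest X Y h f k) => [|y /dirY[]//]; rewrite (nest Y X h f k) => [|y /dirX[]//].
rewrite !along_det //.
have [-> _ _] := dirX _ Nz; have [-> _ _] := dirY _ Nz.
move: (along X (along Y f) z) (along Y (along X f) z) (along X (along Y k) z) (along Y (along X k) z).
move: (along X f z) (along Y f z) (along X k z) (along Y k z) (h z) (f z) (k z).
by move=> *; split; ring.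
Qed.

Lemma rank3_distribution z : U z ->
  bracket_distribution D D z = [set v | v \in <<[:: fA z; fB z; fC z]>>%VS].
Proof.
move=> Uz; have [sA sB sC sP sQ] := smooth_frame chartF.
have [secA secB] := @frame_section U (fun=> id).
have [_ DA] := secA; have [_ DB] := secB.
apply/seteqP; split=> [v [s [Hs]]|v] /=.
  have Ds u : u \in s -> u \in <<[:: fA z; fB z; fC z]>>%VS.
    move=> /Hs[V [X [Y [oV Vz sX sY ->]]]].
    exact/rank3_directionP/(rank3_bracket oV).
  move=> vs; apply: subvP vs; apply/span_subvP => u; exact: Ds.
move=> vABC; exists [:: fA z; fB z; fC z]; split=> // u.
rewrite !inE => /or3P[] /eqP->.
(* The derivative of f along [fA] is 1, so bracketing [fA] with its multiple by f returns [fA];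
   likewise for [fB] and k. Thus the generators of [D] themselves are values of brackets. *)
- exists U, fA, (fun y => f y *: fA y); split=> //.
  + split=> [i|y Uy].
      refine (smooth_near oU _ (smoothM oU (smooth_cf chartF) (sA i))) => y _; by rewrite [RHS]mxE.
    by rewrite dist_frame //; apply/span2P; exists (f y), 0; rewrite scale0r addr0.
  + rewrite (lie_bracket_scale sA (smooth_cf chartF) Uz).
    by rewrite !(frame_along chartF Uz) scale1r.
- exists U, fB, (fun y => k y *: fB y); split=> //.
  + split=> [i|y Uy].
      refine (smooth_near oU _ (smoothM oU (smooth_ck chartF) (sB i))) => y _; by rewrite [RHS]mxE.
    by rewrite dist_frame //; apply/span2P; exists 0, (k y); rewrite scale0r add0r.
  + rewrite (lie_bracket_scale sB (smooth_ck chartF) Uz).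
    by rewrite !(frame_along chartF Uz) scale1r.
- by exists U, fB, fA; split=> //; rewrite (lie_fBfA chartF).
Qed.

Lemma rank5_distribution z : U z ->
  bracket_distribution (bracket_distribution D D) D z = setT.
Proof.
move=> Uz; have [sA sB sC sP sQ] := smooth_frame chartF.
have [secA secB] := @frame_section U (fun=> id).
have sec3 X : smooth_vf U X -> (forall y, U y -> X y \in [:: fA y; fB y; fC y]) ->
    section_of U (bracket_distribution D D) X.
  by move=> sX HX; split=> // y Uy; rewrite rank3_distribution //=; apply: memv_span; exact: HX.
have secA3 : section_of U (bracket_distribution D D) fA.
  by apply: sec3 => // y _; rewrite !inE eqxx.
have secB3 : section_of U (bracket_distribution D D) fB.
  by apply: sec3 => // y _; rewrite !inE eqxx ?orbT.
have secC3 : section_of U (bracket_distribution D D) fC.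
  by apply: sec3 => // y _; rewrite !inE eqxx ?orbT.
apply/seteqP; split=> // v _.
(* The signs come from the order of the arguments: the section of the rank 3 distribution stands
   first, and the bracket of [fC] with [fA] is minus [fP]. *)
exists [:: fA z; fB z; fC z; - fP z; - fQ z]; split=> [u|]; last first.
  have [x1 [x2 [x3 [x4 [x5 ->]]]]] := frame_span v Uz.
  have sp w : w \in [:: fA z; fB z; fC z; - fP z; - fQ z] ->
    w \in <<[:: fA z; fB z; fC z; - fP z; - fQ z]>>%VS by exact: memv_span.
  have opp (x : R) (w : pt) : x *: w = (- x) *: - w by rewrite scaleNr scalerN opprK.
  rewrite (opp x4) (opp x5).
  by apply: memvD; [apply: memvD; [apply: memvD; [apply: memvD|]|]|];
    apply: memvZ; apply: sp; rewrite !inE eqxx ?orbT.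
rewrite !inE => /orP[/eqP->|/orP[/eqP->|/orP[/eqP->|/orP[/eqP->|/eqP->]]]].
- exists U, fA, (fun y => f y *: fA y); split=> //.
  + split=> [i|y Uy].
      refine (smooth_near oU _ (smoothM oU (smooth_cf chartF) (sA i))) => y _; by rewrite [RHS]mxE.
    by rewrite dist_frame //; apply/span2P; exists (f y), 0; rewrite scale0r addr0.
  + rewrite (lie_bracket_scale sA (smooth_cf chartF) Uz).
    by rewrite !(frame_along chartF Uz) scale1r.
- exists U, fB, (fun y => k y *: fB y); split=> //.
  + split=> [i|y Uy].
      refine (smooth_near oU _ (smoothM oU (smooth_ck chartF) (sB i))) => y _; by rewrite [RHS]mxE.
    by rewrite dist_frame //; apply/span2P; exists 0, (k y); rewrite scale0r add0r.
  + rewrite (lie_bracket_scale sB (smooth_ck chartF) Uz).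
    by rewrite !(frame_along chartF Uz) scale1r.
- by exists U, fB, fA; split=> //; rewrite (lie_fBfA chartF).
- by exists U, fC, fA; split=> //; rewrite lie_bracket_anti (lie_fAfC chartF).
- by exists U, fC, fB; split=> //; rewrite lie_bracket_anti (lie_fBfC chartF).
Qed.

End Distribution235.

(** * Cartan's coframe and the flat metric *)

Section ExactSums.
Context {R : realType} {n : nat}.
Local Notation pt := 'rV[R]_n.+1.
Implicit Types (U : set pt) (p z : pt) (s : seq ((pt -> R) * (pt -> R))).

(** Forms written as sums of a db: their exterior derivative is the sum of da /\ db, and no second
    derivative survives. *)
Definition exact_sum s : one_form R n := fun z => \sum_(q <- s) q.1 z *: differential q.2 z.

Lemma exact_sumE s z j : exact_sum s z j 0 = \sum_(q <- s) q.1 z * partial j q.2 z.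
Proof. by rewrite /exact_sum summxE; apply: eq_bigr => q _; rewrite !mxE. Qed.

Definition smooth_pairs U s := forall i, smooth U (nth (fun=> 0, fun=> 0) s i).1 /\
  smooth U (nth (fun=> 0, fun=> 0) s i).2.

Lemma smooth_pairs_nil U : smooth_pairs U [::].
Proof. by move=> i; rewrite nth_nil; split; exact: smooth_cst. Qed.

Lemma smooth_pairs_cons U a b s : smooth U a -> smooth U b -> smooth_pairs U s ->
  smooth_pairs U ((a, b) :: s).
Proof. by move=> sa sb ss [|i] //=; exact: ss. Qed.

Lemma smooth_exact_sum U s : open U -> smooth_pairs U s -> smooth_form U (exact_sum s).
Proof.
move=> oU ss j; refine (smooth_near oU (fun z _ => esym (exact_sumE s z j)) _).
elim: s ss => [|[a b] s IH] ss.
  by refine (smooth_near oU _ (smooth_cst (U := U) 0)) => z _; rewrite big_nil.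
have /= [sa sb] := ss 0%N; have IHs := IH (fun i => ss i.+1).
have sS := smoothD oU (smoothM oU sa (smooth_partial j sb)) IHs.
by refine (smooth_near oU _ sS) => z _; rewrite big_cons.
Qed.

Lemma ext_d_exact_sum U s p : open U -> smooth_pairs U s -> U p ->
  ext_d (exact_sum s) p = \sum_(q <- s) wedge (differential q.1 p) (differential q.2 p).
Proof.
move=> oU ss Up; apply/matrixP => i j; rewrite mxE summxE.
have E (k l : 'I_n.+1) : partial k (fun y => exact_sum s y l 0) p =
    \sum_(q <- s) (partial k q.1 p * partial l q.2 p + q.1 p * partial k (partial l q.2) p).
  under eq_fun do rewrite exact_sumE.
  elim: s ss => [|[a b] s IH] ss.
    by under eq_fun do rewrite big_nil; rewrite big_nil partial_cst.
  have /= [sa sb] := ss 0%N.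
  have da := smooth_differentiable sa Up.
  have db := smooth_differentiable (smooth_partial l sb) Up.
  under eq_fun do rewrite big_cons; rewrite big_cons /= partialD; last first.
  - exact: (near_differentiable oU Up (fun z _ => exact_sumE s z l)
      (smooth_differentiable (smooth_exact_sum oU (fun i => ss i.+1) l) Up)).
  - exact: differentiableM.
  by rewrite partialM // (IH (fun i => ss i.+1)).
rewrite !E -sumrB; elim: s ss {E} => [|[a b] s IH] ss; first by rewrite !big_nil.
have /= [sa sb] := ss 0%N.
rewrite !big_cons (IH (fun i => ss i.+1)); congr (_ + _).
by rewrite /= !mxE !big_ord1 !mxE (partialC i j oU sb Up); ring.
Qed.

Lemma differential_cst (c : R) p : differential (fun=> c) p = 0 :> 'cV[R]_n.+1.
Proof. by apply/colP => i; rewrite !mxE partial_cst. Qed.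

Definition pairing (v : pt) (a : 'cV[R]_n.+1) : R := (v *m a) 0 0.

Lemma pairing_eq0 v a : v *m a = 0 <-> pairing v a = 0.
Proof.
split=> [E|E]; first by rewrite /pairing E mxE.
by apply/matrixP => i j; rewrite !ord1 [RHS]mxE.
Qed.

Lemma pairingD v a b : pairing v (a + b) = pairing v a + pairing v b.
Proof. by rewrite /pairing mulmxDr mxE. Qed.

Lemma pairingZ v c a : pairing v (c *: a) = c * pairing v a.
Proof. by rewrite /pairing -scalemxAr mxE. Qed.

Lemma pairing_differential v (phi : pt -> R) z :
  pairing v (differential phi z) = along (fun=> v) phi z.
Proof. by rewrite /pairing mxE; apply: eq_bigr => i _; rewrite mxE. Qed.

Lemma pairing_exact_sum v s z : pairing v (exact_sum s z) =
  \sum_(q <- s) q.1 z * along (fun=> v) q.2 z.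
Proof.
rewrite /exact_sum; elim: s => [|q s IH]; first by rewrite !big_nil /pairing mulmx0 mxE.
by rewrite !big_cons pairingD pairingZ pairing_differential IH.
Qed.

End ExactSums.

Section CartanCoframe.
Context {R : realType}.
Local Notation pt := 'rV[R]_5.
Local Notation O := (split_octonion R).
Variables (U : set pt) (F : pt -> O) (D : Defs.distribution R 4).
Hypothesis chartF : null_chart U F.
Hypothesis nullD : forall z, U z -> forall v, D z v <-> null_direction F z v.

Local Notation h := (ch F).
Local Notation e := (ce F).
Local Notation f := (cf F).
Local Notation g := (cg F).
Local Notation k := (ck F).

Let oU : open U. Proof. by case: chartF. Qed.
Let sh := smooth_ch chartF.
Let se := smooth_ce chartF.
Let sf := smooth_cf chartF.
Let sg := smooth_cg chartF.
Let sk := smooth_ck chartF.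

(** All coefficients are fixed by duality: [cartan1], ..., [cartan5] is the coframe dual to ([fP],
    [fQ], [fC], [fA], [fB]). *)
Definition pairs1 : seq ((pt -> R) * (pt -> R)) :=
  [:: (fun=> 6^-1, e); (fun z => 3^-1 * f z, h); (fun z => - 6^-1 * h z, f);
      (fun z => - 6^-1 * (f z * f z), k); (fun z => 6^-1 * (f z * k z), f)].
Definition pairs2 : seq ((pt -> R) * (pt -> R)) :=
  [:: (fun=> 6^-1, g); (fun z => 3^-1 * k z, h); (fun z => - 6^-1 * h z, k);
      (fun z => - 6^-1 * (f z * k z), k); (fun z => 6^-1 * (k z * k z), f)].
Definition pairs3 : seq ((pt -> R) * (pt -> R)) :=
  [:: (fun=> - 2^-1, h); (fun z => 2^-1 * f z, k); (fun z => - 2^-1 * k z, f)].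

Definition cartan1 := exact_sum pairs1.
Definition cartan2 := exact_sum pairs2.
Definition cartan3 := exact_sum pairs3.
Definition cartan4 := exact_sum [:: (fun=> 1, f)].
Definition cartan5 := exact_sum [:: (fun=> 1, k)].

Let smooth_pairs_cartan : [/\ smooth_pairs U pairs1, smooth_pairs U pairs2,
  smooth_pairs U pairs3, smooth_pairs U [:: (fun=> 1, f)] & smooth_pairs U [:: (fun=> 1, k)]].
Proof.
by split; repeat first [apply: smooth_pairs_nil | apply: smooth_pairs_cons | exact: sh | exact: se
  | exact: sf | exact: sg | exact: sk | exact: smooth_cst | exact: oU | apply: smoothZ | apply: smoothM].
Qed.

Lemma smooth_cartan : [/\ smooth_form U cartan1, smooth_form U cartan2,
  smooth_form U cartan3, smooth_form U cartan4 & smooth_form U cartan5].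
Proof. by have [? ? ? ? ?] := smooth_pairs_cartan; split; exact: smooth_exact_sum. Qed.

Lemma pairing_cartan v z
  (h' := along (fun=> v) h z) (e' := along (fun=> v) e z) (f' := along (fun=> v) f z)
  (g' := along (fun=> v) g z) (k' := along (fun=> v) k z) :
  [/\ pairing v (cartan1 z) = 6^-1 * (e' + 2 * f z * h' - h z * f' - f z * f z * k' + f z * k z * f'),
      pairing v (cartan2 z) = 6^-1 * (g' + 2 * k z * h' - h z * k' - f z * k z * k' + k z * k z * f'),
      pairing v (cartan3 z) = - 2^-1 * (h' - f z * k' + k z * f'),
      pairing v (cartan4 z) = f' & pairing v (cartan5 z) = k'].
Proof.
by rewrite !pairing_exact_sum !big_cons !big_nil /= -/h' -/e' -/f' -/g' -/k'; split; field.
Qed.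

Let vanishing_connection p (t1 t2 t3 t4 t5 : one_form R 4) :
  [/\ ext_d t1 p = wedge (t3 p) (t4 p), ext_d t2 p = wedge (t3 p) (t5 p),
      ext_d t3 p = wedge (t4 p) (t5 p), ext_d t4 p = 0 & ext_d t5 p = 0] ->
  [/\ ext_d t1 p = wedge (t1 p) (2 *: 0 + 0) + wedge (t2 p) 0 + wedge (t3 p) (t4 p),
      ext_d t2 p = wedge (t1 p) 0 + wedge (t2 p) (0 + 2 *: 0) + wedge (t3 p) (t5 p),
      ext_d t3 p = wedge (t1 p) 0 + wedge (t2 p) 0 + wedge (t3 p) (0 + 0) + wedge (t4 p) (t5 p),
      ext_d t4 p = wedge (t1 p) 0 + (4 / 3) *: wedge (t3 p) 0 + wedge (t4 p) 0 + wedge (t5 p) 0 &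
      ext_d t5 p = wedge (t2 p) 0 - (4 / 3) *: wedge (t3 p) 0 + wedge (t4 p) 0 + wedge (t5 p) 0].
Proof.
have w0 (a : 'cV[R]_5) : wedge a 0 = 0 by rewrite /wedge trmx0 mulmx0 mul0mx subr0.
move=> [-> -> -> -> ->].
by rewrite !(scaler0, addr0, w0, oppr0, add0r).
Qed.

(** Dual form of the constant bracket relations of the frame: every dtheta is a constant combination
    of wedge products, namely those terms of Cartan's equations that contain no Omega. *)
Lemma cartan_structure_chart : cartan_structure_equations U cartan1 cartan2 cartan3 cartan4 cartan5
  (fun=> 0) (fun=> 0) (fun=> 0) (fun=> 0) (fun=> 0) (fun=> 0) (fun=> 0).
Proof.
move=> p Up; apply: vanishing_connection; have [s1 s2 s3 s4 s5] := smooth_pairs_cartan.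
have dh := smooth_differentiable sh Up; have de := smooth_differentiable se Up.
have df := smooth_differentiable sf Up; have dg := smooth_differentiable sg Up.
have dk := smooth_differentiable sk Up.
rewrite /cartan1 /cartan2 /cartan3 /cartan4 /cartan5.
rewrite (ext_d_exact_sum oU s1 Up) (ext_d_exact_sum oU s2 Up) (ext_d_exact_sum oU s3 Up).
rewrite (ext_d_exact_sum oU s4 Up) (ext_d_exact_sum oU s5 Up).
have dM (c : R) (a b : pt -> R) : differentiable a p -> differentiable b p ->
    differential (fun z => c * (a z * b z)) p = (c * b p) *: differential a p + (c * a p) *: differential b p.
  move=> da db; apply/colP => i; rewrite !mxE.
  have dab : differentiable (fun z => a z * b z) p by exact: differentiableM.
  have dc : differentiable (fun=> c : R) p by exact: differentiable_cst.
  by rewrite partialM // partial_cst partialM //; ring.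
have dZ (c : R) (a : pt -> R) : differentiable a p -> differential (fun z => c * a z) p = c *: differential a p.
  move=> da; apply/colP => i; rewrite !mxE.
  have dc : differentiable (fun=> c : R) p by exact: differentiable_cst.
  by rewrite partialM // partial_cst; ring.
rewrite /exact_sum !big_cons !big_nil /= !differential_cst.
rewrite !(dM _ f f df df) !(dM _ f k df dk) !(dM _ k k dk dk) !(dZ _ h dh) !(dZ _ f df) !(dZ _ k dk).
move: (differential h p) (differential e p) (differential f p) (differential g p) (differential k p).
move: (h p) (e p) (f p) (g p) (k p) => {}h {}e {}f {}g {}k dH dE dF dG dK.
split; apply/matrixP => i j; rewrite !mxE !big_ord1 !mxE.
all: move: (dH i 0) (dE i 0) (dF i 0) (dG i 0) (dK i 0) (dH j 0) (dE j 0) (dF j 0) (dG j 0) (dK j 0).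
all: by move=> *; field.
Qed.

End CartanCoframe.

(** * Nurowski's metric and conformal flatness in a chart *)

Section ChartConclusions.
Context {R : realType}.
Local Notation pt := 'rV[R]_5.
Local Notation O := (split_octonion R).
Variables (U : set pt) (F : pt -> O) (D : Defs.distribution R 4).
Hypothesis chartF : null_chart U F.
Hypothesis nullD : forall z, U z -> forall v, D z v <-> null_direction F z v.

Local Notation h := (ch F).
Local Notation e := (ce F).
Local Notation f := (cf F).
Local Notation g := (cg F).
Local Notation k := (ck F).

Let oU : open U. Proof. by case: chartF. Qed.

Lemma free5 (W : vectType R) (a b c d e' : W) :
  (forall x1 x2 x3 x4 x5 : R, x1 *: a + x2 *: b + x3 *: c + x4 *: d + x5 *: e' = 0 ->
    [/\ x1 = 0, x2 = 0, x3 = 0, x4 = 0 & x5 = 0]) -> free [:: a; b; c; d; e'].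
Proof.
move=> H; have -> : [:: a; b; c; d; e'] = [tuple a; b; c; d; e'] by []; apply/freeP => x.
rewrite sum5 /= => /H[? ? ? ? ?]; exact: ord5.
Qed.

Lemma pairing_lin5 (v : pt) (x1 x2 x3 x4 x5 : R) (a b c d e' : 'cV[R]_5) :
  pairing v (x1 *: a + x2 *: b + x3 *: c + x4 *: d + x5 *: e') =
  x1 * pairing v a + x2 * pairing v b + x3 * pairing v c + x4 * pairing v d + x5 * pairing v e'.
Proof. by rewrite !pairingD !pairingZ. Qed.

Lemma pairing0 (v : pt) : pairing v 0 = 0.
Proof. by rewrite /pairing mulmx0 mxE. Qed.

Lemma free_cartan z : U z ->
  free [:: cartan1 F z; cartan2 F z; cartan3 F z; cartan4 F z; cartan5 F z].
Proof.
move=> Uz; apply: free5 => x1 x2 x3 x4 x5 E0.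
have E v := congr1 (pairing v) E0.
have := E (fA F z); have := E (fB F z); have := E (fC F z); have := E (fP F z); have := E (fQ F z).
rewrite !pairing_lin5 !pairing0.
have [-> -> -> -> ->] := pairing_cartan F (fA F z) z.
have [-> -> -> -> ->] := pairing_cartan F (fB F z) z.
have [-> -> -> -> ->] := pairing_cartan F (fC F z) z.
have [-> -> -> -> ->] := pairing_cartan F (fP F z) z.
have [-> -> -> -> ->] := pairing_cartan F (fQ F z) z.
rewrite !(frame_along_at chartF Uz).
move: (h z) (e z) (f z) (g z) (k z) => h0 e0 f0 g0 k0 E5 E4 E3 E2 E1.
have X1 : x1 = 0 by lra.
have X2 : x2 = 0 by lra.
subst x1 x2.
have X3 : x3 = 0 by lra.
subst x3; by split => //; lra.
Qed.

Lemma cartan_kernel z : U z ->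
  D z = [set v | [/\ v *m cartan1 F z = 0, v *m cartan2 F z = 0 & v *m cartan3 F z = 0]].
Proof.
move=> Uz; apply/seteqP; split=> v /=.
  move=> /(nullD Uz)/(null_directionP chartF _ Uz)[Eh Ee Eg].
  split; apply/pairing_eq0; have [E1 E2 E3 _ _] := pairing_cartan F v z.
  - by rewrite E1 Ee Eh; ring.
  - by rewrite E2 Eg Eh; ring.
  - by rewrite E3 Eh; ring.
move=> [/pairing_eq0 + /pairing_eq0 + /pairing_eq0 +].
have [-> -> -> _ _] := pairing_cartan F v z => H1 H2 H3.
apply/(nullD Uz)/(null_directionP chartF _ Uz); move: H1 H2 H3.
move: (along _ h z) (along _ e z) (along _ f z) (along _ g z) (along _ k z).
move: (h z) (e z) (f z) (g z) (k z) => h0 e0 f0 g0 k0 h' e' f' g' k' H1 H2 H3.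
have Eh : h' = f0 * k' - k0 * f' by lra.
by split=> //; move: H1 H2; rewrite Eh; lra.
Qed.

Lemma cartan_coframe_chart : cartan_coframe U D (cartan1 F) (cartan2 F) (cartan3 F) (cartan4 F) (cartan5 F).
Proof.
split; [exact: smooth_cartan|exact: free_cartan|exact: cartan_kernel|].
have s0 : smooth_form U (fun=> 0 : 'cV[R]_5).
  by move=> i; refine (smooth_near oU _ (smooth_cst (U := U) 0)) => z _; rewrite mxE.
do 7!exists (fun=> 0); split=> //; split=> //.
exact: cartan_structure_chart.
Qed.

(** Minus the norm form of the octonions, evaluated on dF: since [oc12] is constant on the chart,
    the term in [oc12] and [oc21] drops out. *)
Definition flat_metric : tensor2 R 4 := fun z =>
  sprod (differential h z) (differential h z) + sprod (differential e z) (differential k z)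
  - sprod (differential f z) (differential g z).

Lemma nurowski_metric_chart z : U z ->
  nurowski_metric (cartan1 F) (cartan2 F) (cartan3 F) (cartan4 F) (cartan5 F) z =
  3^-1 *: flat_metric z.
Proof.
move=> Uz; rewrite /nurowski_metric /flat_metric /cartan1 /cartan2 /cartan3 /cartan4 /cartan5 /exact_sum.
rewrite !big_cons !big_nil /=.
move: (differential h z) (differential e z) (differential f z) (differential g z) (differential k z).
move: (h z) (e z) (f z) (g z) (k z) => h0 e0 f0 g0 k0 dH dE dF dG dK.
apply/matrixP => i j; rewrite !mxE !big_ord1 !mxE.
move: (dH i 0) (dE i 0) (dF i 0) (dG i 0) (dK i 0) (dH j 0) (dE j 0) (dF j 0) (dG j 0) (dK j 0).
by move=> *; field.
Qed.

Lemma represents_chart (gm : tensor2 R 4) (lam : pt -> R) : smooth U lam ->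
  (forall z, U z -> lam z != 0 /\ gm z = lam z *: flat_metric z) ->
  exists (t1 t2 t3 t4 t5 : one_form R 4) (mu : pt -> R),
    [/\ cartan_coframe U D t1 t2 t3 t4 t5, smooth U mu &
      forall y, U y -> mu y != 0 /\ gm y = mu y *: nurowski_metric t1 t2 t3 t4 t5 y].
Proof.
move=> sl Hl; exists (cartan1 F), (cartan2 F), (cartan3 F), (cartan4 F), (cartan5 F), (fun z => 3 * lam z).
split; [exact: cartan_coframe_chart|exact: smoothZ|move=> y Uy].
have [l0 ->] := Hl y Uy; split; first by rewrite mulf_neq0 // pnatr_eq0.
by rewrite nurowski_metric_chart // scalerA; congr (_ *: _); field.
Qed.

(** Half sums and half differences turn the products de dk and df dg into differences of squares;
    [flat_sign] records the resulting signs. *)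
Definition flat_coordinate (i : 'I_5) : pt -> R :=
  nth (fun=> 0) [:: h; (fun z => 2^-1 * (e z + k z)); (fun z => 2^-1 * (e z - k z));
    (fun z => 2^-1 * (f z + g z)); (fun z => 2^-1 * (f z - g z))] i.

Definition flat_sign (i : 'I_5) : R := nth 0 [:: 1; 1; -1; -1; 1] i.

Lemma conformally_flat_chart (M : set pt) (gm : tensor2 R 4) (lam : pt -> R) p : U p -> U `<=` M ->
  smooth U lam ->
  (forall z, U z -> lam z != 0 /\ gm z = lam z *: flat_metric z) ->
  exists (V : set pt) (y : 'I_5 -> scalar_field R 4) (lambda : scalar_field R 4) (eps : 'I_5 -> R),
    [/\ [/\ open V, V p & V `<=` M],
        (forall i, smooth V (y i)) /\ smooth V lambda,
        forall i, eps i = 1 \/ eps i = -1 &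
        forall z, V z ->
          [/\ free [tuple differential (y i) z | i < 5], lambda z != 0 &
              gm z = lambda z *: \sum_i eps i *:
                      sprod (differential (y i) z) (differential (y i) z)]].
Proof.
move=> Up UM sl Hl; exists U, flat_coordinate, lam, flat_sign.
have [sh se sf sg] := And4 (smooth_ch chartF) (smooth_ce chartF) (smooth_cf chartF) (smooth_cg chartF).
have sk := smooth_ck chartF.
split=> //.
- by split=> //; apply: ord5 => //=; apply: smoothZ => //; do ?[exact: smoothD|exact: smoothB].
- by apply: ord5; rewrite /flat_sign /=; [left|left|right|right|left].
move=> z Uz; have [l0 ->] := Hl z Uz.
have dh := smooth_differentiable sh Uz; have de := smooth_differentiable se Uz.
have df := smooth_differentiable sf Uz; have dg := smooth_differentiable sg Uz.
have dk := smooth_differentiable sk Uz.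
have dP (a b : pt -> R) : differentiable a z -> differentiable b z ->
    differential (fun z => 2^-1 * (a z + b z)) z = 2^-1 *: (differential a z + differential b z).
  move=> da db; apply/colP => i; rewrite !mxE.
  have dc : differentiable (fun=> 2^-1 : R) z by exact: differentiable_cst.
  have dab : differentiable (fun z => a z + b z) z by exact: differentiableD.
  by rewrite partialM // partial_cst partialD //; ring.
have dM (a b : pt -> R) : differentiable a z -> differentiable b z ->
    differential (fun z => 2^-1 * (a z - b z)) z = 2^-1 *: (differential a z - differential b z).
  move=> da db; apply/colP => i; rewrite !mxE.
  have dc : differentiable (fun=> 2^-1 : R) z by exact: differentiable_cst.
  have dab : differentiable (fun z => a z - b z) z by exact: differentiableB.
  by rewrite partialM // partial_cst partialB //; ring.
have D1 : differential (flat_coordinate i_theta) z = 2^-1 *: (differential e z + differential k z).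
  exact: dP.
have D2 : differential (flat_coordinate i_phi) z = 2^-1 *: (differential e z - differential k z).
  exact: dM.
have D3 : differential (flat_coordinate i_x) z = 2^-1 *: (differential f z + differential g z).
  exact: dP.
have D4 : differential (flat_coordinate i_q) z = 2^-1 *: (differential f z - differential g z).
  exact: dM.
have D0 : differential (flat_coordinate i_psi) z = differential h z by [].
split=> //; last first.
  congr (_ *: _); rewrite sum5 D0 D1 D2 D3 D4 /flat_sign /= /flat_metric.
  move: (differential h z) (differential e z) (differential f z) (differential g z) (differential k z).
  move=> dH dE dF dG dK; apply/matrixP => i j; rewrite !mxE !big_ord1 !mxE.
  move: (dH i 0) (dE i 0) (dF i 0) (dG i 0) (dK i 0) (dH j 0) (dE j 0) (dF j 0) (dG j 0) (dK j 0).
  by move=> *; field.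
apply/freeP => x; rewrite (eq_bigr (fun i => x i *: differential (flat_coordinate i) z)); last first.
  by move=> i _; rewrite -tnth_nth tnth_mktuple.
rewrite sum5 D0 D1 D2 D3 D4 => E0.
have N1 v a : pairing v (- a) = - pairing v a by rewrite -scaleN1r pairingZ mulN1r.
have L v : x i_psi * along (fun=> v) h z
    + x i_theta * (2^-1 * (along (fun=> v) e z + along (fun=> v) k z))
    + x i_phi * (2^-1 * (along (fun=> v) e z - along (fun=> v) k z))
    + x i_x * (2^-1 * (along (fun=> v) f z + along (fun=> v) g z))
    + x i_q * (2^-1 * (along (fun=> v) f z - along (fun=> v) g z)) = 0.
  have := congr1 (pairing v) E0; rewrite pairing0 => <-; rewrite -!pairing_differential.
  move: (differential h z) (differential e z) (differential f z) (differential g z) (differential k z).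
  by move=> dH dE dF dG dK; rewrite pairing_lin5 !pairingZ !pairingD !N1.
have := L (fA F z); rewrite !(frame_along_at chartF Uz) => EA.
have := L (fB F z); rewrite !(frame_along_at chartF Uz) => EB.
have := L (fC F z); rewrite !(frame_along_at chartF Uz) => EC.
have := L (fP F z); rewrite !(frame_along_at chartF Uz) => EP.
have := L (fQ F z); rewrite !(frame_along_at chartF Uz) => EQ.
move: EA EB EC EP EQ.
move: (h z) (e z) (f z) (g z) (k z) => h0 e0 f0 g0 k0.
have P5 : [/\ x i_psi = 0, x i_theta = 0, x i_phi = 0, x i_x = 0 & x i_q = 0] ->
  forall i, x i = 0 by case=> *; exact: (ord5 (P := fun i => x i = 0)).
move: P5; move: (x i_psi) (x i_theta) (x i_phi) (x i_x) (x i_q) => x0 x1 x2 x3 x4 P5 E1 E2 E3 E4 E5.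
apply: P5.
have X21 : x2 = - x1 by lra.
have X43 : x4 = x3 by lra.
subst x2 x4.
have X0 : x0 = 0 by lra.
subst x0; have X3 : x3 = 0 by lra.
subst x3; have X1 : x1 = 0 by lra.
by subst x1; split=> //; rewrite oppr0.
Qed.

End ChartConclusions.

(** * Infinitesimal symmetries *)

Section Prolongation.
Context {R : realType} {T : Type}.
Variables (V : T -> Prop) (S : (T -> R) -> Prop) (A B : (T -> R) -> T -> R).

Definition opC phi : T -> R := fun z => B (A phi) z - A (B phi) z.
Definition opP phi : T -> R := fun z => A (opC phi) z - opC (A phi) z.
Definition opQ phi : T -> R := fun z => B (opC phi) z - opC (B phi) z.

(** All identities hold only on [V], so linearity also has to say that the operator sees only the
    values on [V]. *)
Definition local_linear (L : (T -> R) -> T -> R) := forall phi psi chi (x y : R),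
  S phi -> S psi -> (forall z, V z -> chi z = x * phi z + y * psi z) ->
  forall z, V z -> L chi z = x * L phi z + y * L psi z.

Hypotheses (SA : forall phi, S phi -> S (A phi)) (SB : forall phi, S phi -> S (B phi))
  (SC : forall phi, S phi -> S (opC phi)).
Hypotheses (linA : local_linear A) (linB : local_linear B).
Hypotheses (AP : forall phi z, S phi -> V z -> A (opP phi) z = opP (A phi) z)
  (BP : forall phi z, S phi -> V z -> B (opP phi) z = opP (B phi) z)
  (BQ : forall phi z, S phi -> V z -> B (opQ phi) z = opQ (B phi) z).

Let linC : local_linear opC.
Proof.
move=> phi psi chi x y Sp Sq E z Vz; rewrite /opC.
rewrite (linB (SA Sp) (SA Sq) (linA Sp Sq E) Vz) (linA (SB Sp) (SB Sq) (linB Sp Sq E) Vz).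
by move: (B _ z) (B _ z) (A _ z) (A _ z) => *; ring.
Qed.

Let linP : local_linear opP.
Proof.
move=> phi psi chi x y Sp Sq E z Vz; rewrite /opP.
rewrite (linA (SC Sp) (SC Sq) (linC Sp Sq E) Vz) (linC (SA Sp) (SA Sq) (linA Sp Sq E) Vz).
by move: (opC _ z) (opC _ z) (A _ z) (A _ z) => *; ring.
Qed.

Let linQ : local_linear opQ.
Proof.
move=> phi psi chi x y Sp Sq E z Vz; rewrite /opQ.
rewrite (linB (SC Sp) (SC Sq) (linC Sp Sq E) Vz) (linC (SB Sp) (SB Sq) (linB Sp Sq E) Vz).
by move: (opC _ z) (opC _ z) (B _ z) (B _ z) => *; ring.
Qed.

Let lin1 L phi chi (x : R) : local_linear L -> S phi -> (forall z, V z -> chi z = x * phi z) ->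
  forall z, V z -> L chi z = x * L phi z.
Proof.
move=> lL Sp E z Vz; rewrite (lL phi phi chi x 0 Sp Sp _ z Vz) ?mul0r ?addr0 // => y Vy.
by rewrite E // mul0r addr0.
Qed.

Variables p q c a b : T -> R.
Hypotheses (Sp : S p) (Sq : S q) (Sc : S c) (Sa : S a) (Sb : S b).

Let lin0 L chi : local_linear L -> (forall z, V z -> chi z = 0) -> forall z, V z -> L chi z = 0.
Proof.
move=> lL E z Vz; rewrite (lin1 (phi := p) (x := 0) lL Sp _ Vz) ?mul0r // => y Vy.
by rewrite E // mul0r.
Qed.

(** The symmetry equations for the components of a field in the frame. The coefficients 1 and -1 are
    written out to fit the shape expected by [lin1]. *)
Hypotheses (Ap : forall z, V z -> A p z = -1 * c z) (Bp : forall z, V z -> B p z = 0)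
  (Aq : forall z, V z -> A q z = 0) (Bq : forall z, V z -> B q z = -1 * c z)
  (Ac : forall z, V z -> A c z = 1 * b z) (Bc : forall z, V z -> B c z = -1 * a z).

(** The unknowns (p, q), c, (a, b), (m, n, r, s), (e1, e2), e3, (e4, e5) have the dimensions 2, 1,
    2, 4, 2, 1, 2 of the graded pieces of g2, from degree -3 to degree 3. [A] and [B] raise the
    degree by one. *)
Let m := A a.
Let n := A b.
Let r := B a.
Let s := B b.
Let e1 := A s.
Let e2 := B m.
Let e3 := A e2.
Let e4 := A e3.
Let e5 := B e3.

Let Sm : S m. Proof. exact: SA. Qed.
Let Sn : S n. Proof. exact: SA. Qed.
Let Sr : S r. Proof. exact: SB. Qed.
Let Ss : S s. Proof. exact: SB. Qed.
Let Se1 : S e1. Proof. exact: SA. Qed.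
Let Se2 : S e2. Proof. exact: SB. Qed.
Let Se3 : S e3. Proof. exact: SA. Qed.
Let Se4 : S e4. Proof. exact: SA. Qed.
Let Se5 : S e5. Proof. exact: SB. Qed.

Let Cp z : V z -> opC p z = 1 * a z.
Proof. by move=> Vz; rewrite /opC (lin1 linB Sc Ap Vz) (lin0 linA Bp Vz) Bc //; ring. Qed.
Let Cq z : V z -> opC q z = 1 * b z.
Proof. by move=> Vz; rewrite /opC (lin1 linA Sc Bq Vz) (lin0 linB Aq Vz) Ac //; ring. Qed.
Let Cc z : V z -> opC c z = 1 * m z + 1 * s z.
Proof. by move=> Vz; rewrite /opC (lin1 linA Sa Bc Vz) (lin1 linB Sb Ac Vz) /m /s; ring. Qed.
Let Pp z : V z -> opP p z = 2 * m z + 1 * s z.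
Proof. by move=> Vz; rewrite /opP (lin1 linA Sa Cp Vz) (lin1 linC Sc Ap Vz) Cc // -/m; ring. Qed.
Let Qq z : V z -> opQ q z = 1 * m z + 2 * s z.
Proof. by move=> Vz; rewrite /opQ (lin1 linB Sb Cq Vz) (lin1 linC Sc Bq Vz) Cc // -/s; ring. Qed.
Let Pq z : V z -> opP q z = 1 * n z.
Proof. by move=> Vz; rewrite /opP (lin1 linA Sb Cq Vz) (lin0 linC Aq Vz) -/n; ring. Qed.
Let Qp z : V z -> opQ p z = 1 * r z.
Proof. by move=> Vz; rewrite /opQ (lin1 linB Sa Cp Vz) (lin0 linC Bp Vz) -/r; ring. Qed.
Let Pc z : V z -> opP c z = A m z + A s z - (B n z - A s z).
Proof.
move=> Vz; rewrite /opP (linA Sm Ss Cc Vz) (lin1 linC Sb Ac Vz) -/(opC b z) /opC -/n -/s.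
by move: (A m z) (A s z) (B n z) => *; ring.
Qed.
Let Qc z : V z -> opQ c z = B m z + B s z + (B m z - A r z).
Proof.
move=> Vz; rewrite /opQ (linB Sm Ss Cc Vz) (lin1 linC Sa Bc Vz) -/(opC a z) /opC -/m -/r.
by move: (B m z) (B s z) (A r z) => *; ring.
Qed.

(** The commutation relations applied to [p] and [q] are six equations for the eight first
    derivatives of m, n, r, s. The two left free are named [e1] and [e2]. *)
Let level0 z : V z -> [/\ A m z = -2 * e1 z, A n z = 0, A r z = -3 * e2 z & A s z = 1 * e1 z] /\
  [/\ B m z = 1 * e2 z, B n z = -3 * e1 z, B r z = 0 & B s z = -2 * e2 z].
Proof.
move=> Vz.
have H1 := AP Sp Vz; rewrite (linA Sm Ss Pp Vz) (lin1 linP Sc Ap Vz) Pc // in H1.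
have H2 := BP Sp Vz; rewrite (linB Sm Ss Pp Vz) (lin0 linP Bp Vz) in H2.
have H3 := BQ Sp Vz; rewrite (lin1 linB Sr Qp Vz) (lin0 linQ Bp Vz) in H3.
have H4 := AP Sq Vz; rewrite (lin1 linA Sn Pq Vz) (lin0 linP Aq Vz) in H4.
have H5 := BP Sq Vz; rewrite (lin1 linB Sn Pq Vz) (lin1 linP Sc Bq Vz) Pc // in H5.
have H6 := BQ Sq Vz; rewrite (linB Sm Ss Qq Vz) (lin1 linQ Sc Bq Vz) Qc // in H6.
rewrite /e1 /e2; move: H1 H2 H3 H4 H5 H6.
move: (A m z) (A n z) (A r z) (A s z) (B m z) (B n z) (B r z) (B s z) => *.
by do 2!split; lra.
Qed.

Let Am z (Vz : V z) : A m z = -2 * e1 z. Proof. by have [[]] := level0 Vz. Qed.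
Let An z (Vz : V z) : A n z = 0. Proof. by have [[]] := level0 Vz. Qed.
Let Ar z (Vz : V z) : A r z = -3 * e2 z. Proof. by have [[]] := level0 Vz. Qed.
Let As z (Vz : V z) : A s z = 1 * e1 z. Proof. by have [[]] := level0 Vz. Qed.
Let Bm z (Vz : V z) : B m z = 1 * e2 z. Proof. by have [_ []] := level0 Vz. Qed.
Let Bn z (Vz : V z) : B n z = -3 * e1 z. Proof. by have [_ []] := level0 Vz. Qed.
Let Br z (Vz : V z) : B r z = 0. Proof. by have [_ []] := level0 Vz. Qed.
Let Bs z (Vz : V z) : B s z = -2 * e2 z. Proof. by have [_ []] := level0 Vz. Qed.

Let Ca z : V z -> opC a z = 4 * e2 z.
Proof. by move=> Vz; rewrite /opC -/m -/r Bm // Ar //; ring. Qed.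
Let Cb z : V z -> opC b z = -4 * e1 z.
Proof. by move=> Vz; rewrite /opC -/n -/s Bn // As //; ring. Qed.
Let Pc' z : V z -> opP c z = 3 * e1 z.
Proof. by move=> Vz; rewrite Pc // Am // As // Bn //; ring. Qed.
Let Qc' z : V z -> opQ c z = 3 * e2 z.
Proof. by move=> Vz; rewrite Qc // Bm // Ar // Bs //; ring. Qed.
Let Cm z : V z -> opC m z = -2 * B e1 z + -1 * A e2 z.
Proof. by move=> Vz; rewrite /opC (lin1 linB Se1 Am Vz) (lin1 linA Se2 Bm Vz); ring. Qed.
Let Cn z : V z -> opC n z = 3 * A e1 z.
Proof. by move=> Vz; rewrite /opC (lin0 linB An Vz) (lin1 linA Se1 Bn Vz); ring. Qed.
Let Cr z : V z -> opC r z = -3 * B e2 z.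
Proof. by move=> Vz; rewrite /opC (lin1 linB Se2 Ar Vz) (lin0 linA Br Vz); ring. Qed.
Let Cs z : V z -> opC s z = 1 * B e1 z + 2 * A e2 z.
Proof. by move=> Vz; rewrite /opC (lin1 linB Se1 As Vz) (lin1 linA Se2 Bs Vz); ring. Qed.
Let Pa z : V z -> opP a z = 5 * A e2 z + 2 * B e1 z.
Proof. by move=> Vz; rewrite /opP (lin1 linA Se2 Ca Vz) -/m Cm //; ring. Qed.
Let Pb z : V z -> opP b z = -7 * A e1 z.
Proof. by move=> Vz; rewrite /opP (lin1 linA Se1 Cb Vz) -/n Cn //; ring. Qed.
Let Qa z : V z -> opQ a z = 7 * B e2 z.
Proof. by move=> Vz; rewrite /opQ (lin1 linB Se2 Ca Vz) -/r Cr //; ring. Qed.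

(** The commutation relations applied to [c] are three equations for the four first derivatives of
    [e1] and [e2]; [e3] names the remaining one. *)
Let level1 z : V z -> [/\ A e1 z = 0, B e1 z = -1 * e3 z, A e2 z = 1 * e3 z & B e2 z = 0].
Proof.
move=> Vz.
have H1 := AP Sc Vz; rewrite (lin1 linA Se1 Pc' Vz) (lin1 linP Sb Ac Vz) Pb // in H1.
have H2 := BP Sc Vz; rewrite (lin1 linB Se1 Pc' Vz) (lin1 linP Sa Bc Vz) Pa // in H2.
have H3 := BQ Sc Vz; rewrite (lin1 linB Se2 Qc' Vz) (lin1 linQ Sa Bc Vz) Qa // in H3.
rewrite /e3; move: H1 H2 H3; move: (A e1 z) (B e1 z) (A e2 z) (B e2 z) => *.
by split; lra.
Qed.

Let Ae1 z (Vz : V z) : A e1 z = 0. Proof. by have [] := level1 Vz. Qed.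
Let Be1 z (Vz : V z) : B e1 z = -1 * e3 z. Proof. by have [] := level1 Vz. Qed.
Let Ae2 z (Vz : V z) : A e2 z = 1 * e3 z. Proof. by have [] := level1 Vz. Qed.
Let Be2 z (Vz : V z) : B e2 z = 0. Proof. by have [] := level1 Vz. Qed.

Let Ce1 z : V z -> opC e1 z = -1 * - e4 z.
Proof. by move=> Vz; rewrite /opC (lin0 linB Ae1 Vz) (lin1 linA Se3 Be1 Vz) /e4; ring. Qed.
Let Ce1' z : V z -> opC e1 z = 1 * e4 z.
Proof. by move=> Vz; rewrite Ce1 //; ring. Qed.
Let Ce2 z : V z -> opC e2 z = 1 * e5 z.
Proof. by move=> Vz; rewrite /opC (lin1 linB Se3 Ae2 Vz) (lin0 linA Be2 Vz) /e5; ring. Qed.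
Let Cm' z : V z -> opC m z = 1 * e3 z.
Proof. by move=> Vz; rewrite Cm // Be1 // Ae2 //; ring. Qed.
Let Cs' z : V z -> opC s z = 1 * e3 z.
Proof. by move=> Vz; rewrite Cs // Be1 // Ae2 //; ring. Qed.
Let Cr' z : V z -> opC r z = 0.
Proof. by move=> Vz; rewrite Cr // Be2 //; ring. Qed.
Let Pe1 z : V z -> opP e1 z = A e4 z.
Proof. by move=> Vz; rewrite /opP (lin1 linA Se4 Ce1' Vz) (lin0 linC Ae1 Vz); ring. Qed.
Let Pe2 z : V z -> opP e2 z = A e5 z - (B e4 z - A e5 z).
Proof. by move=> Vz; rewrite /opP (lin1 linA Se5 Ce2 Vz) (lin1 linC Se3 Ae2 Vz) /opC -/e4 -/e5; ring. Qed.
Let Qe2 z : V z -> opQ e2 z = B e5 z.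
Proof. by move=> Vz; rewrite /opQ (lin1 linB Se5 Ce2 Vz) (lin0 linC Be2 Vz); ring. Qed.
Let Pm z : V z -> opP m z = 3 * e4 z.
Proof. by move=> Vz; rewrite /opP (lin1 linA Se3 Cm' Vz) (lin1 linC Se1 Am Vz) Ce1' // -/e4; ring. Qed.
Let Pr z : V z -> opP r z = 3 * e5 z.
Proof. by move=> Vz; rewrite /opP (lin0 linA Cr' Vz) (lin1 linC Se2 Ar Vz) Ce2 //; ring. Qed.
Let Ps z : V z -> opP s z = 0.
Proof. by move=> Vz; rewrite /opP (lin1 linA Se3 Cs' Vz) (lin1 linC Se1 As Vz) Ce1' // -/e4; ring. Qed.
Let Qs z : V z -> opQ s z = 3 * e5 z.
Proof. by move=> Vz; rewrite /opQ (lin1 linB Se3 Cs' Vz) (lin1 linC Se2 Bs Vz) Ce2 // -/e5; ring. Qed.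

(** The derivatives [e4] and [e5] of [e3] are new unknowns, but the commutation relations applied to
    m, r and s annihilate all their derivatives: here the system closes. *)
Let level3 z : V z -> [/\ A e4 z = 0, B e4 z = 0, A e5 z = 0 & B e5 z = 0].
Proof.
move=> Vz.
have H1 := AP Sm Vz; rewrite (lin1 linA Se4 Pm Vz) (lin1 linP Se1 Am Vz) Pe1 // in H1.
have H2 := AP Sr Vz; rewrite (lin1 linA Se5 Pr Vz) (lin1 linP Se2 Ar Vz) Pe2 // in H2.
have H3 := BP Ss Vz; rewrite (lin0 linB Ps Vz) (lin1 linP Se2 Bs Vz) Pe2 // in H3.
have H4 := BQ Ss Vz; rewrite (lin1 linB Se5 Qs Vz) (lin1 linQ Se2 Bs Vz) Qe2 // in H4.
move: H1 H2 H3 H4; move: (A e4 z) (B e4 z) (A e5 z) (B e5 z) => *.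
by split; lra.
Qed.

Variable z0 : T.
Hypothesis constant : forall phi, S phi -> (forall z, V z -> A phi z = 0) ->
  (forall z, V z -> B phi z = 0) -> phi z0 = 0 -> forall z, V z -> phi z = 0.

(* The system being strictly triangular, the jet is determined by its value
   at one point. *)
Lemma jet_vanish :
  [/\ p z0 = 0, q z0 = 0, c z0 = 0, a z0 = 0 & b z0 = 0] ->
  [/\ m z0 = 0, n z0 = 0, r z0 = 0 & s z0 = 0] ->
  [/\ e1 z0 = 0, e2 z0 = 0, e3 z0 = 0, e4 z0 = 0 & e5 z0 = 0] ->
  forall z, V z -> [/\ p z = 0, q z = 0, c z = 0, a z = 0 & b z = 0].
Proof.
move=> [p0 q0 c0 a0 b0] [m0 n0 r0 s0] [e10 e20 e30 e40 e50].
have E4 : forall z, V z -> e4 z = 0 by apply: constant => // z /level3[].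
have E5 : forall z, V z -> e5 z = 0 by apply: constant => // z /level3[].
have E3 : forall z, V z -> e3 z = 0 by apply: constant.
have E1 : forall z, V z -> e1 z = 0 by apply: constant => // z Vz; rewrite Be1 // E3 // mulr0.
have E2 : forall z, V z -> e2 z = 0 by apply: constant => // z Vz; rewrite Ae2 // E3 // mulr0.
have Em : forall z, V z -> m z = 0.
  by apply: constant => // z Vz; rewrite ?Am ?Bm ?E1 ?E2 ?mulr0.
have En : forall z, V z -> n z = 0.
  by apply: constant => // z Vz; rewrite ?Bn ?E1 ?mulr0.
have Er : forall z, V z -> r z = 0.
  by apply: constant => // z Vz; rewrite ?Ar ?E2 ?mulr0.
have Es : forall z, V z -> s z = 0.
  by apply: constant => // z Vz; rewrite ?As ?Bs ?E1 ?E2 ?mulr0.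
have Ea : forall z, V z -> a z = 0 by apply: constant.
have Eb : forall z, V z -> b z = 0 by apply: constant.
have Ec : forall z, V z -> c z = 0.
  by apply: constant => // z Vz; rewrite ?Ac ?Bc ?Ea ?Eb ?mulr0.
have Ep : forall z, V z -> p z = 0.
  by apply: constant => // z Vz; rewrite Ap // Ec // mulr0.
have Eq : forall z, V z -> q z = 0.
  by apply: constant => // z Vz; rewrite Bq // Ec // mulr0.
by move=> z Vz; split; [exact: Ep|exact: Eq|exact: Ec|exact: Ea|exact: Eb].
Qed.

End Prolongation.

(** * Derivations of the octonions as infinitesimal symmetries *)

Section SymmetryFields.
Context {R : realType}.
Local Notation pt := 'rV[R]_5.
Local Notation O := (split_octonion R).
Variables (U : set pt) (F : pt -> O) (D : Defs.distribution R 4).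
Hypothesis chartF : null_chart U F.
Hypothesis nullD : forall z, U z -> forall v, D z v <-> null_direction F z v.

Let oU : open U. Proof. by case: chartF. Qed.
Let sF : vsmooth U F. Proof. by case: chartF. Qed.
Let F12 z : U z -> oc12 (F z) = 1. Proof. by case: chartF => _ _ H _ /H[]. Qed.
Let F22 z : U z -> oc22 (F z) = - ch F z. Proof. by case: chartF => _ _ H _ /H[]. Qed.
Let F21 z : U z -> oc21 (F z) = - (ch F z * ch F z) - ce F z * ck F z + cf F z * cg F z.
Proof. by case: chartF => _ _ H _ /H[]. Qed.

Let chartE z (Uz : U z) : F z = oct (ch F z) 1
  (- (ch F z * ch F z) - ce F z * ck F z + cf F z * cg F z) (- ch F z) (ce F z) (cf F z) (cg F z) (ck F z).
Proof. by rewrite [LHS]octK F12 // F22 // F21. Qed.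

(** The square of an imaginary octonion is minus its norm. *)
Lemma null_square z : U z -> oct_mul (F z) (F z) = 0.
Proof. by move=> Uz; rewrite chartE // oct_mulE !octE; apply: octP; rewrite octE oc0; ring. Qed.

Lemma valong_inj (v w : pt) z : U z ->
  valong (fun=> v) F z = valong (fun=> w) F z -> v = w.
Proof.
move=> Uz; rewrite !(valong_chart chartF) // => E.
by apply: (chart_vector_inj chartF Uz);
  [have := congr1 oc11 E|have := congr1 od11 E|have := congr1 od12 E|have := congr1 od21 E
  |have := congr1 od22 E]; rewrite !octE.
Qed.

(** The linear action of [- d] leaves the slice [oc12] = 1; adding [kap d] times the radial vector
    returns to it. *)
Definition kap (d : 'End(O)) z : R := oc12 (d (F z)).

Definition g2_field (d : 'End(O)) : vector_field R 4 := pull F (fun z => vec5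
  (- oc11 (d (F z)) + kap d z * ch F z) (- od11 (d (F z)) + kap d z * ce F z)
  (- od12 (d (F z)) + kap d z * cf F z) (- od21 (d (F z)) + kap d z * cg F z)
  (- od22 (d (F z)) + kap d z * ck F z)).

Lemma smooth_kap d : smooth U (kap d).
Proof.
apply: (smooth_functional (l := fun w => oc12 (d w)) oU _ sF).
by move=> c u v; rewrite linearP ocD ocZ.
Qed.

Lemma smooth_g2_field d : smooth_vf U (g2_field d).
Proof.
have sl (l : O -> R) : linear (l : O -> R^o) -> smooth U (fun z => l (d (F z))).
  move=> ll; apply: (smooth_functional (l := fun w => l (d w)) oU _ sF).
  by move=> c u v; rewrite linearP ll.
have [l11 l12 l21 l22] := @oc_linear R; have [m11 m12 m21 m22] := @od_linear R.
have sk := smooth_kap d.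
apply: (smooth_pull chartF); apply: (smooth_vf5 chartF).
- exact: (smoothD oU (smoothN oU (sl _ l11)) (smoothM oU sk (smooth_ch chartF))).
- exact: (smoothD oU (smoothN oU (sl _ m11)) (smoothM oU sk (smooth_ce chartF))).
- exact: (smoothD oU (smoothN oU (sl _ m12)) (smoothM oU sk (smooth_cf chartF))).
- exact: (smoothD oU (smoothN oU (sl _ m21)) (smoothM oU sk (smooth_cg chartF))).
- exact: (smoothD oU (smoothN oU (sl _ m22)) (smoothM oU sk (smooth_ck chartF))).
Qed.

(* A derivation [d] acts on the projectivised null cone by [- d], so that
   [d |-> g2_field d] preserves brackets. *)
Lemma valong_g2_field d z : split_g2 R d -> U z ->
  valong (g2_field d) F z = - d (F z) + kap d z *: F z.
Proof.
move=> dd Uz; have [[[[E1 E2] E3] E4] E5] := along_pull chartF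
  (fun z => - oc11 (d (F z)) + kap d z * ch F z) (fun z => - od11 (d (F z)) + kap d z * ce F z)
  (fun z => - od12 (d (F z)) + kap d z * cf F z) (fun z => - od21 (d (F z)) + kap d z * cg F z)
  (fun z => - od22 (d (F z)) + kap d z * ck F z) Uz.
rewrite (valong_chart chartF) // E1 E2 E3 E4 E5.
(* The derivation applied to the square of F says that dF is tangent to the null cone. This supplies
   [oc21] and [oc22], the two coordinates not prescribed by the definition of the field. *)
have := dd (F z) (F z); rewrite null_square // linear0.
rewrite /kap; move: (d (F z)) => w; rewrite {1 2}chartE // !oct_mulE !octE => E0.
have H12 := congr1 oc12 E0; have H11 := congr1 oc11 E0.
move: H12 H11; rewrite !ocD !octE !oc0 => H12 H11.
have W22 : oc22 w = - oc11 w by lra.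
apply: octP; rewrite octE ocD ocN ocZ [F z]chartE // !octE ?W22; try ring.
move: H11; move: (oc11 w) (oc12 w) (oc21 w) (od11 w) (od12 w) (od21 w) (od22 w).
move: (ch F z) (ce F z) (cf F z) (cg F z) (ck F z) => h e f g k w1 w2 w3 w4 w5 w6 w7 H11.
have -> : w3 = - (2 * h * w1 + w2 * (- (h * h) - e * k + f * g)
  + w7 * e - w5 * g + k * w4 - f * w6) by lra.
ring.
Qed.

Let valong_at (X : vector_field R 4) z : valong (fun=> X z) F z = valong X F z.
Proof. by []. Qed.

Lemma valong_congr X (G H : pt -> O) z : U z -> (forall y, U y -> G y = H y) ->
  valong X G z = valong X H z.
Proof. by move=> Uz; exact: valong_near. Qed.

Let along_kap X (d : 'End(O)) z : U z -> along X (kap d) z = oc12 (d (valong X F z)).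
Proof.
move=> Uz; apply: (along_functional (l := fun w => oc12 (d w)) X oU _ sF Uz).
by move=> c u v; rewrite linearP ocD ocZ.
Qed.

Let valong_image X (d : 'End(O)) z : U z ->
  valong X (fun y => - d (F y) + kap d y *: F y) z =
  - d (valong X F z) + (oc12 (d (valong X F z)) *: F z + kap d z *: valong X F z).
Proof.
move=> Uz; have sd := vsmooth_linear d oU sF.
rewrite (valongD X (vsmoothN oU sd) (vsmoothZ oU (smooth_kap d) sF) Uz).
rewrite (valongN X sd Uz) (valong_linear X d oU sF Uz).
by rewrite (valongZ X (smooth_kap d) sF Uz) along_kap.
Qed.

(** By [valong_inj] it suffices to compare the derivatives of F. The radial corrections combine into
    the one belonging to the commutator. *)
Lemma g2_field_bracket a b z : split_g2 R a -> split_g2 R b ->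
  split_g2 R ((a \o b)%VF - (b \o a)%VF) -> U z ->
  g2_field ((a \o b)%VF - (b \o a)%VF) z = lie_bracket (g2_field a) (g2_field b) z.
Proof.
move=> da db dab Uz; apply: (valong_inj Uz); rewrite 2!valong_at (valong_g2_field dab Uz).
rewrite (valong_bracket oU (smooth_g2_field a) (smooth_g2_field b) sF Uz).
rewrite (valong_congr _ Uz (fun y Uy => valong_g2_field db Uy)).
rewrite (valong_congr _ Uz (fun y Uy => valong_g2_field da Uy)).
rewrite (valong_image _ b Uz) (valong_image _ a Uz) (valong_g2_field da Uz) (valong_g2_field db Uz).
have Ld (d : 'End(O)) w c v : d (- w + c *: v) = - d w + c *: d v by rewrite linearD linearN linearZ.
have -> : kap ((a \o b)%VF - (b \o a)%VF) z = oc12 (a (b (F z)) - b (a (F z))).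
  by rewrite /kap add_lfunE opp_lfunE !comp_lfunE.
have -> : ((a \o b)%VF - (b \o a)%VF) (F z) = a (b (F z)) - b (a (F z)).
  by rewrite add_lfunE opp_lfunE !comp_lfunE.
rewrite (Ld a) (Ld b) /kap.
move: (a (F z)) (b (F z)) => a1 b1; move: (a b1) (b a1) => ab ba.
(* After an arbitrary linear functional [l] the vector identity becomes an identity of real
   polynomials; it is then used for each of the eight coordinates. *)
have G l (ll : linear (l : O -> R^o)) : l (- (ab - ba) + oc12 (ab - ba) *: F z) =
    l (- (- ba + oc12 a1 *: b1) + (oc12 (- ba + oc12 a1 *: b1) *: F z + oc12 b1 *: (- a1 + oc12 a1 *: F z))
    - (- (- ab + oc12 b1 *: a1) + (oc12 (- ab + oc12 b1 *: a1) *: F z + oc12 a1 *: (- b1 + oc12 b1 *: F z)))).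
  have lZD c x y : l (c *: x + y) = c * l x + l y by exact: ll.
  have lD x y : l (x + y) = l x + l y by rewrite -[x]scale1r lZD mul1r scale1r.
  have l0 : l 0 = 0 by apply: (addrI (l 0)); rewrite -lD !addr0.
  have lZ c x : l (c *: x) = c * l x by rewrite -[c *: x]addr0 lZD l0 addr0.
  have lN x : l (- x) = - l x by rewrite -scaleN1r lZ mulN1r.
  rewrite !(lD, lN, lZ) !(ocD, ocN, ocZ).
  move: (l ab) (l ba) (l a1) (l b1) (l (F z)) (oc12 ab) (oc12 ba) (oc12 a1) (oc12 b1) => *; ring.
have [l11 l12 l21 l22] := @oc_linear R; have [m11 m12 m21 m22] := @od_linear R.
by apply: octP; apply: G.
Qed.

Lemma g2_field_linear (c : R) (a b : 'End(O)) z : U z ->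
  g2_field (c *: a + b) z = c *: g2_field a z + g2_field b z.
Proof.
move=> Uz.
have E (d : 'End(O)) (X := fun=> g2_field d z) :
    (along X (ch F) z = - oc11 (d (F z)) + kap d z * ch F z) *
    (along X (ce F) z = - od11 (d (F z)) + kap d z * ce F z) *
    (along X (cf F) z = - od12 (d (F z)) + kap d z * cf F z) *
    (along X (cg F) z = - od21 (d (F z)) + kap d z * cg F z) *
    (along X (ck F) z = - od22 (d (F z)) + kap d z * ck F z).
  exact: (along_pull chartF (fun z => - oc11 (d (F z)) + kap d z * ch F z)
    (fun z => - od11 (d (F z)) + kap d z * ce F z) (fun z => - od12 (d (F z)) + kap d z * cf F z)
    (fun z => - od21 (d (F z)) + kap d z * cg F z) (fun z => - od22 (d (F z)) + kap d z * ck F z) Uz).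
have [l11 l12 _ _] := @oc_linear R; have [m11 m12 m21 m22] := @od_linear R.
have L l (ll : linear (l : O -> R^o)) : l ((c *: a + b) (F z)) = c * l (a (F z)) + l (b (F z)).
  by rewrite add_lfunE scale_lfunE; exact: ll.
have G (x y s t e : R) : - (c * x + y) + (c * s + t) * e = c * (- x + s * e) + (- y + t * e) by ring.
have := E a; have := E b; have := E (c *: a + b); rewrite /kap.
move: (g2_field a z) (g2_field b z) (g2_field (c *: a + b) z) => A B C EC EB EA.
apply: (chart_vector_inj chartF Uz); rewrite along_vecD along_vecZ.
- by rewrite EC.1.1.1.1 EA.1.1.1.1 EB.1.1.1.1 (L _ l11) (L _ l12) G.
- by rewrite EC.1.1.1.2 EA.1.1.1.2 EB.1.1.1.2 (L _ m11) (L _ l12) G.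
- by rewrite EC.1.1.2 EA.1.1.2 EB.1.1.2 (L _ m12) (L _ l12) G.
- by rewrite EC.1.2 EA.1.2 EB.1.2 (L _ m21) (L _ l12) G.
- by rewrite EC.2 EA.2 EB.2 (L _ m22) (L _ l12) G.
Qed.

(** For Y in [D] the product of F with Y(F) vanishes on an open set. Differentiating it along the
    field, and applying the derivation to it, gives two relations which together say that the
    product of F with the derivative of F along the bracket is zero. *)
Lemma g2_field_symmetry V d : V `<=` U -> split_g2 R d ->
  infinitesimal_symmetry V D (g2_field d).
Proof.
move=> VU dd; have sX := smooth_g2_field d; split=> [i|W Y oW WV [sY DY] z Wz].
  exact: smooth_sub VU (sX i).
have WU : W `<=` U by move=> y /WV/VU.
have Uz := WU _ Wz; apply/(nullD Uz).
have sXW : smooth_vf W (g2_field d) by move=> i; exact: smooth_sub WU (sX i).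
have sFW := vsmooth_sub WU sF.
have nullY y : W y -> oct_mul (F y) (valong Y F y) = 0.
  by move=> Wy; exact/(nullD (WU _ Wy))/DY.
have sYF := vsmooth_valong oW sY sFW.
have Ml := @oct_mul_linearl R; have Mr := @oct_mul_linearr R.
have E1 := valong_bilinear Ml Mr (g2_field d) oW sFW sYF Wz.
rewrite (valong_near _ oW Wz nullY) valong_cst valong_g2_field // in E1.
rewrite /null_direction.
rewrite valong_at.
rewrite (valong_bracket oW sXW sY sFW Wz).
rewrite (valong_congr Y Uz (fun y Uy => valong_g2_field dd Uy)) valong_image //.
have E2 := dd (F z) (valong Y F z); rewrite nullY // linear0 in E2.
have E3 := null_square Uz; have E4 := nullY z Wz.
move: E1 E2 E3 E4; move: (valong (g2_field d) _ z) (valong Y F z) (F z) (kap d z) => XY Yz Fz kz.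
move: (d Fz) (d Yz) (oc12 (d Yz)) => dF dY kY E1 E2 E3 E4.
have mD (x y w : O) : oct_mul x (y + w) = oct_mul x y + oct_mul x w by have := Mr x 1 y w; rewrite !scale1r.
have m0 (x : O) : oct_mul x 0 = 0 by rewrite oct_mulE; apply: octP; rewrite octE !oc0; ring.
have mZ (x : O) c (y : O) : oct_mul x (c *: y) = c *: oct_mul x y by have := Mr x c y 0; rewrite m0 !addr0.
have mN (x y : O) : oct_mul x (- y) = - oct_mul x y by rewrite -scaleN1r mZ scaleN1r.
have D2 (x y w : O) : oct_mul (x + y) w = oct_mul x w + oct_mul y w by have := Ml w 1 x y; rewrite !scale1r.
have m0' (x : O) : oct_mul 0 x = 0 by rewrite oct_mulE; apply: octP; rewrite octE !oc0; ring.
have mZ' (x : O) c (y : O) : oct_mul (c *: x) y = c *: oct_mul x y by have := Ml y c x 0; rewrite m0' !addr0.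
have mN' (x y : O) : oct_mul (- x) y = - oct_mul x y by rewrite -scaleN1r mZ' scaleN1r.
rewrite !(D2, mN', mZ') E4 scaler0 addr0 in E1.
have EXY : oct_mul Fz XY = oct_mul dF Yz by apply/eqP; rewrite -subr_eq0 addrC -E1.
by rewrite !(mD, mN, mZ) E3 E4 !scaler0 !addr0 opprK EXY.
Qed.

End SymmetryFields.

(** * Faithfulness of the action of derivations *)

Section Injectivity.
Context {R : realType}.
Local Notation pt := 'rV[R]_5.
Local Notation O := (split_octonion R).
Variables (U : set pt) (F : pt -> O).
Hypothesis chartF : null_chart U F.

Let oU : open U. Proof. by case: chartF. Qed.
Let sF : vsmooth U F. Proof. by case: chartF. Qed.
Let F12 z : U z -> oc12 (F z) = 1. Proof. by case: chartF => _ _ H _ /H[]. Qed.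

(** In a chart only [oc21] of F is quadratic in (h, e, f, g, k), the other coordinates being affine;
    second derivatives of F along constant chart directions are therefore multiples of [n0]. *)
Let n0 : O := oct 0 0 1 0 0 0 0 0.
Let dirH : vector_field R 4 := pull F (fun=> vec5 1 0 0 0 0).
Let dirE : vector_field R 4 := pull F (fun=> vec5 0 1 0 0 0).
Let dirF : vector_field R 4 := pull F (fun=> vec5 0 0 1 0 0).
Let dirG : vector_field R 4 := pull F (fun=> vec5 0 0 0 1 0).
Let dirK : vector_field R 4 := pull F (fun=> vec5 0 0 0 0 1).

Let smooth_dir a b c d e : smooth_vf U (pull F (fun=> vec5 a b c d e)).
Proof. by apply: (smooth_pull chartF); apply: (smooth_vf5 chartF); exact: smooth_cst. Qed.

Let along_dir a b c d e z (Uz : U z) := along_pull chartF (fun=> a) (fun=> b) (fun=> c) (fun=> d) (fun=> e) Uz.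

Let valong_dir a b c d e z : U z -> valong (pull F (fun=> vec5 a b c d e)) F z =
  (- (2 * ch F z * a) - b * ck F z - ce F z * e + c * cg F z + cf F z * d) *: n0
  + oct a 0 0 (- a) b c d e.
Proof.
move=> Uz; rewrite (valong_chart chartF) //.
have [[[[-> ->] ->] ->] ->] := along_dir a b c d e Uz.
by apply: octP; rewrite octE ocD ocZ !octE; ring.
Qed.

Lemma valong_zero (X : vector_field R 4) (G : pt -> O) z : X z = 0 -> valong X G z = 0.
Proof.
move=> X0; rewrite /valong big1 // => i _; rewrite /along big1 ?scale0r // => j _.
by rewrite X0 mxE mul0r.
Qed.

Variables (V : set pt) (p : pt) (d : 'End(O)).
Hypotheses (oV : open V) (VU : V `<=` U) (Vp : V p) (dd : split_g2 R d).
Hypothesis field0 : forall z, V z -> g2_field F d z = 0.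

Local Notation kp := (kap F d).

Let skap : smooth V kp. Proof. exact: smooth_sub VU (smooth_kap chartF d). Qed.
Let sFV : vsmooth V F. Proof. exact: vsmooth_sub VU sF. Qed.
Let sdirV a b c d' e : smooth_vf V (pull F (fun=> vec5 a b c d' e)).
Proof. move=> i; exact: smooth_sub VU (smooth_dir a b c d' e i). Qed.

Let dFE z : V z -> d (F z) = kp z *: F z.
Proof.
move=> Vz; have := valong_g2_field chartF dd (VU Vz).
rewrite valong_zero ?field0 // => /esym/eqP.
by rewrite addrC subr_eq0 => /eqP ->.
Qed.

(** This and [dYXF] are successive derivatives of the eigenvector equation [dFE]; the derivatives of
    the eigenvalue appear as the terms to be eliminated. *)
Let dXF X z : smooth_vf V X -> V z -> d (valong X F z) = along X kp z *: F z + kp z *: valong X F z.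
Proof.
move=> sX Vz; rewrite -(valong_linear X d oV sFV Vz).
by rewrite (valong_near X oV Vz dFE) (valongZ X skap sFV Vz).
Qed.

Let dYXF X Y z : smooth_vf V X -> smooth_vf V Y -> V z ->
  d (valong Y (valong X F) z) = along Y (along X kp) z *: F z + along X kp z *: valong Y F z
   + (along Y kp z *: valong X F z + kp z *: valong Y (valong X F) z).
Proof.
move=> sX sY Vz; have sXF := vsmooth_valong oV sX sFV; have sXk := smooth_along oV sX skap.
rewrite -(valong_linear Y d oV sXF Vz) (valong_near Y oV Vz (fun z Vz => dXF sX Vz)).
rewrite (valongD Y (vsmoothZ oV sXk sFV) (vsmoothZ oV skap sXF) Vz).
by rewrite (valongZ Y sXk sFV Vz) (valongZ Y skap sXF Vz).
Qed.

Let valong2_dir Y (a b c d' e : R) z : V z -> valong Y (valong (pull F (fun=> vec5 a b c d' e)) F) z =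
  (- (2 * along Y (ch F) z * a) - b * along Y (ck F) z - along Y (ce F) z * e
    + c * along Y (cg F) z + along Y (cf F) z * d') *: n0.
Proof.
move=> Vz; rewrite (valong_near Y oV Vz (fun z Vz => valong_dir a b c d' e (VU Vz))).
have [sh se sf sg] := And4 (smooth_ch chartF) (smooth_ce chartF) (smooth_cf chartF) (smooth_cg chartF).
have sk := smooth_ck chartF; have Uz := VU Vz.
have dh := smooth_differentiable sh Uz; have de := smooth_differentiable se Uz.
have df := smooth_differentiable sf Uz; have dg := smooth_differentiable sg Uz.
have dk := smooth_differentiable sk Uz.
pose phi z := - (2 * a) * ch F z + (- b) * ck F z + (- e) * ce F z + c * cg F z + d' * cf F z.
have sphi : smooth U phi.
  exact: (smoothD oU (smoothD oU (smoothD oU (smoothD oU (smoothZ _ oU sh) (smoothZ _ oU sk))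
    (smoothZ _ oU se)) (smoothZ _ oU sg)) (smoothZ _ oU sf)).
have sphin : vsmooth U (fun z => phi z *: n0) by apply: vsmoothZ => //; exact: vsmooth_cst.
rewrite (valong_near (G := fun z => phi z *: n0 + oct a 0 0 (- a) b c d' e) Y oU Uz); last first.
  by move=> y _; congr (_ *: _ + _); rewrite /phi; ring.
rewrite (valongD Y sphin (vsmooth_cst _) Uz) valong_cst addr0.
rewrite (valongZ Y sphi (vsmooth_cst _) Uz) valong_cst scaler0 addr0; congr (_ *: _).
have dZ x (u : pt -> R) : differentiable u z -> differentiable (fun y => x * u y) z.
  by move=> du; exact: differentiableZ.
rewrite /phi !alongD; do ?[apply: differentiableD]; do ?[exact: dZ].
by rewrite !alongZ //; ring.
Qed.

(** The condition says that the direction X is null for the flat metric, so that F is affine along X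
    and its second derivative vanishes. The derivation applied to it leaves a relation between F and
    X(F). They are independent, and the coefficient of X(F) is twice the derivative of the
    eigenvalue. *)
Let null_dir_kap (b c d' e : R) z (X := pull F (fun=> vec5 0 b c d' e)) : V z ->
  c * d' - b * e = 0 ->
  [/\ along X kp z * b = 0, along X kp z * c = 0, along X kp z * d' = 0 & along X kp z * e = 0].
Proof.
move=> Vz Q0; have sX := sdirV 0 b c d' e; have E := dYXF sX sX Vz.
have E0 : valong X (valong X F) z = 0.
  rewrite valong2_dir //; have [[[[-> ->] ->] ->] ->] := along_dir 0 b c d' e (VU Vz).
  rewrite (_ : _ *: n0 = (2 * (c * d' - b * e)) *: n0); first by rewrite Q0 mulr0 scale0r.
  by congr (_ *: _); ring.
rewrite -/X E0 linear0 scaler0 addr0 in E.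
have Uz := VU Vz; move: E; rewrite (valong_dir 0 b c d' e Uz).
move: (along X kp z) (along X (along X kp) z) (F12 Uz) => x y.
move: (F z) (- _ - _ - _ + _ + _ : R) => Fz t F1 E.
have := congr1 oc12 E; have := congr1 od11 E; have := congr1 od12 E.
have := congr1 od21 E; have := congr1 od22 E.
rewrite !(ocD, ocZ, octE, oc0, mulr0, addr0, add0r) F1 mulr1 => E5 E4 E3 E2 E1.
move: E2 E3 E4 E5; rewrite -E1 !mul0r !add0r => E2 E3 E4 E5.
by split; lra.
Qed.

Let kapE z : V z -> along dirE kp z = 0.
Proof. by move=> Vz; have [] := @null_dir_kap 1 0 0 0 z Vz; rewrite ?mulr1 //; ring. Qed.
Let kapF z : V z -> along dirF kp z = 0.
Proof. by move=> Vz; have [] := @null_dir_kap 0 1 0 0 z Vz; rewrite ?mulr1 //; ring. Qed.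
Let kapG z : V z -> along dirG kp z = 0.
Proof. by move=> Vz; have [] := @null_dir_kap 0 0 1 0 z Vz; rewrite ?mulr1 //; ring. Qed.
Let kapK z : V z -> along dirK kp z = 0.
Proof. by move=> Vz; have [] := @null_dir_kap 0 0 0 1 z Vz; rewrite ?mulr1 //; ring. Qed.

(** The direction of h is not null, but the mixed second derivative of F in the directions of h and
    e vanishes, and [kapE] removes the other first-order term. *)
Let kapH z : V z -> along dirH kp z = 0.
Proof.
move=> Vz; have sH := sdirV 1 0 0 0 0; have sE := sdirV 0 1 0 0 0.
have E := dYXF sH sE Vz.
have E0 : valong dirE (valong dirH F) z = 0.
  rewrite valong2_dir //; have [[[[-> ->] ->] ->] ->] := along_dir 0 1 0 0 0 (VU Vz).
  rewrite (_ : _ *: n0 = 0 *: n0); first by rewrite scale0r.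
  by congr (_ *: _); ring.
rewrite -/dirH -/dirE E0 linear0 scaler0 addr0 (kapE Vz) scale0r addr0 in E.
have Uz := VU Vz; move: E; rewrite (valong_dir 0 1 0 0 0 Uz).
move: (along dirH kp z) (along dirE (along dirH kp) z) (F12 Uz) => x y.
move: (F z) (- _ - _ - _ + _ + _ : R) => Fz t F1 E.
have := congr1 oc12 E; have := congr1 od11 E.
rewrite !(ocD, ocZ, octE, oc0, mulr0, addr0, add0r) F1 !mulr1 => E2 E1.
by move: E2; rewrite -E1 mul0r add0r.
Qed.

Let kapHH z : V z -> along dirH (along dirH kp) z = 0.
Proof. by move=> Vz; rewrite (along_near dirH oV Vz kapH) along_cst. Qed.

(* By the vanishing of the derivatives of [kp], [d] acts as the scalar [kp p]
   on the span of the 2-jet of [F], which is the space of imaginary octonions. *)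
Let eigen_jet :
  let l := kp p in
  [/\ d n0 = l *: n0, d (oct 1 0 0 (-1) 0 0 0 0) = l *: oct 1 0 0 (-1) 0 0 0 0 &
   d (F p) = l *: F p] /\
  [/\ d (oct 0 0 0 0 1 0 0 0) = l *: oct 0 0 0 0 1 0 0 0,
      d (oct 0 0 0 0 0 1 0 0) = l *: oct 0 0 0 0 0 1 0 0,
      d (oct 0 0 0 0 0 0 1 0) = l *: oct 0 0 0 0 0 0 1 0 &
      d (oct 0 0 0 0 0 0 0 1) = l *: oct 0 0 0 0 0 0 0 1].
Proof.
move=> l; have Up := VU Vp; have sH := sdirV 1 0 0 0 0.
have dn0 : d n0 = l *: n0.
  have := dYXF sH sH Vp; rewrite -/dirH kapHH // kapH // !scale0r !add0r valong2_dir //.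
  have [[[[-> ->] ->] ->] ->] := along_dir 1 0 0 0 0 Up.
  rewrite (_ : _ *: n0 = (- 2) *: n0); last by congr (_ *: _); ring.
  by rewrite linearZ /= scalerA mulrC -scalerA => /scalerI; apply; rewrite oppr_eq0 pnatr_eq0.
(* The vector [n0] is already known to be an eigenvector, so its multiples can be stripped from the
   first derivatives of F. *)
have step (w : O) (t : R) : d (t *: n0 + w) = l *: (t *: n0 + w) -> d w = l *: w.
  rewrite linearD linearZ /= dn0 scalerDr !scalerA mulrC => /addrI; exact.
have jet a b c d' e : along (pull F (fun=> vec5 a b c d' e)) kp p = 0 ->
    d (oct a 0 0 (- a) b c d' e) = l *: oct a 0 0 (- a) b c d' e.
  move=> K0; have := dXF (sdirV a b c d' e) Vp; rewrite K0 scale0r add0r.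
  by rewrite (valong_dir a b c d' e Up); exact: step.
split; split; [exact: dn0|exact: jet (kapH Vp)|exact: dFE| | | |].
- by have := jet _ _ _ _ _ (kapE Vp); rewrite oppr0.
- by have := jet _ _ _ _ _ (kapF Vp); rewrite oppr0.
- by have := jet _ _ _ _ _ (kapG Vp); rewrite oppr0.
- by have := jet _ _ _ _ _ (kapK Vp); rewrite oppr0.
Qed.

(** A derivation kills 1 and here acts on imaginary octonions as a scalar. The imaginary element [u]
    has square 1, so the Leibniz rule gives twice the scalar times 1 equal to 0. *)
Lemma g2_field_injective : d = 0.
Proof.
have [[dn0 dh dF] [de df dg dk]] := eigen_jet.
pose one : O := oct 1 0 0 1 0 0 0 0; pose u : O := oct 1 0 0 (-1) 0 0 0 0.
have oneE : oct_mul one one = one.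
  by apply: octP; rewrite oct_mulE !octE; ring.
have uE : oct_mul u u = one by apply: octP; rewrite oct_mulE !octE; ring.
have one_l w : oct_mul one w = w by apply: octP; rewrite oct_mulE !octE; ring.
have one_r w : oct_mul w one = w by apply: octP; rewrite oct_mulE !octE; ring.
have d1 : d one = 0.
  have := dd one one; rewrite oneE one_l one_r => /eqP.
  by rewrite -subr_eq0 opprD addrA subrr sub0r oppr_eq0 => /eqP.
have l0 : kp p = 0.
  have := dd u u; rewrite uE d1 dh => /(congr1 oc11).
  by rewrite oct_mulE ocD !octE oct_mulE !ocZ !octE oc0 => ?; lra.
rewrite !l0 !scale0r in dn0 dh dF de df dg dk.
have dD x y : d (x + y) = d x + d y by rewrite linearD.
have dZ (c : R) x : d (c *: x) = c *: d x by rewrite linearZ.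
apply/lfunP => w; rewrite zero_lfunE.
have -> : w = ((oc11 w + oc22 w) / 2) *: one + ((oc11 w - oc22 w) / 2 - oc12 w * ch F p) *: u
   + (od11 w - oc12 w * ce F p) *: oct 0 0 0 0 1 0 0 0 + (od12 w - oc12 w * cf F p) *: oct 0 0 0 0 0 1 0 0
   + (od21 w - oc12 w * cg F p) *: oct 0 0 0 0 0 0 1 0 + (od22 w - oc12 w * ck F p) *: oct 0 0 0 0 0 0 0 1
   + (oc21 w - oc12 w * oc21 (F p)) *: n0 + oc12 w *: F p.
  have F1 := F12 (VU Vp).
  have F2 : oc22 (F p) = - ch F p by case: chartF => _ _ H _; have [] := H p (VU Vp).
  have Fh : oc11 (F p) = ch F p by [].
  have Fe : od11 (F p) = ce F p by [].
  have Ff : od12 (F p) = cf F p by [].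
  have Fg : od21 (F p) = cg F p by [].
  have Fk : od22 (F p) = ck F p by [].
  apply: octP; rewrite !(ocD, ocZ, octE) ?F1 ?F2 ?Fh ?Fe ?Ff ?Fg ?Fk;
    move: (oc11 w) (oc12 w) (oc21 w) (oc22 w) (od11 w) (od12 w) (od21 w) (od22 w) (oc21 (F p));
    move: (ch F p) (ce F p) (cf F p) (cg F p) (ck F p) => *; by field.
by rewrite 7!dD 8!dZ d1 dn0 dh dF de df dg dk !scaler0 !addr0.
Qed.

End Injectivity.

(** * A family of derivations with 14 parameters *)

Section Derivations.
Context {R : realType}.
Local Notation O := (split_octonion R).

Lemma ord14 (P : 'I_14 -> Prop) : (forall k, (k < 14)%N -> P (inord k)) -> forall i, P i.
Proof. by move=> H i; rewrite -(inord_val i); apply: H; exact: ltn_ord. Qed.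

Lemma oct_congr (a a' b b' c c' d d' e e' f f' g g' k k' : R) : a = a' -> b = b' -> c = c' ->
  d = d' -> e = e' -> f = f' -> g = g' -> k = k' -> oct a b c d e f g k = oct a' b' c' d' e' f' g' k'.
Proof. by move=> -> -> -> -> -> -> -> ->. Qed.

Lemma oct_mul_oct (a b c d e f g k a' b' c' d' e' f' g' k' : R) :
  oct_mul (oct a b c d e f g k) (oct a' b' c' d' e' f' g' k') = oct
  (a * a' + b * c' + (k' * e - f' * g)) (a * b' + b * d' + (k' * f - f' * k))
  (c * a' + d * c' + (e' * g - g' * e)) (c * b' + d * d' + (e' * k - g' * f))
  (e' * a + f' * c + (e * d' - f * c')) (e' * b + f' * d + (f * a' - e * b'))
  (g' * a + k' * c + (g * d' - k * c')) (g' * b + k' * d + (k * a' - g * b')).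
Proof. by rewrite oct_mulE !octE. Qed.

Lemma oct_add (a b c d e f g k a' b' c' d' e' f' g' k' : R) :
  oct a b c d e f g k + oct a' b' c' d' e' f' g' k' =
  oct (a + a') (b + b') (c + c') (d + d') (e + e') (f + f') (g + g') (k + k').
Proof. by apply: octP; rewrite ocD !octE. Qed.

Lemma oct_scale (r a b c d e f g k : R) :
  r *: oct a b c d e f g k = oct (r * a) (r * b) (r * c) (r * d) (r * e) (r * f) (r * g) (r * k).
Proof. by apply: octP; rewrite ocZ !octE. Qed.

(** A family solving the linear system that the Leibniz rule imposes on the matrix of an
    endomorphism. Each parameter is itself an entry of that matrix, so that [derivation_inj] can
    read it off the images of basis vectors. *)
Definition derivation_oct (x0 x1 x2 x3 x4 x5 x6 x7 x8 x9 x10 x11 x12 x13 a b c d e f g k : R) : O := oct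
  (x0 * b + x1 * c + x2 * e + x3 * f + x4 * g + x5 * k)
  (- x1 * a + x6 * b + x1 * d + x7 * e - x2 * f + x8 * g - x4 * k)
  (- x0 * a - x6 * c + x0 * d + x3 * e + x9 * f + x5 * g + x10 * k)
  (- x0 * b - x1 * c - x2 * e - x3 * f - x4 * g - x5 * k)
  (- x5 * a - x10 * b + x4 * c + x5 * d + x11 * e + x0 * f + x12 * g)
  (x4 * a + x5 * b + x8 * c - x4 * d - x1 * e + (x6 + x11) * f + x12 * k)
  (x3 * a + x9 * b - x2 * c - x3 * d + x13 * e - (x6 + x11) * g + x0 * k)
  (- x2 * a - x3 * b - x7 * c + x2 * d + x13 * f - x1 * g - x11 * k).

Definition param (x : 'rV[R]_14) (k : nat) : R := x 0 (inord k).

Definition derivation_fun (x : 'rV[R]_14) (w : O) : O :=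
  derivation_oct (param x 0) (param x 1) (param x 2) (param x 3) (param x 4) (param x 5) (param x 6) (param
    x 7) (param x 8) (param x 9) (param x 10) (param x 11) (param x 12) (param x 13)
   (oc11 w) (oc12 w) (oc21 w) (oc22 w) (od11 w) (od12 w) (od21 w) (od22 w).

Let derivation_fun_oct x a b c d e f g k : derivation_fun x (oct a b c d e f g k) =
  derivation_oct (param x 0) (param x 1) (param x 2) (param x 3) (param x 4) (param x 5) (param x 6) (param
    x 7) (param x 8) (param x 9) (param x 10) (param x 11) (param x 12) (param x 13)
   a b c d e f g k.
Proof. by rewrite /derivation_fun !octE. Qed.

Let derivation_fun_linear x : linear (derivation_fun x).
Proof.
move=> r u v; rewrite [u]octK [v]octK oct_scale oct_add !derivation_fun_oct /derivation_oct.
rewrite oct_scale oct_add; apply: oct_congr; ring.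
Qed.

Definition derivation_lin (x : 'rV[R]_14) : {linear O -> O} :=
  HB.pack (derivation_fun x) (GRing.isLinear.Build _ _ _ _ _ (derivation_fun_linear x)).

Definition derivation (x : 'rV[R]_14) : 'End(O) := linfun (derivation_lin x).

Lemma derivationE x w : derivation x w = derivation_fun x w.
Proof. exact: lfunE. Qed.

Lemma derivation_g2 x : split_g2 R (derivation x).
Proof.
move=> u v; rewrite !derivationE [u]octK [v]octK.
move: (oc11 u) (oc12 u) (oc21 u) (oc22 u) (od11 u) (od12 u) (od21 u) (od22 u) => a b c d e f g k.
move: (oc11 v) (oc12 v) (oc21 v) (oc22 v) (od11 v) (od12 v) (od21 v) (od22 v) => a' b' c' d' e' f' g' k'.
rewrite oct_mul_oct !derivation_fun_oct.
move: (param x 0) (param x 1) (param x 2) (param x 3) (param x 4) (param x 5) (param x 6) (param x 7)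
  (param x 8) (param x 9) (param x 10) (param x 11) (param x 12) (param x 13).
move=> x0 x1 x2 x3 x4 x5 x6 x7 x8 x9 x10 x11 x12 x13.
by rewrite /derivation_oct !oct_mul_oct oct_add; apply: oct_congr; ring.
Qed.

Lemma derivation_linear (c : R) x y : derivation (c *: x + y) = c *: derivation x + derivation y.
Proof.
apply/lfunP => w; rewrite add_lfunE scale_lfunE !derivationE /derivation_fun.
by rewrite /derivation_oct oct_scale oct_add; apply: oct_congr; rewrite /param !mxE; ring.
Qed.

Lemma derivation_inj x : derivation x = 0 -> x = 0.
Proof.
move=> x0.
have E a b c d e f g k : derivation_oct (param x 0) (param x 1) (param x 2) (param x 3) (param x 4) (param
  x 5) (param x 6) (param x 7) (param x 8) (param x 9)
    (param x 10) (param x 11) (param x 12) (param x 13) a b c d e f g k = 0.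
  by rewrite -derivation_fun_oct -derivationE x0 zero_lfunE.
have Eb := E 0 1 0 0 0 0 0 0; have Ec := E 0 0 1 0 0 0 0 0; have Ee := E 0 0 0 0 1 0 0 0.
have Ef := E 0 0 0 0 0 1 0 0; have Eg := E 0 0 0 0 0 0 1 0; have Ek := E 0 0 0 0 0 0 0 1.
move: Eb Ec Ee Ef Eg Ek; rewrite /derivation_oct => Eb Ec Ee Ef Eg Ek.
have b1 := congr1 oc11 Eb; have b2 := congr1 oc12 Eb; have b3 := congr1 od21 Eb; have b4 := congr1 od11 Eb.
have c1 := congr1 oc11 Ec; have c2 := congr1 od12 Ec; have c3 := congr1 od22 Ec.
have e1 := congr1 oc11 Ee; have e2 := congr1 od11 Ee; have e3 := congr1 od21 Ee.
have f1 := congr1 oc11 Ef; have g1 := congr1 oc11 Eg; have g2 := congr1 od11 Eg; have k1 := congr1 oc11 Ek.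
rewrite !octE oc0 in b1 b2 b3 b4 c1 c2 c3 e1 e2 e3 f1 g1 g2 k1.
rewrite !(oc0, mulr0, mulr1, addr0, add0r, subr0, oppr0) in b1 b2 b3 b4 c1 c2 c3 e1 e2 e3 f1 g1 g2 k1.
have L : forall i, (i < 14)%N -> nth 0 [:: param x 0; param x 1; param x 2; param x 3; param x 4; param x
  5; param x 6; param x 7; param x 8; param x 9; param x 10; param x 11; param x 12; param x 13] i = 0.
  move: b1 b2 b3 b4 c1 c2 c3 e1 e2 e3 f1 g1 g2 k1; move: (param x 0) (param x 1) (param x 2) (param x 3)
    (param x 4) (param x 5) (param x 6) (param x 7) (param x 8) (param x 9) (param x 10) (param x 11)
    (param x 12) (param x 13).
  move=> y0 y1 y2 y3 y4 y5 y6 y7 y8 y9 y10 y11 y12 y13 b1 b2 b3 b4 c1 c2 c3 e1 e2 e3 f1 g1 g2 k1 i i14.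
  by do 14![case: i i14 => [_|i i14]; first by rewrite /=; clear -b1 b2 b3 b4 c1 c2 c3 e1 e2 e3 f1 g1 g2
    k1; lra].
apply/rowP; apply: ord14 => i i14; rewrite [RHS]mxE -/(param x i); move: (L i i14).
by do 14![case: i i14 => [//|i i14]].
Qed.

End Derivations.

(** * The symmetry equations in the adapted frame *)

Section SymmetryJets.
Context {R : realType}.
Local Notation pt := 'rV[R]_5.
Local Notation O := (split_octonion R).
Variables (U : set pt) (F : pt -> O) (D : Defs.distribution R 4).
Hypothesis chartF : null_chart U F.
Hypothesis nullD : forall z, U z -> forall v, D z v <-> null_direction F z v.

Local Notation h := (ch F).
Local Notation e := (ce F).
Local Notation f := (cf F).
Local Notation g := (cg F).
Local Notation k := (ck F).
Local Notation fA := (fA F).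
Local Notation fB := (fB F).
Local Notation fC := (fC F).
Local Notation fP := (fP F).
Local Notation fQ := (fQ F).

Let oU : open U. Proof. by case: chartF. Qed.

(* The components of a vector field in the frame [fA], [fB], [fC], [fP], [fQ]. *)
Definition compA (X : vector_field R 4) : pt -> R := along X f.
Definition compB (X : vector_field R 4) : pt -> R := along X k.
Definition compC (X : vector_field R 4) z : R :=
  - 2^-1 * (along X h z - f z * along X k z + k z * along X f z).
Definition compP (X : vector_field R 4) z : R :=
  6^-1 * (along X e z - (h z + f z * k z) * compA X z + f z * f z * compB X z - 4 * f z * compC X z).
Definition compQ (X : vector_field R 4) z : R :=
  6^-1 * (along X g z - k z * k z * compA X z - (h z - f z * k z) * compB X z - 4 * k z * compC X z).

Lemma along_components X z :
  [/\ along X h z = - k z * compA X z + f z * compB X z - 2 * compC X z,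
      along X e z = (h z + f z * k z) * compA X z - f z * f z * compB X z + 4 * f z * compC X z + 6 * compP
        X z &
      along X g z = k z * k z * compA X z + (h z - f z * k z) * compB X z + 4 * k z * compC X z + 6 * compQ
        X z].
Proof.
rewrite /compP /compQ /compC /compA /compB.
move: (along X h z) (along X e z) (along X f z) (along X g z) (along X k z) (h z) (f z) (k z) => *.
by split; field.
Qed.

Lemma field_eq0 X z : U z -> compA X z = 0 -> compB X z = 0 -> compC X z = 0 ->
  compP X z = 0 -> compQ X z = 0 -> X z = 0.
Proof.
move=> Uz EA EB EC EP EQ; have [Eh Ee Eg] := along_components X z.
by apply: (chart_vector_inj chartF Uz); rewrite along_vec0;
  [refine (etrans Eh _)|refine (etrans Ee _)|exact: EA|refine (etrans Eg _)|exact: EB];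
  rewrite EA EB EC ?EP ?EQ; ring.
Qed.

Section OnOpen.
Variable V : set pt.
Hypotheses (oV : open V) (VU : V `<=` U).

Let S := smooth V.
Let sh : smooth V h. Proof. exact: smooth_sub VU (smooth_ch chartF). Qed.
Let se : smooth V e. Proof. exact: smooth_sub VU (smooth_ce chartF). Qed.
Let sf : smooth V f. Proof. exact: smooth_sub VU (smooth_cf chartF). Qed.
Let sg : smooth V g. Proof. exact: smooth_sub VU (smooth_cg chartF). Qed.
Let sk : smooth V k. Proof. exact: smooth_sub VU (smooth_ck chartF). Qed.

Let smooth_fields : [/\ smooth_vf V fA, smooth_vf V fB, smooth_vf V fC, smooth_vf V fP & smooth_vf V fQ].
Proof.
by have [sA sB sC sP sQ] := smooth_frame chartF; split=> i; apply: (smooth_sub VU).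
Qed.

Lemma smooth_components X : smooth_vf V X ->
  [/\ smooth V (compA X), smooth V (compB X), smooth V (compC X), smooth V (compP X) & smooth V (compQ X)].
Proof.
move=> sX.
have sA : smooth V (compA X) by exact: smooth_along.
have sB : smooth V (compB X) by exact: smooth_along.
have sC : smooth V (compC X).
  apply: (smoothZ _ oV); apply: (smoothD oV); last exact: (smoothM oV sk sA).
  by apply: (smoothB oV); [exact: smooth_along|exact: (smoothM oV sf sB)].
have sfk := smoothM oV sf sk.
split=> //; apply: (smoothZ _ oV); apply: (smoothB oV);
  try exact: (smoothM oV (smoothZ _ oV sf) sC); try exact: (smoothM oV (smoothZ _ oV sk) sC).
  apply: (smoothD oV); last exact: (smoothM oV (smoothM oV sf sf) sB).
  by apply: (smoothB oV); [exact: smooth_along|exact: (smoothM oV (smoothD oV sh sfk) sA)].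
apply: (smoothB oV); last exact: (smoothM oV (smoothB oV sh sfk) sB).
by apply: (smoothB oV); [exact: smooth_along|exact: (smoothM oV (smoothM oV sk sk) sA)].
Qed.

Let bracket_along X Z phi z : smooth_vf V X -> smooth_vf V Z -> smooth V phi -> V z ->
  along (fun=> lie_bracket X Z z) phi z = along X (along Z phi) z - along Z (along X phi) z.
Proof. by move=> sX sZ sphi Vz; exact: (along_bracket oV sX sZ sphi Vz). Qed.

(** For a symmetry the components along [fC], [fP], [fQ] of its brackets with [fA] and [fB] vanish.
    By the bracket relations of the frame these are six first-order equations linking the components
    of [X]. *)
Lemma symmetry_equations X : infinitesimal_symmetry V D X -> forall z, V z ->
  [/\ along fA (compC X) z = compB X z, along fA (compP X) z = - compC X z & along fA (compQ X) z = 0] /\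
  [/\ along fB (compC X) z = - compA X z, along fB (compP X) z = 0 & along fB (compQ X) z = - compC X z].
Proof.
move=> [sX symX] z Vz; have Uz := VU Vz.
have [sA sB _ _ _] := smooth_fields.
have [secA secB] := frame_section chartF nullD VU.
have [sa sb sc sp sq] := smooth_components sX.
have dh := smooth_differentiable sh Vz; have de := smooth_differentiable se Vz.
have df := smooth_differentiable sf Vz; have dg := smooth_differentiable sg Vz.
have dk := smooth_differentiable sk Vz.
have da := smooth_differentiable sa Vz; have db := smooth_differentiable sb Vz.
have dc := smooth_differentiable sc Vz; have dp := smooth_differentiable sp Vz.
have dq := smooth_differentiable sq Vz.
have dM (u v : pt -> R) : differentiable u z -> differentiable v z -> differentiable (fun y => u y * v y) z.
  by move=> ? ?; exact: differentiableM.
have dD (u v : pt -> R) : differentiable u z -> differentiable v z -> differentiable (fun y => u y + v y) z.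
  by move=> ? ?; exact: differentiableD.
have dB (u v : pt -> R) : differentiable u z -> differentiable v z -> differentiable (fun y => u y - v y) z.
  by move=> ? ?; exact: differentiableB.
have dN (u : pt -> R) : differentiable u z -> differentiable (fun y => - u y) z.
  by move=> ?; exact: differentiableN.
have dZ x (u : pt -> R) : differentiable u z -> differentiable (fun y => x * u y) z.
  by move=> ?; apply: dM => //; exact: differentiable_cst.
(* [L1], [L2] and [L3] apply the product rule to [along_components]: they express second derivatives
   of the chart functions through derivatives of the frame components of [X]. *)
have L1 (Z : vector_field R 4) : along Z (along X h) z =
    - (along Z k z * compA X z + k z * along Z (compA X) z)
    + (along Z f z * compB X z + f z * along Z (compB X) z) - 2 * along Z (compC X) z.
  rewrite (along_near (g := fun y => - (k y * compA X y) + f y * compB X y - 2 * compC X y) Z oV Vz); last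
    first.
    by move=> y _; have [-> _ _] := along_components X y; rewrite mulNr.
  have dka := dM _ _ dk da; have dfb := dM _ _ df db.
  rewrite (alongB _ (dD _ _ (dN _ dka) dfb) (dZ 2 _ dc)) (alongD _ (dN _ dka) dfb) (alongN _ dka).
  by rewrite (alongM _ dk da) (alongM _ df db) (alongZ _ _ dc).
have L2 (Z : vector_field R 4) : along Z (along X e) z =
    (along Z h z + (along Z f z * k z + f z * along Z k z)) * compA X z + (h z + f z * k z) * along Z
      (compA X) z
    - ((along Z f z * f z + f z * along Z f z) * compB X z + f z * f z * along Z (compB X) z)
    + 4 * (along Z f z * compC X z + f z * along Z (compC X) z) + 6 * along Z (compP X) z.
  rewrite (along_near (g := fun y => (h y + f y * k y) * compA X y - f y * f y * compB X y
     + 4 * (f y * compC X y) + 6 * compP X y) Z oV Vz); last first.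
    by move=> y _; have [_ -> _] := along_components X y; rewrite mulrA.
  have d1 := dM _ _ (dD _ _ dh (dM _ _ df dk)) da; have d2 := dM _ _ (dM _ _ df df) db.
  have d3 := dZ 4 _ (dM _ _ df dc); have d4 := dB _ _ d1 d2.
  rewrite (alongD _ (dD _ _ d4 d3) (dZ 6 _ dp)) (alongD _ d4 d3) (alongB _ d1 d2).
  rewrite (alongM _ (dD _ _ dh (dM _ _ df dk)) da) (alongM _ (dM _ _ df df) db).
  rewrite (alongZ _ _ (dM _ _ df dc)) (alongZ _ _ dp) (alongD _ dh (dM _ _ df dk)).
  by rewrite (alongM _ df dk) (alongM _ df df) (alongM _ df dc).
have L3 (Z : vector_field R 4) : along Z (along X g) z =
    (along Z k z * k z + k z * along Z k z) * compA X z + k z * k z * along Z (compA X) z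
    + ((along Z h z - (along Z f z * k z + f z * along Z k z)) * compB X z + (h z - f z * k z) * along Z
        (compB X) z)
    + 4 * (along Z k z * compC X z + k z * along Z (compC X) z) + 6 * along Z (compQ X) z.
  rewrite (along_near (g := fun y => k y * k y * compA X y + (h y - f y * k y) * compB X y
     + 4 * (k y * compC X y) + 6 * compQ X y) Z oV Vz); last first.
    by move=> y _; have [_ _ ->] := along_components X y; rewrite mulrA.
  have d1 := dM _ _ (dM _ _ dk dk) da; have d2 := dM _ _ (dB _ _ dh (dM _ _ df dk)) db.
  have d3 := dZ 4 _ (dM _ _ dk dc); have d4 := dD _ _ d1 d2.
  rewrite (alongD _ (dD _ _ d4 d3) (dZ 6 _ dq)) (alongD _ d4 d3) (alongD _ d1 d2).
  rewrite (alongM _ (dB _ _ dh (dM _ _ df dk)) db) (alongM _ (dM _ _ dk dk) da).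
  rewrite (alongZ _ _ (dM _ _ dk dc)) (alongZ _ _ dq) (alongB _ dh (dM _ _ df dk)).
  by rewrite (alongM _ df dk) (alongM _ dk dk) (alongM _ dk dc).
have fr y (Vy : V y) := frame_along chartF (VU Vy).
have XA := along_near X oV Vz.
have [Xh _ _] := along_components X z.
have FA := symX V fA oV (fun y Vy => Vy) secA z Vz.
have FB := symX V fB oV (fun y Vy => Vy) secB z Vz.
split.
  move: FA => /(nullD Uz)/(null_directionP chartF _ Uz); rewrite !bracket_along //.
  rewrite (XA (along fA h) (fun y => - k y)) => [|y Vy]; last by rewrite (fr y Vy).
  rewrite (XA (along fA e) (fun y => h y + f y * k y)) => [|y Vy]; last by rewrite (fr y Vy).
  rewrite (XA (along fA f) (fun=> 1)) => [|y Vy]; last by rewrite (fr y Vy).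
  rewrite (XA (along fA g) (fun y => k y * k y)) => [|y Vy]; last by rewrite (fr y Vy).
  rewrite (XA (along fA k) (fun=> 0)) => [|y Vy]; last by rewrite (fr y Vy).
  rewrite (alongN X dk) (alongD X dh (dM _ _ df dk)) (alongM X df dk) (alongM X dk dk) !along_cst Xh.
  rewrite L1 L2 L3 !(fr z Vz) -/(compA X) -/(compB X) -/(compA X z) -/(compB X z).
  move: (along fA (compA X) z) (along fA (compB X) z) (along fA (compC X) z) (along fA (compP X) z)
    (along fA (compQ X) z) (compA X z) (compB X z) (compC X z) (h z) (f z) (k z).
  move=> a' b' c' p' q' a b c h0 f0 k0 [H1 H2 H3].
  have C1 : c' = b by lra.
  by subst c'; split=> //; lra.
move: FB => /(nullD Uz)/(null_directionP chartF _ Uz); rewrite !bracket_along //.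
rewrite (XA (along fB h) f) => [|y Vy]; last by rewrite (fr y Vy).
rewrite (XA (along fB e) (fun y => - (f y * f y))) => [|y Vy]; last by rewrite (fr y Vy).
rewrite (XA (along fB f) (fun=> 0)) => [|y Vy]; last by rewrite (fr y Vy).
rewrite (XA (along fB g) (fun y => h y - f y * k y)) => [|y Vy]; last by rewrite (fr y Vy).
rewrite (XA (along fB k) (fun=> 1)) => [|y Vy]; last by rewrite (fr y Vy).
rewrite (alongN X (dM _ _ df df)) (alongB X dh (dM _ _ df dk)) (alongM X df dk) (alongM X df df) !along_cst Xh.
rewrite L1 L2 L3 !(fr z Vz) -/(compA X) -/(compB X) -/(compA X z) -/(compB X z).
move: (along fB (compA X) z) (along fB (compB X) z) (along fB (compC X) z) (along fB (compP X) z)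
  (along fB (compQ X) z) (compA X z) (compB X z) (compC X z) (h z) (f z) (k z).
move=> a' b' c' p' q' a b c h0 f0 k0 [H1 H2 H3].
have C1 : c' = - a by lra.
by subst c'; split=> //; lra.
Qed.

End OnOpen.

End SymmetryJets.

(** * Identification of local symmetries with derivations *)

Section LocalSymmetries.
Context {R : realType}.
Local Notation pt := 'rV[R]_5.
Local Notation O := (split_octonion R).
Variables (U : set pt) (F : pt -> O) (D : Defs.distribution R 4).
Hypothesis chartF : null_chart U F.
Hypothesis nullD : forall z, U z -> forall v, D z v <-> null_direction F z v.

Local Notation fA := (fA F).
Local Notation fB := (fB F).
Local Notation fC := (fC F).
Local Notation fP := (fP F).
Local Notation fQ := (fQ F).

Section OnBall.
Variables (p : pt) (r : R).
Hypothesis r0 : 0 < r.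
Let V : set pt := ball p r.
Hypothesis VU : V `<=` U.

Let oV : open V. Proof. exact: ball_open. Qed.
Let Vp : V p. Proof. exact: ballxx. Qed.

Let A := along fA.
Let B := along fB.
Let S := smooth V.

Let smooth_fields : [/\ smooth_vf V fA, smooth_vf V fB, smooth_vf V fC, smooth_vf V fP & smooth_vf V fQ].
Proof.
by have [sA sB sC sP sQ] := smooth_frame chartF; split=> i; apply: (smooth_sub VU).
Qed.

Let along_eq (X Y : vector_field R 4) (phi : pt -> R) z : X z = Y z -> along X phi z = along Y phi z.
Proof. by move=> E; rewrite /along E. Qed.

Let SA phi : S phi -> S (A phi).
Proof. by have [sA _ _ _ _] := smooth_fields; exact: smooth_along. Qed.
Let SB phi : S phi -> S (B phi).
Proof. by have [_ sB _ _ _] := smooth_fields; exact: smooth_along. Qed.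
Let SC phi : S phi -> S (opC A B phi).
Proof. by move=> sphi; apply: (smoothB oV); [exact/SB/SA|exact/SA/SB]. Qed.

Let along_local_linear (X : vector_field R 4) : local_linear V S (along X).
Proof.
move=> phi psi chi x y sphi spsi E z Vz; rewrite (along_near X oV Vz E).
have dphi := smooth_differentiable sphi Vz; have dpsi := smooth_differentiable spsi Vz.
have dZ c (u : pt -> R) : differentiable u z -> differentiable (fun y => c * u y) z.
  by move=> du; exact: differentiableZ.
by rewrite (alongD _ (dZ x _ dphi) (dZ y _ dpsi)) !alongZ.
Qed.

(** The formal commutators of the prolongation are the derivatives along the bracket fields; with
    [opPE] and [opQE] this turns the brackets of the frame into the hypotheses of [jet_vanish]. *)
Let opCE phi z : S phi -> V z -> opC A B phi z = along fC phi z.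
Proof.
move=> sphi Vz; have [sA sB _ _ _] := smooth_fields.
refine (etrans (esym (along_bracket oV sB sA sphi Vz)) _).
by apply: along_eq; exact: (lie_fBfA chartF (VU Vz)).
Qed.

Let opPE phi z : S phi -> V z -> opP A B phi z = along fP phi z.
Proof.
move=> sphi Vz; have [sA _ sC _ _] := smooth_fields.
rewrite /opP; have -> : A (opC A B phi) z = along fA (along fC phi) z.
  by apply: (along_near fA oV Vz) => y Vy; exact: opCE.
rewrite opCE //; last exact: SA.
refine (etrans (esym (along_bracket oV sA sC sphi Vz)) _).
by apply: along_eq; exact: (lie_fAfC chartF (VU Vz)).
Qed.

Let opQE phi z : S phi -> V z -> opQ A B phi z = along fQ phi z.
Proof.
move=> sphi Vz; have [_ sB sC _ _] := smooth_fields.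
rewrite /opQ; have -> : B (opC A B phi) z = along fB (along fC phi) z.
  by apply: (along_near fB oV Vz) => y Vy; exact: opCE.
rewrite opCE //; last exact: SB.
refine (etrans (esym (along_bracket oV sB sC sphi Vz)) _).
by apply: along_eq; exact: (lie_fBfC chartF (VU Vz)).
Qed.

Let commuting X Y phi z : smooth_vf V X -> smooth_vf V Y -> S phi -> V z ->
  lie_bracket X Y z = 0 -> along X (along Y phi) z = along Y (along X phi) z.
Proof.
move=> sX sY sphi Vz E0; apply/eqP; rewrite -subr_eq0 -(along_bracket oV sX sY sphi Vz).
by rewrite (along_eq (Y := fun=> 0)) // along_vec0.
Qed.

Let AP phi z : S phi -> V z -> A (opP A B phi) z = opP A B (A phi) z.
Proof.
move=> sphi Vz; have [sA _ _ sP _] := smooth_fields; rewrite opPE //; last exact: SA.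
have -> : A (opP A B phi) z = along fA (along fP phi) z.
  by apply: (along_near fA oV Vz) => y Vy; exact: opPE.
by apply: commuting => //; exact: (lie_fAfP chartF (VU Vz)).
Qed.

Let BP phi z : S phi -> V z -> B (opP A B phi) z = opP A B (B phi) z.
Proof.
move=> sphi Vz; have [_ sB _ sP _] := smooth_fields; rewrite opPE //; last exact: SB.
have -> : B (opP A B phi) z = along fB (along fP phi) z.
  by apply: (along_near fB oV Vz) => y Vy; exact: opPE.
by apply: commuting => //; exact: (lie_fBfP chartF (VU Vz)).
Qed.

Let BQ phi z : S phi -> V z -> B (opQ A B phi) z = opQ A B (B phi) z.
Proof.
move=> sphi Vz; have [_ sB _ _ sQ] := smooth_fields; rewrite opQE //; last exact: SB.
have -> : B (opQ A B phi) z = along fB (along fQ phi) z.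
  by apply: (along_near fB oV Vz) => y Vy; exact: opQE.
by apply: commuting => //; exact: (lie_fBfQ chartF (VU Vz)).
Qed.

(* [fA] and [fB] generate all directions under brackets. *)
Let constant phi : S phi -> (forall z, V z -> A phi z = 0) -> (forall z, V z -> B phi z = 0) ->
  phi p = 0 -> forall z, V z -> phi z = 0.
Proof.
move=> sphi A0 B0 phi0 z Vz; rewrite -[RHS]phi0; apply: (constant_on_ball sphi) Vz => i y Vy.
have C0 x : V x -> along fC phi x = 0.
  move=> Vx; rewrite -opCE // /opC /A /B.
  by rewrite (along_near _ oV Vx A0) (along_near _ oV Vx B0) !along_cst subr0.
have P0 x : V x -> along fP phi x = 0.
  move=> Vx; rewrite -opPE // /opP opCE //; last exact: SA.
  have -> : A (opC A B phi) x = along fA (fun=> 0) x.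
    by apply: (along_near fA oV Vx) => t Vt; rewrite opCE // C0.
  by rewrite (along_near _ oV Vx A0) !along_cst subr0.
have Q0 x : V x -> along fQ phi x = 0.
  move=> Vx; rewrite -opQE // /opQ opCE //; last exact: SB.
  have -> : B (opC A B phi) x = along fB (fun=> 0) x.
    by apply: (along_near fB oV Vx) => t Vt; rewrite opCE // C0.
  by rewrite (along_near _ oV Vx B0) !along_cst subr0.
have -> : partial i phi y = along (fun=> delta_mx 0 i) phi y.
  rewrite /along (bigD1 i) //= mxE !eqxx mul1r big1 ?addr0 // => j ji.
  by rewrite mxE (negbTE ji) andbF mul0r.
have [x1 [x2 [x3 [x4 [x5 ->]]]]] := frame_span chartF (delta_mx 0 i) (VU Vy).
rewrite !along_vec; move: (A0 y Vy) (B0 y Vy) (C0 y Vy) (P0 y Vy) (Q0 y Vy).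
by rewrite /A /B /along => -> -> -> -> ->; rewrite !mulr0 !addr0.
Qed.

(** The 14 unknowns of the closed system, listed by increasing degree. *)
Definition jets (X : vector_field R 4) : seq (pt -> R) :=
  let m := along fA (compA F X) in let n := along fA (compB F X) in
  let t := along fB (compA F X) in let s := along fB (compB F X) in
  let e2 := along fB m in let e3 := along fA e2 in
  [:: compP F X; compQ F X; compC F X; compA F X; compB F X; m; n; t; s;
      along fA s; e2; e3; along fA e3; along fB e3].

Definition jet_at (X : vector_field R 4) : 'rV[R]_14 := \row_j nth (fun=> 0) (jets X) j p.

Lemma jet_at_inj X : infinitesimal_symmetry V D X -> jet_at X = 0 -> forall z, V z -> X z = 0.
Proof.
move=> symX J0; have [sX _] := symX.
have E (j : nat) : (j < 14)%N -> nth (fun=> 0) (jets X) j p = 0.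
  by move=> j14; have := congr1 (fun w : 'rV[R]_14 => w 0 (Ordinal j14)) J0; rewrite !mxE.
have [sa sb sc sp sq] := smooth_components chartF oV VU sX.
have eqs z (Vz : V z) := symmetry_equations chartF nullD oV VU symX Vz.
move=> z Vz.
have [|||||||||e1 e2 e3 e4 e5] := @jet_vanish R pt V S A B SA SB SC (along_local_linear fA)
  (along_local_linear fB) AP BP BQ (compP F X) (compQ F X) (compC F X) (compA F X) (compB F X)
  sp sq sc sa sb _ _ _ _ _ _ p constant _ _ _ z Vz.
- by move=> y /eqs[[_ H _] _]; rewrite mulN1r.
- by move=> y /eqs[_ [_ H _]].
- by move=> y /eqs[[_ _ H] _].
- by move=> y /eqs[_ [_ _ H]]; rewrite mulN1r.
- by move=> y /eqs[[H _ _] _]; rewrite mul1r.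
- by move=> y /eqs[_ [H _ _]]; rewrite mulN1r.
- by split; [exact: (E 0%N)|exact: (E 1%N)|exact: (E 2%N)|exact: (E 3%N)|exact: (E 4%N)].
- by split; [exact: (E 5%N)|exact: (E 6%N)|exact: (E 7%N)|exact: (E 8%N)].
- by split; [exact: (E 9%N)|exact: (E 10%N)|exact: (E 11%N)|exact: (E 12%N)|exact: (E 13%N)].
exact: (field_eq0 chartF (VU Vz)).
Qed.

Lemma jet_at_linear (c : R) X Y Z : smooth_vf V X -> smooth_vf V Y ->
  (forall z, V z -> Z z = c *: X z + Y z) -> jet_at Z = c *: jet_at X + jet_at Y.
Proof.
move=> sX sY EZ.
have E0 phi z : V z -> along Z phi z = c * along X phi z + along Y phi z.
  by move=> Vz; apply: along_lin; exact: EZ.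
have [saX sbX scX spX sqX] := smooth_components chartF oV VU sX.
have [saY sbY scY spY sqY] := smooth_components chartF oV VU sY.
have EA z : V z -> compA F Z z = c * compA F X z + 1 * compA F Y z by move=> Vz; rewrite mul1r; exact: E0.
have EB z : V z -> compB F Z z = c * compB F X z + 1 * compB F Y z by move=> Vz; rewrite mul1r; exact: E0.
have EC z : V z -> compC F Z z = c * compC F X z + 1 * compC F Y z.
  by move=> Vz; rewrite /compC !E0 //; ring.
have EP z : V z -> compP F Z z = c * compP F X z + 1 * compP F Y z.
  by move=> Vz; rewrite /compP EA // EB // EC // E0 //; ring.
have EQ z : V z -> compQ F Z z = c * compQ F X z + 1 * compQ F Y z.
  by move=> Vz; rewrite /compQ EA // EB // EC // E0 //; ring.
have Em := along_local_linear fA saX saY EA.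
have En := along_local_linear fA sbX sbY EB.
have Et := along_local_linear fB saX saY EA.
have Es := along_local_linear fB sbX sbY EB.
have smX := SA saX; have smY := SA saY; have ssX := SB sbX; have ssY := SB sbY.
have E1 := along_local_linear fA ssX ssY Es.
have E2 := along_local_linear fB smX smY Em.
have E3 := along_local_linear fA (SB smX) (SB smY) E2.
have E4 := along_local_linear fA (SA (SB smX)) (SA (SB smY)) E3.
have E5 := along_local_linear fB (SA (SB smX)) (SA (SB smY)) E3.
pose good (a b d : pt -> R) := a p = c * b p + 1 * d p.
have all_good : forall j : nat, (j < 14)%N ->
    good (nth (fun=> 0) (jets Z) j) (nth (fun=> 0) (jets X) j) (nth (fun=> 0) (jets Y) j).
  move=> j.
  case: j => [_|j]; first exact: (EP p Vp).
  case: j => [_|j]; first exact: (EQ p Vp).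
  case: j => [_|j]; first exact: (EC p Vp).
  case: j => [_|j]; first exact: (EA p Vp).
  case: j => [_|j]; first exact: (EB p Vp).
  case: j => [_|j]; first exact: (Em p Vp).
  case: j => [_|j]; first exact: (En p Vp).
  case: j => [_|j]; first exact: (Et p Vp).
  case: j => [_|j]; first exact: (Es p Vp).
  case: j => [_|j]; first exact: (E1 p Vp).
  case: j => [_|j]; first exact: (E2 p Vp).
  case: j => [_|j]; first exact: (E3 p Vp).
  case: j => [_|j]; first exact: (E4 p Vp).
  case: j => [_|j]; first exact: (E5 p Vp).
  by [].
apply/rowP => j; have := all_good j (ltn_ord j); rewrite /good mul1r => E.
have R1 W : jet_at W 0 j = nth (fun=> 0) (jets W) j p by rewrite mxE.
have mxlin (u v : 'rV[R]_14) : (c *: u + v) 0 j = c * u 0 j + v 0 j by rewrite !mxE.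
refine (etrans (R1 Z) (etrans E (esym (etrans (mxlin _ _) _)))).
exact: (congr2 (fun a b => c * a + b) (R1 X) (R1 Y)).
Qed.

End OnBall.

Lemma lie_bracket_linearl (V : set pt) (c : R) (X Y Z W : vector_field R 4) z : open V -> V z ->
  (forall y, V y -> W y = c *: X y + Y y) -> smooth_vf V X -> smooth_vf V Y ->
  lie_bracket W Z z = c *: lie_bracket X Z z + lie_bracket Y Z z.
Proof.
move=> oV Vz EW sX sY; apply/rowP => j; rewrite !mxE mulr_sumr -big_split; apply: eq_bigr => i _ /=.
have dX := smooth_differentiable (sX j) Vz; have dY := smooth_differentiable (sY j) Vz.
have dc : differentiable (fun=> c : R) z by exact: differentiable_cst.
have -> : partial i (fun y => W y 0 j) z = partial i (fun y => c * X y 0 j + Y y 0 j) z.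
  by apply: (partial_near i oV Vz) => y Vy; rewrite EW // !mxE.
rewrite partialD //; last exact: differentiableM.
by rewrite partialM // partial_cst EW // !mxE; ring.
Qed.

(** The jet at [p] of the field of a derivation is an injective linear function of the 14
    parameters, hence a bijection of R^14. A symmetry [X] thus has the jet of some derivation, and
    their difference, again a symmetry with zero jet, vanishes by [jet_at_inj]. *)
Lemma local_symmetry_chart p : U p -> exists (r : R) (rho : 'End(O) -> vector_field R 4),
    [/\ 0 < r /\ ball p r `<=` U,
        forall a, split_g2 R a -> infinitesimal_symmetry (ball p r) D (rho a),
        forall (c : R) a b, split_g2 R a -> split_g2 R b -> forall y, ball p r y ->
          rho (c *: a + b) y = c *: rho a y + rho b y,
        forall a b, split_g2 R a -> split_g2 R b -> forall y, ball p r y ->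
          rho ((a \o b)%VF - (b \o a)%VF) y = lie_bracket (rho a) (rho b) y &
        forall s, 0 < s -> s <= r -> forall X,
          infinitesimal_symmetry (ball p s) D X ->
          exists! a, split_g2 R a /\ forall y, ball p s y -> X y = rho a y].
Proof.
have [oU _ _ _] := chartF => Up.
have /nbhs_ballP[r /= r0 rU] : nbhs p U by exact: open_nbhs_nbhs.
have g2_lin (c : R) a b : split_g2 R a -> split_g2 R b -> split_g2 R (c *: a + b).
  move=> da db x y; rewrite !add_lfunE !scale_lfunE da db.
  have L1 := oct_mul_linearl y c (a x) (b x); have L2 := oct_mul_linearr x c (a y) (b y).
  by rewrite L1 L2 scalerDr addrACA.
have g2_comm a b : split_g2 R a -> split_g2 R b -> split_g2 R ((a \o b)%VF - (b \o a)%VF).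
  move=> da db x y; rewrite !add_lfunE !opp_lfunE !comp_lfunE da db !linearD /= !da !db.
  have mBl (u v w : O) : oct_mul (u - v) w = oct_mul u w - oct_mul v w.
    have /= E := oct_mul_linearl w (-1) v u.
    by rewrite [u - v]addrC -(scaleN1r v) E scaleN1r addrC.
  have mBr (u v w : O) : oct_mul u (v - w) = oct_mul u v - oct_mul u w.
    have /= E := oct_mul_linearr u (-1) w v.
    by rewrite [v - w]addrC -(scaleN1r w) E scaleN1r addrC.
  rewrite mBl mBr; move: (oct_mul _ _) (oct_mul (a x) (b y)) (oct_mul (b x) (a y)) (oct_mul _ _)
   (oct_mul (b _) _) (oct_mul _ (b _)) => t1 t2 t3 t4 t5 t6.
  move: (oct_mul (b (a x)) y) (oct_mul x (b (a y))) => t7 t8.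
  rewrite [t6 + t1]addrC [t4 + t5 + _]addrACA [t5 + t8]addrC -opprD [t7 + t6 + _]addrACA opprD.
  by rewrite [t6 + t5]addrC [LHS]addrACA subrr addr0 opprD addrACA.
exists r, (g2_field F); split=> //.
- by move=> a da; exact: (g2_field_symmetry chartF nullD).
- by move=> c a b _ _ y /rU Uy; exact: (g2_field_linear chartF).
- move=> a b da db y /rU Uy; apply: (g2_field_bracket chartF) => //; exact: g2_comm.
move=> s s0 sr X symX.
have sU : ball p s `<=` U by move=> y Vy; apply: rU; exact: le_ball Vy.
have [sX _] := symX.
have oB : open (ball p s) by exact: ball_open.
have Bp : ball p s p by exact: ballxx.
have sR d : smooth_vf (ball p s) (g2_field F d).
  by move=> i; exact: (smooth_sub sU (smooth_g2_field chartF d i)).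
pose L (x : 'rV[R]_14) : 'rV[R]_14 := jet_at p (g2_field F (derivation x)).
have Llin : linear L.
  move=> c x y; rewrite /L derivation_linear; apply: (jet_at_linear s0 sU) => // z /sU Uz.
  exact: (g2_field_linear chartF).
pose LL : {linear 'rV[R]_14 -> 'rV[R]_14} := HB.pack L (GRing.isLinear.Build _ _ _ _ _ Llin).
have LE x : x *m lin1_mx LL = L x by rewrite mul_rV_lin1.
have Linj x : L x = 0 -> x = 0.
  move=> Lx0; apply: derivation_inj.
  have symx : infinitesimal_symmetry (ball p s) D (g2_field F (derivation x)).
    by apply: (g2_field_symmetry chartF nullD) => //; exact: derivation_g2.
  have field0 := jet_at_inj sU symx Lx0.
  exact (g2_field_injective chartF oB sU Bp (derivation_g2 x) field0).
have uL : lin1_mx LL \in unitmx.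
  rewrite -row_free_unit -kermx_eq0; apply/eqP/row_matrixP => i; rewrite row0.
  by apply: Linj; rewrite -LE -row_mul mulmx_ker row0.
pose x := jet_at p X *m invmx (lin1_mx LL).
have Lx : L x = jet_at p X by rewrite -LE /x mulmxKV.
have dx := derivation_g2 x.
pose Z : vector_field R 4 := fun y => (-1) *: g2_field F (derivation x) y + X y.
have EZ z : ball p s z -> Z z = (-1) *: g2_field F (derivation x) z + X z by [].
have jZ : jet_at p Z = 0.
  refine (etrans (jet_at_linear s0 sU (sR (derivation x)) sX EZ) _).
  by rewrite -/(L x) Lx scaleN1r addNr.
have symx := g2_field_symmetry chartF nullD sU dx.
have symZ : infinitesimal_symmetry (ball p s) D Z.
  have mxlin (u v : pt) i : ((-1) *: u + v) 0 i = -1 * u 0 i + v 0 i by rewrite !mxE.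
  have sZ : smooth_vf (ball p s) Z.
    move=> i; refine (smooth_near oB _ (smoothD oB (smoothZ (-1) oB (sR (derivation x) i)) (sX i))) => z _.
    exact: (esym (mxlin _ _ i)).
  split; first exact: sZ.
  move=> V Y oV Vs secY z Vz.
  have brx := symx.2 V Y oV Vs secY z Vz; have brX := symX.2 V Y oV Vs secY z Vz.
  have Uz := sU z (Vs z Vz).
  have -> : lie_bracket Z Y z = (-1) *: lie_bracket (g2_field F (derivation x)) Y z + lie_bracket X Y z.
    have sRV : smooth_vf V (g2_field F (derivation x)).
      by move=> i; exact: (smooth_sub Vs (sR (derivation x) i)).
    have sXV : smooth_vf V X by move=> i; exact: (smooth_sub Vs (sX i)).
    exact: (lie_bracket_linearl Y oV Vz (fun y Vy => EZ y (Vs y Vy)) sRV sXV).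
  move: brx brX; rewrite (dist_frame chartF nullD Uz) /= => brx brX.
  by apply: memvD; [apply: memvZ; exact: brx|exact: brX].
have Z0 := jet_at_inj sU symZ jZ.
have XE y : ball p s y -> X y = g2_field F (derivation x) y.
  by move=> /Z0/eqP; rewrite /Z scaleN1r addrC subr_eq0 => /eqP.
exists (derivation x); split; first by split.
move=> a [da Xa]; apply/eqP; rewrite -subr_eq0 addrC -scaleN1r; apply/eqP.
have dz := g2_lin (-1) _ _ da dx.
apply: (g2_field_injective chartF oB sU Bp dz) => z Bz.
refine (etrans (g2_field_linear chartF (-1) a (derivation x) (sU z Bz)) _).
by rewrite -(Xa z Bz) -(XE z Bz) scaleN1r addNr.
Qed.

End LocalSymmetries.

(** * Weyl tensor of a section of a null cone *)

Section ConeMetric.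
Context {R : realType}.
Local Notation pt := 'rV[R]_5.
Variables (M : set pt) (eps : 'I_7 -> R) (Y : 'I_7 -> pt -> R) (g : tensor2 R 4) (W : pt -> 'rV[R]_7).

Definition ip (u v : 'rV[R]_7) : R := \sum_a eps a * (u 0 a * v 0 a).
Definition cone (p : pt) : 'rV[R]_7 := \row_a Y a p.
Definition cone_d i (p : pt) : 'rV[R]_7 := \row_a partial i (Y a) p.
Definition cone_dd i j (p : pt) : 'rV[R]_7 := \row_a partial i (partial j (Y a)) p.

Hypotheses (oM : open M) (sY : forall a, smooth M (Y a)).
Hypothesis gE : forall p, M p -> forall i j, g p i j = ip (cone_d i p) (cone_d j p).
Hypothesis g_unit : forall p, M p -> g p \in unitmx.
Hypothesis null : forall p, M p -> ip (cone p) (cone p) = 0.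
Hypothesis W_null : forall p, M p -> ip (W p) (W p) = 0.
Hypothesis W_cone : forall p, M p -> ip (cone p) (W p) = 1.
Hypothesis W_tangent : forall p i, M p -> ip (cone_d i p) (W p) = 0.

Lemma ipC u v : ip u v = ip v u.
Proof. by apply: eq_bigr => a _; rewrite [u 0 a * _]mulrC. Qed.

Lemma mul_diagE m n (A : 'M[R]_(m, 7)) (B : 'M[R]_(n, 7)) i j :
  (A *m diag_mx (\row_a eps a) *m B^T) i j = ip (row i A) (row j B).
Proof.
by rewrite mul_mx_diag mxE; apply: eq_bigr => a _; rewrite !mxE; ring.
Qed.

Lemma row_1 (u : 'rV[R]_7) i : row i u = u.
Proof. by apply/rowP => a; rewrite mxE ord1. Qed.

Section At.
Variable p : pt.
Hypothesis Mp : M p.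
Local Notation gi := (invmx (g p)).

Lemma g_sym i j : g p i j = g p j i.
Proof. by rewrite (gE Mp i j) (gE Mp j i) ipC. Qed.

Lemma gi_g i j : \sum_l gi i l * g p l j = (i == j)%:R.
Proof. by have /matrixP/(_ i j) := mulVmx (g_unit Mp); rewrite !mxE. Qed.

Lemma g_gi i j : \sum_l g p i l * gi l j = (i == j)%:R.
Proof. by have /matrixP/(_ i j) := mulmxV (g_unit Mp); rewrite !mxE. Qed.

Lemma gi_sym i j : gi i j = gi j i.
Proof.
have gT : (g p)^T = g p by apply/matrixP => a b; rewrite mxE g_sym.
by rewrite -[in LHS]gT -trmx_inv mxE.
Qed.

Lemma ip_cone_d i : ip (cone p) (cone_d i p) = 0.
Proof.
have d a := smooth_differentiable (sY a) Mp.
have E : partial i (fun z => \sum_a eps a * (Y a z * Y a z)) p = 0.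
  rewrite (partial_near i (g := fun=> 0) oM Mp) ?partial_cst // => z Mz.
  by transitivity (ip (cone z) (cone z)); [apply: eq_bigr => a _; rewrite !mxE|exact: null].
have dM a : differentiable (fun z => Y a z * Y a z) p by exact: differentiableM.
have dc a : differentiable (fun=> eps a : R) p by exact: differentiable_cst.
move: E; rewrite partial_sum => [E|a]; last exact: differentiableM.
have : 2 * ip (cone p) (cone_d i p) = 0.
  rewrite -[RHS]E mulr_sumr; apply: eq_bigr => a _.
  by rewrite partialM // partial_cst partialM // !mxE; ring.
by move=> /eqP; rewrite mulf_eq0 pnatr_eq0 /= => /eqP.
Qed.

(** The Gram matrix of the vectors dY, [cone p], [W p] consists of the block g and a hyperbolic
    plane. Inverting it yields the completeness relation on which [ip_split] rests. *)
Lemma cone_basis : exists B : 'M[R]_(5 + (1 + 1), 7),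
  B = col_mx (\matrix_(i, a) cone_d i p 0 a) (col_mx (cone p) (W p)) /\
  diag_mx (\row_a eps a) *m B^T *m block_mx gi 0 0 (block_mx 0 1%:M 1%:M 0) *m B = 1%:M.
Proof.
set E := diag_mx _; set J : 'M[R]_(5, 7) := \matrix_(i, a) cone_d i p 0 a.
exists (col_mx J (col_mx (cone p) (W p))); split=> //; set B := col_mx _ _.
have rJ i : row i J = cone_d i p by apply/rowP => a; rewrite !mxE.
have BEB : B *m E *m B^T = block_mx (g p) 0 0 (block_mx 0 1%:M 1%:M 0).
  have BE1 : B *m E = col_mx (J *m E) (col_mx (cone p *m E) (W p *m E)) by rewrite /B !mul_col_mx.
  rewrite BE1 /B !tr_col_mx mul_col_row mul_mx_row mul_col_mx mul_col_row; congr block_mx.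
  - by apply/matrixP => i j; rewrite mul_diagE !rJ gE.
  - rewrite -[RHS]row_mx0; congr row_mx; apply/matrixP => i j; rewrite mul_diagE rJ row_1 mxE.
      by rewrite ipC ip_cone_d.
    by rewrite W_tangent.
  - rewrite -[RHS]col_mx0; congr col_mx; apply/matrixP => i j; rewrite mul_diagE rJ row_1 mxE.
      by rewrite ip_cone_d.
    by rewrite ipC W_tangent.
  congr block_mx; apply/matrixP => i j; rewrite mul_diagE !row_1 !ord1 mxE //= ?null ?W_null ?W_cone //.
  by rewrite ipC W_cone.
have G'K : block_mx (g p) 0 0 (block_mx 0 1%:M 1%:M 0) *m
    block_mx gi 0 0 (block_mx 0 1%:M 1%:M 0) = 1%:M :> 'M[R]_(5 + (1 + 1)).
  rewrite !mulmx_block !(mulmx0, mul0mx, addr0, add0r, mulmx1, mulmxV (g_unit Mp)).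
  by rewrite -!scalar_mx_block.
have BX : B *m (E *m B^T *m block_mx gi 0 0 (block_mx 0 1%:M 1%:M 0)) = 1%:M.
  by rewrite !mulmxA BEB G'K.
(* A right inverse of a square matrix is a left inverse; 5 + (1 + 1) computes to 7. *)
exact: (@mulmx1C R 7 _ _ BX).
Qed.

(* The coordinate vectors together with the two null normals [cone p], [W p]
   span [R^7], so the ambient scalar product splits into tangential and normal parts. *)
Lemma ip_split u v : ip u v =
  \sum_m \sum_n gi m n * (ip (cone_d m p) u * ip (cone_d n p) v)
  + (ip (cone p) u * ip (W p) v + ip (W p) u * ip (cone p) v).
Proof.
have [B [BE E1]] := cone_basis; set E := diag_mx _ in E1; set G := block_mx gi 0 0 _ in E1.
have L (w : 'rV[R]_7) : w *m E *m B^T = row_mx (\row_i ip (cone_d i p) w) (row_mx (ip (cone p) w)%:M (ip (W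
  p) w)%:M).
  rewrite BE !tr_col_mx !mul_mx_row; congr row_mx.
    apply/rowP => i; rewrite mul_diagE row_1 mxE ipC; congr ip.
    by apply/rowP => a; rewrite !mxE.
  by congr row_mx; apply/matrixP => i j; rewrite mul_diagE !row_1 !ord1 ipC [RHS]mxE.
have -> : ip u v = ((u *m E *m B^T) *m G *m (v *m E *m B^T)^T) 0 0.
  have -> : ip u v = (u *m E *m v^T) 0 0 by rewrite mul_diagE !row_1.
  congr (fun_of_matrix _ 0 0); rewrite !trmx_mul trmxK tr_diag_mx -/E.
  transitivity (u *m (E *m B^T *m G *m B) *m E *m v^T); first by rewrite E1 mulmx1.
  by rewrite !mulmxA.
rewrite !L /G; set a := \row_i _; set b := \row_i _.
rewrite mul_row_block !(mulmx0, addr0, add0r) mul_row_block !(mulmx0, mulmx1, addr0, add0r).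
rewrite !tr_row_mx !mul_row_col !tr_scalar_mx mxE; congr (_ + _).
  rewrite mxE exchange_big /=; apply: eq_bigr => m _.
  rewrite mxE mulr_suml; apply: eq_bigr => n _; rewrite !mxE gi_sym; ring.
by rewrite mxE -!scalar_mxM !mxE /= !mulr1n addrC.
Qed.

End At.

Lemma partial_ip (u v : 'I_7 -> pt -> R) i p :
  (forall a, differentiable (u a) p) -> (forall a, differentiable (v a) p) ->
  partial i (fun z => \sum_a eps a * (u a z * v a z)) p =
  ip (\row_a partial i (u a) p) (\row_a v a p) + ip (\row_a u a p) (\row_a partial i (v a) p).
Proof.
move=> du dv; have dM a : differentiable (fun z => u a z * v a z) p by exact: differentiableM.
have dc a : differentiable (fun=> eps a : R) p by exact: differentiable_cst.
rewrite partial_sum => [|a]; last exact: differentiableM.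
rewrite -big_split; apply: eq_bigr => a _ /=.
by rewrite partialM // partial_cst partialM // !mxE; ring.
Qed.

Lemma cone_ddC i j p : M p -> cone_dd i j p = cone_dd j i p.
Proof.
move=> Mp.
have E : (fun a => partial i (partial j (Y a)) p) = (fun a => partial j (partial i (Y a)) p).
  apply/funext => a.
  exact: (partialC i j oM (sY a) Mp).
exact: (congr1 (fun f : 'I_7 -> R => \row_a f a) E).
Qed.

Let dY a i p : M p -> differentiable (partial i (Y a)) p.
Proof. by move=> Mp; exact: (smooth_differentiable (smooth_partial i (sY a)) Mp). Qed.

Lemma partial_g i j l p : M p ->
  partial i (fun z => g z j l) p = ip (cone_dd i j p) (cone_d l p) + ip (cone_d j p) (cone_dd i l p).
Proof.
move=> Mp.
have E := partial_ip i (fun a => dY a j Mp) (fun a => dY a l Mp).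
refine (etrans _ E); apply: (partial_near i oM Mp) => z Mz; rewrite (gE Mz).
by apply: eq_bigr => a _; rewrite !mxE.
Qed.

(** Christoffel symbols of the first kind, read off the embedding as the tangential part of the
    second derivative. *)
Definition lowered l i j (p : pt) : R := ip (cone_d l p) (cone_dd i j p).

Lemma loweredC l i j p : M p -> lowered l i j p = lowered l j i p.
Proof. by move=> Mp; rewrite /lowered (cone_ddC i j Mp). Qed.

Lemma partial_g_lowered i j l p : M p ->
  partial i (fun z => g z j l) p = lowered l i j p + lowered j i l p.
Proof. by move=> Mp; rewrite (partial_g i j l Mp); congr (_ + _); exact: ipC. Qed.

Lemma christoffelE m i j p : M p ->
  christoffel g m i j p = \sum_l invmx (g p) m l * lowered l i j p.
Proof.
move=> Mp; rewrite /christoffel mulr_sumr; apply: eq_bigr => l _.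
rewrite (partial_g_lowered i j l Mp) (partial_g_lowered j i l Mp) (partial_g_lowered l i j Mp).
rewrite (loweredC l j i Mp) (loweredC j l i Mp) (loweredC i l j Mp).
move: (lowered l i j p) (lowered j i l p) (lowered i j l p) (invmx _ _ _) => x y t w; by field.
Qed.

Let smooth_lowered l i j : smooth M (lowered l i j).
Proof.
have sS : smooth M (fun z => \sum_a eps a * (partial l (Y a) z * partial i (partial j (Y a)) z)).
  apply: smooth_sum => // a _; apply: smoothZ => //; apply: smoothM => //.
    exact: smooth_partial.
  by do 2!apply: smooth_partial.
by refine (smooth_near oM _ sS) => z _; apply: eq_bigr => a _; rewrite !mxE.
Qed.

Let smooth_g i j : smooth M (fun z => g z i j).
Proof.
have sS : smooth M (fun z => \sum_a eps a * (partial i (Y a) z * partial j (Y a) z)).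
  by apply: smooth_sum => // a _; apply: smoothZ => //; apply: smoothM => //; exact: smooth_partial.
by refine (smooth_near oM _ sS) => z Mz; rewrite gE //; apply: eq_bigr => a _; rewrite !mxE.
Qed.

Let smooth_christoffel m i j : smooth M (christoffel g m i j).
Proof.
have sS : smooth M (fun z => \sum_l invmx (g z) m l * lowered l i j z).
  apply: smooth_sum => // l _; apply: smoothM => //; exact: smooth_invmx.
by refine (smooth_near oM _ sS) => z Mz; rewrite christoffelE.
Qed.

Lemma lower_christoffel l i j p : M p -> \sum_m g p l m * christoffel g m i j p = lowered l i j p.
Proof.
move=> Mp; under eq_bigr do rewrite christoffelE // mulr_sumr.
rewrite exchange_big (bigD1 l) //= [X in _ + X]big1 ?addr0 => [|n nl].
  by under eq_bigr do rewrite mulrA; rewrite -mulr_suml g_gi // eqxx mul1r.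
by under eq_bigr do rewrite mulrA; rewrite -mulr_suml g_gi // eq_sym (negbTE nl) mul0r.
Qed.

Lemma partial_lowered l i j k p : M p -> partial i (lowered l j k) p =
  ip (cone_dd i l p) (cone_dd j k p) + ip (cone_d l p) (\row_a partial i (partial j (partial k (Y a))) p).
Proof.
move=> Mp.
have E := partial_ip i (fun a => dY a l Mp)
  (fun a => smooth_differentiable (smooth_partial j (smooth_partial k (sY a))) Mp).
refine (etrans _ E); apply: (partial_near i oM Mp) => z Mz.
by apply: eq_bigr => a _; rewrite !mxE.
Qed.

(** Leibniz rule for [lower_christoffel]: it trades derivatives of the inverse metric for
    derivatives of the metric. *)
Lemma lower_partial_christoffel l i j k p : M p ->
  \sum_m g p l m * partial i (christoffel g m j k) p =
  partial i (lowered l j k) p - \sum_m partial i (fun z => g z l m) p * christoffel g m j k p.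
Proof.
move=> Mp; have dg m := smooth_differentiable (smooth_g l m) Mp.
have dc m := smooth_differentiable (smooth_christoffel m j k) Mp.
have -> : partial i (lowered l j k) p = partial i (fun z => \sum_m g z l m * christoffel g m j k z) p.
  by apply: (partial_near i oM Mp) => z Mz; rewrite lower_christoffel.
rewrite partial_sum => [|m]; last exact: differentiableM.
rewrite -sumrB; apply: eq_bigr => m _; rewrite partialM //; ring.
Qed.

(** The contribution of the plane spanned by [cone p] and [W p] to the product of two second
    derivatives of Y. *)
Definition normal_part i j k l p : R :=
  ip (cone p) (cone_dd i j p) * ip (W p) (cone_dd k l p)
  + ip (W p) (cone_dd i j p) * ip (cone p) (cone_dd k l p).

(** Gauss equation: third derivatives of Y cancel by symmetry, the tangential parts of the products
    of second derivatives cancel the terms quadratic in the Christoffel symbols, and only the normal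
    parts remain. *)
Lemma riemannE l k i j p : M p ->
  riemann g l k i j p = normal_part i l j k p - normal_part j l i k p.
Proof.
move=> Mp.
have third : ip (cone_d l p) (\row_a partial j (partial i (partial k (Y a))) p) =
    ip (cone_d l p) (\row_a partial i (partial j (partial k (Y a))) p).
  have E : (fun a => partial j (partial i (partial k (Y a))) p) =
      (fun a => partial i (partial j (partial k (Y a))) p).
    by apply/funext => a; exact: (partialC j i oM (smooth_partial k (sY a)) Mp).
  exact: (congr1 (fun f : 'I_7 -> R => ip (cone_d l p) (\row_a f a)) E).
have S1 u v : \sum_m \sum_n invmx (g p) m n * (ip (cone_d m p) (cone_dd u l p) * ip (cone_d n p) (cone_dd v
  k p))
   = \sum_m lowered m u l p * christoffel g m v k p.
  apply: eq_bigr => m _; rewrite (christoffelE m v k Mp) mulr_sumr; apply: eq_bigr => n _.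
  rewrite /lowered; move: (invmx _ _ _) (ip _ _) (ip _ _) => x y t; ring.
have S2 u v : \sum_m partial u (fun z => g z l m) p * christoffel g m v k p =
    \sum_m lowered m u l p * christoffel g m v k p + \sum_m lowered l u m p * christoffel g m v k p.
  by rewrite -big_split; apply: eq_bigr => m _ /=; rewrite (partial_g_lowered u l m Mp) mulrDl.
have S3 u v : \sum_m g p l m * (\sum_n christoffel g m u n p * christoffel g n v k p) =
    \sum_n lowered l u n p * christoffel g n v k p.
  under eq_bigr do rewrite mulr_sumr.
  rewrite exchange_big; apply: eq_bigr => n _ /=.
  by under eq_bigr do rewrite mulrA; rewrite -mulr_suml (lower_christoffel l u n Mp).
have split_sum (x a b c d : 'I_5 -> R) : \sum_m x m * (a m - b m + (c m - d m)) =
    \sum_m x m * a m - \sum_m x m * b m + (\sum_m x m * c m - \sum_m x m * d m).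
  by rewrite -!sumrB -big_split; apply: eq_bigr => m _ /=; ring.
have step : riemann g l k i j p =
    \sum_m g p l m * partial i (christoffel g m j k) p - \sum_m g p l m * partial j (christoffel g m i k) p
    + (\sum_m g p l m * (\sum_n christoffel g m i n p * christoffel g n j k p)
       - \sum_m g p l m * (\sum_n christoffel g m j n p * christoffel g n i k p)).
  refine (etrans _ (split_sum _ _ _ _ _)); apply: eq_bigr => m _.
  by rewrite /riemann_up sumrB.
(* The bookkeeping of the cancellation: p are derivatives of [lowered], q derivatives of g times
   Christoffel symbols, d products of second derivatives, t third derivatives, a tangential
   quadratic terms, n normal terms. *)
have alg (x1 x2 x3 x4 p1 p2 q1 q2 d1 d2 t1 t2 a1 a2 a3 a4 n1 n2 n3 n4 : R) :
    x1 = p1 - q1 -> x2 = p2 - q2 -> x3 = a2 -> x4 = a4 ->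
    p1 = d1 + t1 -> p2 = d2 + t2 -> t2 = t1 -> q1 = a1 + a2 -> q2 = a3 + a4 ->
    d1 = a1 + (n1 + n2) -> d2 = a3 + (n3 + n4) ->
    x1 - x2 + (x3 - x4) = n1 + n2 - (n3 + n4).
  by move=> -> -> -> -> -> -> -> -> -> -> ->; ring.
have D1 := etrans (ip_split Mp (cone_dd i l p) (cone_dd j k p)) (congr1 (fun x => x + _) (S1 i j)).
have D2 := etrans (ip_split Mp (cone_dd j l p) (cone_dd i k p)) (congr1 (fun x => x + _) (S1 j i)).
refine (etrans step (alg _ _ _ _ _ _ _ _ _ _ _ _ _ _ _ _ _ _ _ _
  (lower_partial_christoffel l i j k Mp) (lower_partial_christoffel l j i k Mp) (S3 i j) (S3 j i)
  (partial_lowered l i j k Mp) (partial_lowered l j i k Mp) third (S2 i j) (S2 j i) D1 D2)).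
Qed.

(** Derivative of the orthogonality of Y and dY: the second fundamental form in the direction of the
    position vector is minus the metric. *)
Lemma ip_cone_dd i j p : M p -> ip (cone p) (cone_dd i j p) = - g p i j.
Proof.
move=> Mp.
have E0 z : M z -> \sum_a eps a * (Y a z * partial j (Y a) z) = 0.
  by move=> Mz; refine (etrans _ (ip_cone_d Mz j)); apply: eq_bigr => a _; rewrite !mxE.
have E := etrans (partial_near i oM Mp E0) (partial_cst i 0 p).
have E1 := partial_ip i (fun a => smooth_differentiable (sY a) Mp) (fun a => dY a j Mp).
have alg (x y t : R) : x = 0 -> x = y + t -> t = - y by move=> ->; lra.
by refine (etrans (alg _ _ _ E E1) _); rewrite (gE Mp i j).
Qed.

(** The second fundamental form in the direction of the other null normal. By [ricci_cone] it is
    minus the Schouten tensor. *)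
Let K i j p : R := ip (W p) (cone_dd i j p).

Let KC i j p : M p -> K i j p = K j i p.
Proof. by move=> Mp; rewrite /K (cone_ddC i j Mp). Qed.

(** One of the two second fundamental forms is minus g, so the Gauss equation leaves a
    Kulkarni-Nomizu product of g and [K], which has no trace-free part. *)
Lemma riemann_cone l k i j p : M p -> riemann g l k i j p =
  - (g p l i * K k j p - g p l j * K k i p - g p k i * K l j p + g p k j * K l i p).
Proof.
move=> Mp.
have alg (x y z t a b c d e f g0 h e' f' g' h' : R) : x = - a -> y = - b -> z = - c -> t = - d ->
    e = e' -> f = f' -> g0 = g' -> h = h' ->
    x * e + f * y - (z * g0 + h * t) = - (a * e' - c * g' - d * h' + b * f').
  by move=> -> -> -> -> -> -> -> ->; ring.
have cE a b : ip (cone p) (cone_dd a b p) = - g p b a by rewrite (ip_cone_dd a b Mp) (g_sym Mp a b).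
exact: (etrans (riemannE l k i j Mp) (alg _ _ _ _ _ _ _ _ _ _ _ _ _ _ _ _
  (cE i l) (cE j k) (cE j l) (cE i k) (KC j k Mp) (KC i l Mp) (KC i k Mp) (KC j l Mp))).
Qed.

Lemma riemann_up_cone m k i j p : M p -> riemann_up g m k i j p =
  \sum_l invmx (g p) m l * riemann g l k i j p.
Proof.
move=> Mp; rewrite /riemann; under [RHS]eq_bigr do rewrite mulr_sumr.
rewrite exchange_big (bigD1 m) //= [X in _ = _ + X]big1 ?addr0 => [|n nm].
  by under eq_bigr do rewrite mulrA; rewrite -mulr_suml gi_g // eqxx mul1r.
by under eq_bigr do rewrite mulrA; rewrite -mulr_suml gi_g // eq_sym (negbTE nm) mul0r.
Qed.

Let tr p : R := \sum_i \sum_l invmx (g p) i l * K i l p.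

Lemma ricci_cone k j p : M p -> ricci g k j p = - 3 * K k j p - tr p * g p k j.
Proof.
move=> Mp; rewrite /ricci.
have E i : riemann_up g i k i j p = - ((\sum_l invmx (g p) i l * g p l i) * K k j p
   - (\sum_l invmx (g p) i l * g p l j) * K k i p
   - g p k i * (\sum_l invmx (g p) i l * K l j p) + g p k j * (\sum_l invmx (g p) i l * K l i p)).
  have sums (x a b c d : 'I_5 -> R) (s t u w : R) :
      \sum_l x l * (- (a l * s - b l * t - u * c l + w * d l)) =
      - ((\sum_l x l * a l) * s - (\sum_l x l * b l) * t - u * (\sum_l x l * c l) + w * (\sum_l x l * d l)).
    rewrite !mulr_suml !mulr_sumr -!sumrB -big_split -sumrN; apply: eq_bigr => l _ /=; ring.
  refine (etrans (riemann_up_cone i k i j Mp) (etrans _ (sums _ _ _ _ _ _ _ _ _))).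
  by apply: eq_bigr => l _; congr (_ * _); exact: (riemann_cone l k i j Mp).
have sums (t u c e : 'I_5 -> R) (s w : R) :
    \sum_i - (s - (i == j)%:R * t i - u i * c i + w * e i) =
    - 5 * s + t j + \sum_i u i * c i - w * \sum_i e i.
  have -> : t j = \sum_i (i == j)%:R * t i.
    rewrite (bigD1 j) //= eqxx mul1r big1 ?addr0 // => i ij.
    by rewrite (negbTE ij) mul0r.
  have -> : - 5 * s = \sum_(i < 5) - s by rewrite sumr_const card_ord; ring.
  by rewrite mulr_sumr -!big_split -sumrB; apply: eq_bigr => i _ /=; ring.
have contract : \sum_i g p k i * (\sum_l invmx (g p) i l * K l j p) = K k j p.
  under eq_bigr do rewrite mulr_sumr.
  rewrite exchange_big (bigD1 k) //= [X in _ + X]big1 ?addr0 => [|n nk].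
    by under eq_bigr do rewrite mulrA; rewrite -mulr_suml (g_gi Mp k k) eqxx mul1r.
  by under eq_bigr do rewrite mulrA; rewrite -mulr_suml (g_gi Mp k n) eq_sym (negbTE nk) mul0r.
have trE : \sum_i \sum_l invmx (g p) i l * K l i p = tr p.
  by apply: eq_bigr => i _; apply: eq_bigr => l _; rewrite (KC l i Mp).
have alg (x y z s w : R) : y = x -> z = s -> - 5 * x + x + y - w * z = - 3 * x - s * w.
  by move=> -> ->; ring.
refine (etrans _ (etrans (sums (fun i => K k i p) (fun i => g p k i)
  (fun i => \sum_l invmx (g p) i l * K l j p) (fun i => \sum_l invmx (g p) i l * K l i p)
  (K k j p) (g p k j)) (alg _ _ _ _ _ contract trE))).
apply: eq_bigr => i _; refine (etrans (E i) _).
by rewrite (gi_g Mp i i) (gi_g Mp i j) eqxx mul1r.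
Qed.

Lemma scalar_curvature_cone p : M p -> scalar_curvature g p = - 8 * tr p.
Proof.
move=> Mp; rewrite /scalar_curvature.
have E k : \sum_j invmx (g p) k j * ricci g k j p =
    - 3 * (\sum_j invmx (g p) k j * K k j p) - tr p * (\sum_j invmx (g p) k j * g p j k).
  have sums (x a b : 'I_5 -> R) (t : R) : \sum_j x j * (- 3 * a j - t * b j) =
      - 3 * (\sum_j x j * a j) - t * (\sum_j x j * b j).
    by rewrite !mulr_sumr -sumrB; apply: eq_bigr => j _; ring.
  refine (etrans _ (sums _ _ _ _)); apply: eq_bigr => j _; congr (_ * _).
  by refine (etrans (ricci_cone k j Mp) _); rewrite (g_sym Mp k j).
have sums (a : 'I_5 -> R) (t : R) : \sum_k (- 3 * a k - t) = - 3 * (\sum_k a k) - 5 * t.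
  have -> : 5 * t = \sum_(i < 5) t by rewrite sumr_const card_ord; ring.
  by rewrite mulr_sumr -sumrB.
have alg (t : R) : - 3 * t - 5 * t = - 8 * t by ring.
refine (etrans _ (etrans (sums (fun k => \sum_j invmx (g p) k j * K k j p) (tr p)) (alg _))).
by apply: eq_bigr => k _; refine (etrans (E k) _); rewrite (gi_g Mp k k) eqxx mulr1.
Qed.

Theorem weyl_cone l k i j p : M p -> weyl g l k i j p = 0.
Proof.
move=> Mp; rewrite /weyl (riemann_cone l k i j Mp) (scalar_curvature_cone Mp).
rewrite (ricci_cone k j Mp) (ricci_cone k i Mp) (ricci_cone l j Mp) (ricci_cone l i Mp).
have -> : (5%:R - 2 : R) = 3 by ring.
have -> : (5%:R - 1 : R) = 4 by ring.
move: (g p l i) (g p l j) (g p k i) (g p k j) (K k j p) (K k i p) (K l j p) (K l i p) (tr p).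
by move=> *; field.
Qed.

End ConeMetric.

(** * The rolling distribution in the null cone *)

Section ConeAlgebra.
Context {R : realType}.
Local Notation O := (split_octonion R).

(** The first three coordinates are those of the imaginary quaternion, the last four those of the
    quaternion. The scale 6 makes the induced metric equal to [g_R] and not merely proportional to
    it. *)
Definition sgn7 (a : 'I_7) : R := if (a < 3)%N then - 6 else 6.

Lemma sum7 (V : zmodType) (f : nat -> V) :
  \sum_(a < 7) f a = f 0%N + f 1%N + f 2%N + f 3%N + f 4%N + f 5%N + f 6%N.
Proof. by rewrite !big_ord_recr big_ord0 /= add0r. Qed.

Lemma ip_sgn7 (u v : nat -> R) : ip sgn7 (\row_a u a) (\row_a v a) =
  - 6 * (u 0%N * v 0%N + u 1%N * v 1%N + u 2%N * v 2%N
         - (u 3%N * v 3%N + u 4%N * v 4%N + u 5%N * v 5%N + u 6%N * v 6%N)).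
Proof.
rewrite /ip; under eq_bigr do rewrite !mxE.
rewrite (sum7 (fun a : nat => (if (a < 3)%N then - 6 else 6) * (u a * v a))) /=.
by ring.
Qed.

Variables r0 r1 r2 r3 s0 s1 s2 s3 : R.

(* For quaternions [r], [s], the entries of the imaginary quaternion [r e3 r^*]
   followed by those of the quaternion [s r^*]. *)
Definition cone_entry (a : nat) : R := nth 0
  [:: 2 * (r1 * r3 + r0 * r2); 2 * (r2 * r3 - r0 * r1); r0 * r0 - r1 * r1 - r2 * r2 + r3 * r3;
      s0 * r0 + s1 * r1 + s2 * r2 + s3 * r3; - (s0 * r1) + s1 * r0 - s2 * r3 + s3 * r2;
      - (s0 * r2) + s1 * r3 + s2 * r0 - s3 * r1; - (s0 * r3) - s1 * r2 + s2 * r1 + s3 * r0] a.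

(* The same entries for [2 r (x2 e1 - x1 e2) r^*] and [s y r^*]: this is the
   derivative of the cone when [dr = r x] and [ds = s (y + x)]. *)
Definition cone_entry_d (x1 x2 y1 y2 y3 : R) (a : nat) : R := nth 0
  [:: 2 * (x2 * (r0 * r0 + r1 * r1 - r2 * r2 - r3 * r3) - x1 * (2 * (r1 * r2 - r0 * r3)));
      2 * (x2 * (2 * (r1 * r2 + r0 * r3)) - x1 * (r0 * r0 - r1 * r1 + r2 * r2 - r3 * r3));
      2 * (x2 * (2 * (r1 * r3 - r0 * r2)) - x1 * (2 * (r2 * r3 + r0 * r1)));
      (- (s1 * y1) - s2 * y2 - s3 * y3) * r0 + (s0 * y1 + s2 * y3 - s3 * y2) * r1
        + (s0 * y2 - s1 * y3 + s3 * y1) * r2 + (s0 * y3 + s1 * y2 - s2 * y1) * r3;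
      - ((- (s1 * y1) - s2 * y2 - s3 * y3) * r1) + (s0 * y1 + s2 * y3 - s3 * y2) * r0
        - (s0 * y2 - s1 * y3 + s3 * y1) * r3 + (s0 * y3 + s1 * y2 - s2 * y1) * r2;
      - ((- (s1 * y1) - s2 * y2 - s3 * y3) * r2) + (s0 * y1 + s2 * y3 - s3 * y2) * r3
        + (s0 * y2 - s1 * y3 + s3 * y1) * r0 - (s0 * y3 + s1 * y2 - s2 * y1) * r1;
      - ((- (s1 * y1) - s2 * y2 - s3 * y3) * r3) - (s0 * y1 + s2 * y3 - s3 * y2) * r2
        + (s0 * y2 - s1 * y3 + s3 * y1) * r1 + (s0 * y3 + s1 * y2 - s2 * y1) * r0] a.

Local Notation nr := (r0 * r0 + r1 * r1 + r2 * r2 + r3 * r3).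
Local Notation ns := (s0 * s0 + s1 * s1 + s2 * s2 + s3 * s3).
Hypotheses (r1E : nr = 1) (s1E : ns = 1).

Local Notation u0 := (cone_entry 0%N). Local Notation u1 := (cone_entry 1%N).
Local Notation u2 := (cone_entry 2%N). Local Notation v0 := (cone_entry 3%N).
Local Notation v1 := (cone_entry 4%N). Local Notation v2 := (cone_entry 5%N).
Local Notation v3 := (cone_entry 6%N).

(** Multiplicativity of the quaternion norm. The identity is first stated in homogeneous form, where
    it is polynomial, and the unit norms are inserted afterwards; [cone_entry_dd] proceeds
    likewise. *)
Lemma cone_entry_u : u0 * u0 + u1 * u1 + u2 * u2 = 1.
Proof. by transitivity (nr * nr); [rewrite /cone_entry /cone_entry_d /=; ring|rewrite r1E mulr1]. Qed.

Lemma cone_entry_v : v0 * v0 + v1 * v1 + v2 * v2 + v3 * v3 = 1.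
Proof.
by transitivity (nr * ns); [rewrite /cone_entry /cone_entry_d /=; ring|rewrite r1E s1E mulr1].
Qed.

Section Derivative.
Variables x1 x2 y1 y2 y3 : R.
Local Notation d := (cone_entry_d x1 x2 y1 y2 y3).

Lemma cone_entry_du : u0 * d 0%N + u1 * d 1%N + u2 * d 2%N = 0.
Proof. by rewrite /cone_entry /cone_entry_d /=; ring. Qed.

Lemma cone_entry_dv : v0 * d 3%N + v1 * d 4%N + v2 * d 5%N + v3 * d 6%N = 0.
Proof. by rewrite /cone_entry /cone_entry_d /=; ring. Qed.

(** Conjugation by r and multiplication by s and r^-1 are isometries, so only 2 (x2 e1 - x1 e2) and
    y have to be measured. *)
Lemma cone_entry_dd x1' x2' y1' y2' y3' (d' := cone_entry_d x1' x2' y1' y2' y3') :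
  d 0%N * d' 0%N + d 1%N * d' 1%N + d 2%N * d' 2%N -
  (d 3%N * d' 3%N + d 4%N * d' 4%N + d 5%N * d' 5%N + d 6%N * d' 6%N) =
  4 * (x1 * x1' + x2 * x2') - (y1 * y1' + y2 * y2' + y3 * y3').
Proof.
transitivity (4 * (x1 * x1' + x2 * x2') * (nr * nr) - (y1 * y1' + y2 * y2' + y3 * y3') * (ns * nr)).
  by rewrite /d' /cone_entry_d /=; ring.
by rewrite r1E s1E !mulr1.
Qed.
End Derivative.

(** With u the first three entries and v the last four, minus the octonion norm of the result is
    |v|^2 - |u|^2; a pair of unit vectors thus gives a null octonion. *)
Definition oct_of_cone (y : nat -> R) : O :=
  oct (y 3%N) (y 0%N - y 4%N) (- y 0%N - y 4%N) (- y 3%N) (y 1%N - y 5%N) (y 2%N + y 6%N) (y 2%N - y 6%N)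
    (- y 1%N - y 5%N).

(* Multiplication by the unit imaginary quaternion [r e3 r^*] sends [r e1 r^*] to [r e2 r^*]. *)
Lemma cone_entry_null x1 x2 :
  oct_mul (oct_of_cone cone_entry) (oct_of_cone (cone_entry_d x1 x2 (2 * x1) (2 * x2) 0)) = 0.
Proof.
have Er : r0 * r0 = 1 - r1 * r1 - r2 * r2 - r3 * r3 by rewrite -r1E; ring.
have Es : s0 * s0 = 1 - s1 * s1 - s2 * s2 - s3 * s3 by rewrite -s1E; ring.
rewrite oct_mulE /oct_of_cone !octE /cone_entry /cone_entry_d /=.
by apply: octP; rewrite octE oc0; ring: Er Es.
Qed.

End ConeAlgebra.

(** * Unit quaternions attached to the two spheres *)

Section Rotors.
Context {R : realType}.
Local Notation pt := 'rV[R]_5.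
Implicit Types (z p : pt) (i j : 'I_5) (c : R).

Lemma delta_col i j : (delta_mx j 0 : 'cV[R]_5) i 0 = (i == j)%:R.
Proof. by rewrite mxE eqxx andbT. Qed.

Lemma smooth_scaled_coordinate U j c : open U -> smooth U (fun z : pt => z 0 j / c).
Proof.
move=> oU; refine (smooth_near oU _ (smoothZ c^-1 oU (@smooth_coordinate _ _ U j))) => z _.
exact: mulrC.
Qed.

Lemma partial_scaled_coordinate i j c z : partial i (fun z : pt => z 0 j / c) z = (i == j)%:R / c.
Proof.
have dc := differentiable_coordinate j z.
have dk : differentiable (fun=> c^-1 : R) z by exact: differentiable_cst.
by rewrite (partialM i dc dk) partial_cst partial_coordinate mulr0 addr0.
Qed.

Let dsc j c z : differentiable (fun z : pt => z 0 j / c) z.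
Proof. exact: (smooth_differentiable (smooth_scaled_coordinate j c openT)). Qed.

Definition cosc j c z : R := cos (z 0 j / c).
Definition sinc j c z : R := sin (z 0 j / c).

Lemma partial_cosc i j c z : partial i (cosc j c) z = - sinc j c z * ((i == j)%:R / c).
Proof. by rewrite (partial_cos i (dsc j c z)) partial_scaled_coordinate. Qed.

Lemma partial_sinc i j c z : partial i (sinc j c) z = cosc j c z * ((i == j)%:R / c).
Proof. by rewrite (partial_sin i (dsc j c z)) partial_scaled_coordinate. Qed.

Lemma smooth_cosc U j c : open U -> smooth U (cosc j c).
Proof. by move=> oU; apply: smooth_cos => //; exact: smooth_scaled_coordinate. Qed.

Lemma smooth_sinc U j c : open U -> smooth U (sinc j c).
Proof. by move=> oU; apply: smooth_sin => //; exact: smooth_scaled_coordinate. Qed.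

Lemma cosc2 j c z : cosc j c z * cosc j c z = 1 - sinc j c z * sinc j c z.
Proof. by rewrite -!expr2 /cosc cos2sin2. Qed.

Lemma cosc_double j c z : c != 0 ->
  cos (z 0 j / c) = cosc j (c * 2) z * cosc j (c * 2) z - sinc j (c * 2) z * sinc j (c * 2) z /\
  sin (z 0 j / c) = 2 * sinc j (c * 2) z * cosc j (c * 2) z.
Proof.
move=> c0; have -> : z 0 j / c = z 0 j / (c * 2) + z 0 j / (c * 2).
  by move: (z 0 j) => t; field.
by rewrite cosD sinD; split=> //; rewrite /cosc /sinc; ring.
Qed.

Local Notation cq := (cosc i_q (3 * 2)). Local Notation sq := (sinc i_q (3 * 2)).
Local Notation cx := (cosc i_x (3 * 2)). Local Notation sx := (sinc i_x (3 * 2)).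

(* [exp (- e1 q / 6) exp (- e2 x / 6)] *)
Definition rot0 z := cq z * cx z.
Definition rot1 z := - (sq z * cx z).
Definition rot2 z := - (cq z * sx z).
Definition rot3 z := sq z * sx z.

(** [rho1], [rho2], [rho3] are the components of r^-1 dr. The radius 3 and the half angles of
    quaternions produce the factor 1/6. *)
Definition rho1 z i : R := - (cos (xx z / 3) / 6 * d_q i 0).
Definition rho2 z i : R := - (d_x i 0 / 6).
Definition rho3 z i : R := sin (xx z / 3) / 6 * d_q i 0.

Let dfc j c z : differentiable (cosc j c) z.
Proof. exact: (smooth_differentiable (smooth_cosc j c openT)). Qed.
Let dfs j c z : differentiable (sinc j c) z.
Proof. exact: (smooth_differentiable (smooth_sinc j c openT)). Qed.

Lemma partial_rot i z :
  [/\ partial i rot0 z = - (rot1 z * rho1 z i) - rot2 z * rho2 z i - rot3 z * rho3 z i,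
      partial i rot1 z = rot0 z * rho1 z i + rot2 z * rho3 z i - rot3 z * rho2 z i,
      partial i rot2 z = rot0 z * rho2 z i - rot1 z * rho3 z i + rot3 z * rho1 z i &
      partial i rot3 z = rot0 z * rho3 z i + rot1 z * rho2 z i - rot2 z * rho1 z i].
Proof.
have n3 : (3 : R) != 0 by rewrite pnatr_eq0.
have [C3 S3] := cosc_double i_x z n3.
have E := cosc2 i_x (3 * 2) z.
have [d1 d2 d3 d4] := And4 (dfc i_q (3 * 2) z) (dfs i_q (3 * 2) z) (dfc i_x (3 * 2) z) (dfs i_x (3 * 2) z).
have PM := partialM i; have PN := partialN i.
have P0 : partial i rot0 z = partial i cq z * cx z + cq z * partial i cx z by exact: (PM _ _ _ _ d1 d3).
have P1 : partial i rot1 z = - (partial i sq z * cx z + sq z * partial i cx z).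
  by refine (etrans (PN _ _ _ (differentiableM d2 d3)) _); rewrite (PM _ _ _ _ d2 d3).
have P2 : partial i rot2 z = - (partial i cq z * sx z + cq z * partial i sx z).
  by refine (etrans (PN _ _ _ (differentiableM d1 d4)) _); rewrite (PM _ _ _ _ d1 d4).
have P3 : partial i rot3 z = partial i sq z * sx z + sq z * partial i sx z by exact: (PM _ _ _ _ d2 d4).
rewrite P0 P1 P2 P3 !partial_cosc !partial_sinc /rot0 /rot1 /rot2 /rot3 /rho1 /rho2 /rho3 /xx C3 S3 !delta_col.
move: (cq z) (sq z) (cx z) (sx z) (i == i_q)%:R (i == i_x)%:R E => a b c d e f E.
by split; field: E.
Qed.

Local Notation ct := (cosc i_theta 2). Local Notation st := (sinc i_theta 2).
Local Notation cp := (cosc i_psi 2). Local Notation sp := (sinc i_psi 2).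
Local Notation cf := (cosc i_phi 2). Local Notation sf := (sinc i_phi 2).

(* [exp (e3 phi / 2) exp (- e2 theta / 2) exp (e3 psi / 2)] *)
Definition eul0 z := ct z * (cf z * cp z - sf z * sp z).
Definition eul1 z := st z * (sf z * cp z - cf z * sp z).
Definition eul2 z := - (st z * (cf z * cp z + sf z * sp z)).
Definition eul3 z := ct z * (sf z * cp z + cf z * sp z).

(** [eta1], [eta2], [eta3] are the components of s^-1 ds, so that the forms sigma are left-invariant
    forms on the unit quaternions. *)
Definition eta1 z i : R := - (sigma1 z i 0 / 2).
Definition eta2 z i : R := - (sigma2 z i 0 / 2).
Definition eta3 z i : R := - (sigma3 z i 0 / 2).

Lemma partial_eul i z :
  [/\ partial i eul0 z = - (eul1 z * eta1 z i) - eul2 z * eta2 z i - eul3 z * eta3 z i,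
      partial i eul1 z = eul0 z * eta1 z i + eul2 z * eta3 z i - eul3 z * eta2 z i,
      partial i eul2 z = eul0 z * eta2 z i - eul1 z * eta3 z i + eul3 z * eta1 z i &
      partial i eul3 z = eul0 z * eta3 z i + eul1 z * eta2 z i - eul2 z * eta1 z i].
Proof.
have n1 : (1 : R) != 0 by exact: oner_neq0.
have [Cp Sp] := cosc_double i_psi z n1; have [Ct St] := cosc_double i_theta z n1.
move: Cp Sp Ct St; rewrite !divr1 !mul1r => Cp Sp Ct St.
have Ep := cosc2 i_psi 2 z; have Et := cosc2 i_theta 2 z.
have [d1 d2 d3 d4] := And4 (dfc i_theta 2 z) (dfs i_theta 2 z) (dfc i_psi 2 z) (dfs i_psi 2 z).
have [d5 d6] := conj (dfc i_phi 2 z) (dfs i_phi 2 z).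
have d5d3 := differentiableM d5 d3; have d6d4 := differentiableM d6 d4.
have d6d3 := differentiableM d6 d3; have d5d4 := differentiableM d5 d4.
have PM := partialM i; have PN := partialN i; have PD := partialD i; have PB := partialB i.
have P0 : partial i eul0 z = partial i ct z * (cf z * cp z - sf z * sp z) + ct z *
   (partial i cf z * cp z + cf z * partial i cp z - (partial i sf z * sp z + sf z * partial i sp z)).
  by refine (etrans (PM _ _ _ _ d1 (differentiableB d5d3 d6d4)) _);
     rewrite (PB _ _ _ _ d5d3 d6d4) (PM _ _ _ _ d5 d3) (PM _ _ _ _ d6 d4).
have P1 : partial i eul1 z = partial i st z * (sf z * cp z - cf z * sp z) + st z *
   (partial i sf z * cp z + sf z * partial i cp z - (partial i cf z * sp z + cf z * partial i sp z)).
  by refine (etrans (PM _ _ _ _ d2 (differentiableB d6d3 d5d4)) _);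
     rewrite (PB _ _ _ _ d6d3 d5d4) (PM _ _ _ _ d6 d3) (PM _ _ _ _ d5 d4).
have P2 : partial i eul2 z = - (partial i st z * (cf z * cp z + sf z * sp z) + st z *
   (partial i cf z * cp z + cf z * partial i cp z + (partial i sf z * sp z + sf z * partial i sp z))).
  refine (etrans (PN _ _ _ (differentiableM d2 (differentiableD d5d3 d6d4))) _).
  by rewrite (PM _ _ _ _ d2 (differentiableD d5d3 d6d4)) (PD _ _ _ _ d5d3 d6d4) (PM _ _ _ _ d5 d3) (PM _ _
    _ _ d6 d4).
have P3 : partial i eul3 z = partial i ct z * (sf z * cp z + cf z * sp z) + ct z *
   (partial i sf z * cp z + sf z * partial i cp z + (partial i cf z * sp z + cf z * partial i sp z)).
  by refine (etrans (PM _ _ _ _ d1 (differentiableD d6d3 d5d4)) _);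
     rewrite (PD _ _ _ _ d6d3 d5d4) (PM _ _ _ _ d6 d3) (PM _ _ _ _ d5 d4).
rewrite P0 P1 P2 P3 !partial_cosc !partial_sinc /eul0 /eul1 /eul2 /eul3 /eta1 /eta2 /eta3.
rewrite /sigma1 /sigma2 /sigma3 /psi /theta Cp Sp Ct St !mxE !eqxx !andbT.
move: (cp z) (sp z) (ct z) (st z) (cf z) (sf z) (i == i_psi)%:R (i == i_theta)%:R (i == i_phi)%:R Ep Et.
move=> a b c d e f x y t Ep Et.
by split; field: Ep Et.
Qed.

Lemma rot_norm z : rot0 z * rot0 z + rot1 z * rot1 z + rot2 z * rot2 z + rot3 z * rot3 z = 1.
Proof.
have E := cosc2 i_x (3 * 2) z; have E' := cosc2 i_q (3 * 2) z.
rewrite /rot0 /rot1 /rot2 /rot3; move: (cq z) (sq z) (cx z) (sx z) E E' => a b c d E E'.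
by ring: E E'.
Qed.

Lemma eul_norm z : eul0 z * eul0 z + eul1 z * eul1 z + eul2 z * eul2 z + eul3 z * eul3 z = 1.
Proof.
have E := cosc2 i_theta 2 z; have E' := cosc2 i_phi 2 z; have E2 := cosc2 i_psi 2 z.
rewrite /eul0 /eul1 /eul2 /eul3.
move: (cp z) (sp z) (ct z) (st z) (cf z) (sf z) E E' E2 => a b c d e f E E' E2.
by ring: E E' E2.
Qed.

Lemma smooth_rot U : open U ->
  [/\ smooth U rot0, smooth U rot1, smooth U rot2 & smooth U rot3].
Proof.
move=> oU; have [s1 s2] := conj (fun j => smooth_cosc j (3 * 2) oU) (fun j => smooth_sinc j (3 * 2) oU).
split; do ?apply: smoothN => //; exact: smoothM.
Qed.

Lemma smooth_eul U : open U ->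
  [/\ smooth U eul0, smooth U eul1, smooth U eul2 & smooth U eul3].
Proof.
move=> oU; have [s1 s2] := conj (fun j => smooth_cosc j 2 oU) (fun j => smooth_sinc j 2 oU).
split; do ?apply: smoothN => //; apply: smoothM => //; do ?[apply: smoothB => //|apply: smoothD => //];
  exact: smoothM.
Qed.

End Rotors.

(** * The metric induced on the cone, and its Weyl tensor *)

Section RollingCone.
Context {R : realType}.
Local Notation pt := 'rV[R]_5.
Implicit Types (z p : pt) (i j : 'I_5).

(** Differentiability travels with the value of the derivative, so that the rules for sums and
    products compose in a single term. *)
Definition has_partial i (f : pt -> R) (d : R) z := differentiable f z /\ partial i f z = d.

Lemma has_partialD i f g a b z : has_partial i f a z -> has_partial i g b z ->
  has_partial i (fun z => f z + g z) (a + b) z.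
Proof. by move=> [df <-] [dg <-]; split; [exact: differentiableD|exact: partialD]. Qed.

Lemma has_partialB i f g a b z : has_partial i f a z -> has_partial i g b z ->
  has_partial i (fun z => f z - g z) (a - b) z.
Proof. by move=> [df <-] [dg <-]; split; [exact: differentiableB|exact: partialB]. Qed.

Lemma has_partialN i f a z : has_partial i f a z -> has_partial i (fun z => - f z) (- a) z.
Proof. by move=> [df <-]; split; [exact: differentiableN|exact: partialN]. Qed.

Lemma has_partialM i f g a b z : has_partial i f a z -> has_partial i g b z ->
  has_partial i (fun z => f z * g z) (a * g z + f z * b) z.
Proof. by move=> [df <-] [dg <-]; split; [exact: differentiableM|exact: partialM]. Qed.

Lemma has_partialZ i c f a z : has_partial i f a z -> has_partial i (fun z => c * f z) (c * a) z.
Proof.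
have dc : differentiable (fun=> c : R) z by exact: differentiable_cst.
move=> [df <-]; split; first exact: differentiableM.
by rewrite (partialM i dc df) partial_cst mul0r add0r.
Qed.

Definition rolling_cone (a : 'I_7) z : R :=
  cone_entry (rot0 z) (rot1 z) (rot2 z) (rot3 z) (eul0 z) (eul1 z) (eul2 z) (eul3 z) a.

Definition rolling_cone_d i (a : nat) z : R :=
  cone_entry_d (rot0 z) (rot1 z) (rot2 z) (rot3 z) (eul0 z) (eul1 z) (eul2 z) (eul3 z)
    (rho1 z i) (rho2 z i) (eta1 z i - rho1 z i) (eta2 z i - rho2 z i) (eta3 z i - rho3 z i) a.

Lemma partial_rolling_cone i a z : partial i (rolling_cone a) z = rolling_cone_d i a z.
Proof.
have [sr0 sr1 sr2 sr3] := @smooth_rot R setT openT.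
have [se0 se1 se2 se3] := @smooth_eul R setT openT.
have [pr0 pr1 pr2 pr3] := partial_rot i z; have [pe0 pe1 pe2 pe3] := partial_eul i z.
have H f (sf : smooth setT f) d (E : partial i f z = d) : has_partial i f d z.
  by split=> //; exact: smooth_differentiable sf I.
have h0 := H _ sr0 _ pr0; have h1 := H _ sr1 _ pr1; have h2 := H _ sr2 _ pr2; have h3 := H _ sr3 _ pr3.
have k0 := H _ se0 _ pe0; have k1 := H _ se1 _ pe1; have k2 := H _ se2 _ pe2; have k3 := H _ se3 _ pe3.
have M := has_partialM; have D := has_partialD; have B := has_partialB; have N := has_partialN.
have Z := has_partialZ 2.
rewrite /rolling_cone_d /cone_entry_d.
case: a => -[|[|[|[|[|[|[|//]]]]]]] lt_a /=.
- refine (etrans (proj2 (Z _ _ _ _ (D _ _ _ _ _ _ (M _ _ _ _ _ _ h1 h3) (M _ _ _ _ _ _ h0 h2)))) _); ring.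
- refine (etrans (proj2 (Z _ _ _ _ (B _ _ _ _ _ _ (M _ _ _ _ _ _ h2 h3) (M _ _ _ _ _ _ h0 h1)))) _); ring.
- refine (etrans (proj2 (D _ _ _ _ _ _ (B _ _ _ _ _ _ (B _ _ _ _ _ _ (M _ _ _ _ _ _ h0 h0)
    (M _ _ _ _ _ _ h1 h1)) (M _ _ _ _ _ _ h2 h2)) (M _ _ _ _ _ _ h3 h3))) _); ring.
- refine (etrans (proj2 (D _ _ _ _ _ _ (D _ _ _ _ _ _ (D _ _ _ _ _ _ (M _ _ _ _ _ _ k0 h0)
    (M _ _ _ _ _ _ k1 h1)) (M _ _ _ _ _ _ k2 h2)) (M _ _ _ _ _ _ k3 h3))) _); ring.
- refine (etrans (proj2 (D _ _ _ _ _ _ (B _ _ _ _ _ _ (D _ _ _ _ _ _ (N _ _ _ _ (M _ _ _ _ _ _ k0 h1))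
    (M _ _ _ _ _ _ k1 h0)) (M _ _ _ _ _ _ k2 h3)) (M _ _ _ _ _ _ k3 h2))) _); ring.
- refine (etrans (proj2 (B _ _ _ _ _ _ (D _ _ _ _ _ _ (D _ _ _ _ _ _ (N _ _ _ _ (M _ _ _ _ _ _ k0 h2))
    (M _ _ _ _ _ _ k1 h3)) (M _ _ _ _ _ _ k2 h0)) (M _ _ _ _ _ _ k3 h1))) _); ring.
- refine (etrans (proj2 (D _ _ _ _ _ _ (D _ _ _ _ _ _ (B _ _ _ _ _ _ (N _ _ _ _ (M _ _ _ _ _ _ k0 h3))
    (M _ _ _ _ _ _ k1 h2)) (M _ _ _ _ _ _ k2 h1)) (M _ _ _ _ _ _ k3 h0))) _); ring.
Qed.

Lemma smooth_rolling_cone U a : open U -> smooth U (rolling_cone a).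
Proof.
move=> oU; have [r0 r1 r2 r3] := @smooth_rot R U oU; have [e0 e1 e2 e3] := @smooth_eul R U oU.
have M f g sf sg := @smoothM R 4 U f g oU sf sg; have D f g sf sg := @smoothD R 4 U f g oU sf sg.
have B f g sf sg := @smoothB R 4 U f g oU sf sg; have N f sf := @smoothN R 4 U f oU sf.
case: a => -[|[|[|[|[|[|[|//]]]]]]] lt_a.
- exact: (smoothZ 2 oU (D _ _ (M _ _ r1 r3) (M _ _ r0 r2))).
- exact: (smoothZ 2 oU (B _ _ (M _ _ r2 r3) (M _ _ r0 r1))).
- exact: (D _ _ (B _ _ (B _ _ (M _ _ r0 r0) (M _ _ r1 r1)) (M _ _ r2 r2)) (M _ _ r3 r3)).
- exact: (D _ _ (D _ _ (D _ _ (M _ _ e0 r0) (M _ _ e1 r1)) (M _ _ e2 r2)) (M _ _ e3 r3)).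
- exact: (D _ _ (B _ _ (D _ _ (N _ (M _ _ e0 r1)) (M _ _ e1 r0)) (M _ _ e2 r3)) (M _ _ e3 r2)).
- exact: (B _ _ (D _ _ (D _ _ (N _ (M _ _ e0 r2)) (M _ _ e1 r3)) (M _ _ e2 r0)) (M _ _ e3 r1)).
- exact: (D _ _ (D _ _ (B _ _ (N _ (M _ _ e0 r3)) (M _ _ e1 r2)) (M _ _ e2 r1)) (M _ _ e3 r0)).
Qed.

Lemma g_R_entry z i j : g_R z i j =
  6 * (eta1 z i * eta1 z j + eta2 z i * eta2 z j + (eta3 z i - rho3 z i) * (eta3 z j - rho3 z j))
  - 18 * (rho1 z i * rho1 z j + rho2 z i * rho2 z j)
  - 6 * (eta1 z i * rho1 z j + rho1 z i * eta1 z j + eta2 z i * rho2 z j + rho2 z i * eta2 z j).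
Proof.
rewrite /eta1 /eta2 /eta3 /rho1 /rho2 /rho3 /g_R /o1 /o2 /o3 /o4 /o5 /o3t /o1t /o2t /o3.
move: (sigma1 z) (sigma2 z) (sigma3 z) (cos (xx z / 3)) (sin (xx z / 3)) (d_q : 'cV[R]_5) (d_x : 'cV[R]_5).
move=> a1 a2 a3 c s dq dx; rewrite !mxE !big_ord1 !mxE.
move: (a1 i 0) (a1 j 0) (a2 i 0) (a2 j 0) (a3 i 0) (a3 j 0) (dq i 0) (dq j 0) (dx i 0) (dx j 0).
by move=> *; field.
Qed.

Lemma cone_d_rolling i z : cone_d rolling_cone i z = \row_a rolling_cone_d i a z.
Proof.
have E : (fun a => partial i (rolling_cone a) z) = (fun a : 'I_7 => rolling_cone_d i a z).
  by apply/funext => a; exact: partial_rolling_cone.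
exact: (congr1 (fun f : 'I_7 -> R => \row_a f a) E).
Qed.

Lemma g_R_cone z i j : g_R z i j = ip sgn7 (cone_d rolling_cone i z) (cone_d rolling_cone j z).
Proof.
rewrite !cone_d_rolling.
refine (etrans _ (esym (ip_sgn7 (rolling_cone_d i ^~ z) (rolling_cone_d j ^~ z)))).
refine (etrans _ (congr1 ( *%R (- 6)) (esym (cone_entry_dd (rot_norm z) (eul_norm z) _ _ _ _ _ _ _ _ _ _)))).
rewrite g_R_entry.
move: (eta1 z i) (eta2 z i) (eta3 z i) (rho1 z i) (rho2 z i) (rho3 z i).
move: (eta1 z j) (eta2 z j) (eta3 z j) (rho1 z j) (rho2 z j) (rho3 z j).
by move=> *; ring.
Qed.

Local Notation M := (@domain R).

Lemma open_nonzero (U : set pt) (f : pt -> R) : open U -> (forall z, U z -> differentiable f z) ->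
  open [set z | U z /\ f z != 0].
Proof.
move=> oU df; rewrite openE => z [Uz fz]; rewrite /interior /=.
have nU : nbhs z U by exact: open_nbhs_nbhs.
have nf : nbhs z (f @^-1` [set x | x != 0]).
  apply: (differentiable_continuous (df z Uz)); apply: open_nbhs_nbhs; split=> //.
by apply: filterS2 nU nf => y Uy fy; split.
Qed.

Lemma open_domain : open M.
Proof.
have sc : smooth setT (sinc i_theta 1 : pt -> R) by apply: smooth_sinc; exact: openT.
have ss : smooth setT (cosc i_x 3 : pt -> R) by apply: smooth_cosc; exact: openT.
have o1 := open_nonzero (@openT pt) (fun z (_ : setT z) => smooth_differentiable sc I).
have o2 := open_nonzero o1 (fun z (_ : _ z) => smooth_differentiable ss I).
have -> // : M = [set z | [set z | setT z /\ sinc i_theta 1 z != 0] z /\ cosc i_x 3 z != 0].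
by apply/seteqP; split=> z; rewrite /sinc /= divr1 => -[]; [move=> ? ?|move=> [_ ?] ?].
Qed.

(** A rotation by the angle psi turns [sigma1] and [sigma2] into dtheta and sin(theta) dphi up to
    sign; sin(theta) is nonzero on the domain. *)
Lemma domain_sigma_inj z (v : pt) : M z -> v *m sigma1 z = 0 -> v *m sigma2 z = 0 -> v *m sigma3 z = 0 ->
  v 0 i_x = 0 -> v 0 i_q = 0 -> v = 0.
Proof.
move=> [st0 _] E1 E2 E3 Ex Eq.
have P (w : 'cV[R]_5) : v *m w = 0 -> \sum_i v 0 i * w i 0 = 0.
  by move/(congr1 (fun m : 'M[R]_1 => m 0 0)); rewrite !mxE.
have := P _ E1; have := P _ E2; have := P _ E3.
rewrite !sum5 Ex Eq !mxE !eqxx /=.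
have C : cos (psi z) * cos (psi z) = 1 - sin (psi z) * sin (psi z) by rewrite -!expr2 cos2sin2.
have Ev : v 0 i_psi = 0 -> v 0 i_theta = 0 -> v 0 i_phi = 0 -> v = 0.
  by move=> Ea Eb Ec; apply: row5P; rewrite mxE.
move: (v 0 i_psi) (v 0 i_theta) (v 0 i_phi) (cos (psi z)) (sin (psi z)) C
  (cos (theta z)) (sin (theta z)) st0 Ev.
move=> a b c C S E ct st st0 Ev H3 H2 H1.
have {}H1 : b * S = c * (C * st) by lra.
have {}H2 : b * C = - (c * (S * st)) by lra.
have b0 : b = 0.
  have -> : b = b * C * C + b * S * S by rewrite -!mulrA -mulrDr E subrK mulr1.
  by rewrite H1 H2; ring.
have c0 : c = 0.
  have : c * st = 0.
    have -> : c * st = c * (C * st) * C + c * (S * st) * S.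
      transitivity (c * st * (C * C + S * S)); first by rewrite E subrK mulr1.
      by ring.
    by rewrite -H1 -[c * (S * st)]opprK -H2 b0; ring.
  by move/eqP; rewrite mulf_eq0 (negbTE st0) orbF => /eqP.
have a0 : a = 0 by move: H3; rewrite b0 c0; lra.
exact: Ev.
Qed.

(** The coframe (y1, y2, y3, x1, x2) of [cone_entry_dd], in which [g_R] is diagonal with the entries
    of [coframe_form]: 6 from y and -24 = -6 * 4 from x. This reduces nondegeneracy of [g_R] to that
    of the coframe. *)
Definition coframe_mx z : 'M[R]_5 := \matrix_(i, k) nth 0
  [:: eta1 z i - rho1 z i; eta2 z i - rho2 z i; eta3 z i - rho3 z i; rho1 z i; rho2 z i] k.

Definition coframe_form : 'rV[R]_5 := vec5 6 6 6 (- 24) (- 24).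

Lemma g_R_coframe z : g_R z = coframe_mx z *m diag_mx coframe_form *m (coframe_mx z)^T.
Proof.
apply/matrixP => i j; rewrite g_R_entry mxE; under eq_bigr do rewrite mul_mx_diag !mxE.
rewrite sum5 /=.
move: (eta1 z i) (eta2 z i) (eta3 z i) (rho1 z i) (rho2 z i) (rho3 z i).
move: (eta1 z j) (eta2 z j) (eta3 z j) (rho1 z j) (rho2 z j) (rho3 z j).
by move=> *; ring.
Qed.

Lemma coframe_mx_unit z : M z -> coframe_mx z \in unitmx.
Proof.
move=> Mz; rewrite -row_free_unit -kermx_eq0; apply/eqP/row_matrixP => n; rewrite row0.
have : row n (kermx (coframe_mx z)) *m coframe_mx z = 0 by rewrite -row_mul mulmx_ker row0.
move: (row n _) => v vA.
have c0 : cos (xx z / 3) != 0 by case: Mz.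
have E k := congr1 (fun w : 'rV[R]_5 => w 0 k) vA.
have S k : \sum_i v 0 i * coframe_mx z i k = 0 by move: (E k); rewrite !mxE.
have := S i_psi; have := S i_theta; have := S i_phi; have := S i_x; have := S i_q.
rewrite !sum5 !mxE /= /rho1 /rho2 /rho3 !delta_col /=.
rewrite !(mulr0, oppr0, subr0, mulr1, mul0r, add0r, addr0) => E5 E4 E3 E2 E1.
have vx : v 0 i_x = 0 by move: E5; lra.
have vq : v 0 i_q = 0.
  have : v 0 i_q * cos (xx z / 3) = 0 by move: E4; lra.
  by move/eqP; rewrite mulf_eq0 (negbTE c0) orbF => /eqP.
have eq0 (w : 'cV[R]_5) : \sum_i v 0 i * (w i 0 / 2) = 0 -> v *m w = 0.
  move=> H; apply/matrixP => i j; rewrite !ord1 !mxE.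
  have : (\sum_i v 0 i * w i 0) / 2 = 0 by rewrite mulr_suml -[RHS]H; apply: eq_bigr => k _; rewrite mulrA.
  by move/eqP; rewrite mulf_eq0 invr_eq0 pnatr_eq0 orbF => /eqP.
move: E1 E2 E3; rewrite vx vq !mul0r !addr0 /eta1 /eta2 /eta3 => E1 E2 E3.
by apply: (domain_sigma_inj Mz _ _ _ vx vq); apply: eq0; rewrite sum5 vx vq !mul0r !addr0;
  [move: E1|move: E2|move: E3];
  move: (v 0 i_psi) (v 0 i_theta) (v 0 i_phi) (sigma1 z) (sigma2 z) (sigma3 z) => a b c A1 A2 A3; lra.
Qed.

Lemma g_R_unit z : M z -> g_R z \in unitmx.
Proof.
move=> Mz; rewrite g_R_coframe !unitmx_mul unitmx_tr coframe_mx_unit // andbT /=.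
rewrite unitmxE det_diag unitfE; apply/prodf_neq0 => i _; move: i.
by apply: ord5; rewrite vec5E ?oppr_eq0 pnatr_eq0.
Qed.

Lemma weyl_g_R l k i j z : M z -> weyl g_R l k i j z = 0.
Proof.
(* With Y = (u, v) and |u| = |v| = 1, the second null normal is (-u, v)/12: it is orthogonal to dY
   since u and v have constant length, and 1/12 normalises its product with Y to 1. *)
pose W z : 'rV[R]_7 := \row_a ((if (a < 3)%N then - 12^-1 else 12^-1) * rolling_cone a z).
pose y z := cone_entry (rot0 z) (rot1 z) (rot2 z) (rot3 z) (eul0 z) (eul1 z) (eul2 z) (eul3 z).
pose w z (a : nat) := (if (a < 3)%N then - 12^-1 else 12^-1) * y z a.
have coneE z' : cone rolling_cone z' = \row_(a < 7) y z' a by [].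
have WE z' : W z' = \row_(a < 7) w z' a by [].
apply: (weyl_cone (M := M) (eps := sgn7) (Y := rolling_cone) (W := W)).
- exact: open_domain.
- by move=> a; exact: (smooth_rolling_cone a open_domain).
- by move=> p _ i' j'; exact: g_R_cone.
- exact: g_R_unit.
- move=> p _; rewrite coneE; refine (etrans (ip_sgn7 (y p) (y p)) _).
  have := cone_entry_u (eul0 p) (eul1 p) (eul2 p) (eul3 p) (rot_norm p); have := cone_entry_v (rot_norm p)
    (eul_norm p).
  rewrite -!/(y p _); move: (y p) => t; lra.
- move=> p _; rewrite WE; refine (etrans (ip_sgn7 (w p) (w p)) _); rewrite /w /=.
  have := cone_entry_u (eul0 p) (eul1 p) (eul2 p) (eul3 p) (rot_norm p); have := cone_entry_v (rot_norm p)
    (eul_norm p).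
  rewrite -!/(y p _); move: (y p) => t; lra.
- move=> p _; rewrite coneE WE; refine (etrans (ip_sgn7 (y p) (w p)) _); rewrite /w /=.
  have := cone_entry_u (eul0 p) (eul1 p) (eul2 p) (eul3 p) (rot_norm p); have := cone_entry_v (rot_norm p)
    (eul_norm p).
  rewrite -!/(y p _); move: (y p) => t; lra.
move=> p i' _; rewrite cone_d_rolling WE.
refine (etrans (ip_sgn7 (rolling_cone_d i' ^~ p) (w p)) _); rewrite /w /=.
rewrite /rolling_cone_d.
have := cone_entry_du (rot0 p) (rot1 p) (rot2 p) (rot3 p) (eul0 p) (eul1 p) (eul2 p) (eul3 p)
  (rho1 p i') (rho2 p i') (eta1 p i' - rho1 p i') (eta2 p i' - rho2 p i') (eta3 p i' - rho3 p i').
have := cone_entry_dv (rot0 p) (rot1 p) (rot2 p) (rot3 p) (eul0 p) (eul1 p) (eul2 p) (eul3 p)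
  (rho1 p i') (rho2 p i') (eta1 p i' - rho1 p i') (eta2 p i' - rho2 p i') (eta3 p i' - rho3 p i').
rewrite -!/(y p _); move: (cone_entry_d _ _ _ _ _ _ _ _ _ _ _ _ _) (y p) => d t; lra.
Qed.

End RollingCone.

(** * From maps into the null cone to affine charts *)

Section ConeMaps.
Context {R : realType}.
Local Notation pt := 'rV[R]_5.
Local Notation O := (split_octonion R).
Variables (M : set pt) (D : Defs.distribution R 4) (gm : tensor2 R 4).

Local Notation d i c G z := (partial i (fun y => c (G y)) z).

Lemma flat_metric_entry (F : pt -> O) z i j : flat_metric F z i j =
  d i oc11 F z * d j oc11 F z + 2^-1 * (d i od11 F z * d j od22 F z + d i od22 F z * d j od11 F z)
  - 2^-1 * (d i od12 F z * d j od21 F z + d i od21 F z * d j od12 F z).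
Proof.
have E (a e f g k : 'cV[R]_5) : (sprod a a + sprod e k - sprod f g) i j =
    a i 0 * a j 0 + 2^-1 * (e i 0 * k j 0 + k i 0 * e j 0) - 2^-1 * (f i 0 * g j 0 + g i 0 * f j 0).
  by rewrite !mxE !big_ord1 !mxE; field.
have dE (f : pt -> R) k : differential f z k 0 = partial k f z by rewrite mxE.
refine (etrans (E _ _ _ _ _) _).
rewrite (dE (ch F) i) (dE (ch F) j) (dE (ce F) i) (dE (ce F) j) (dE (cf F) i) (dE (cf F) j).
by rewrite (dE (cg F) i) (dE (cg F) j) (dE (ck F) i) (dE (ck F) j).
Qed.

(* [G] parametrises the null cone of the imaginary split octonions, with [gm] the
   metric induced by a multiple of the norm and [D] tangent to null subalgebras. *)
Definition cone_map (G : pt -> O) :=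
  [/\ vsmooth M G,
      forall z, M z -> oc22 (G z) = - oc11 (G z) /\ oc11 (G z) * oc11 (G z) + oc12 (G z) * oc21 (G z)
        + od11 (G z) * od22 (G z) - od12 (G z) * od21 (G z) = 0,
      forall z, M z -> G z != 0,
      forall z, M z -> forall i j, gm z i j = 6 * (d i oc11 G z * d j oc11 G z)
        + 3 * (d i oc12 G z * d j oc21 G z + d i oc21 G z * d j oc12 G z
          + (d i od11 G z * d j od22 G z + d i od22 G z * d j od11 G z)
          - (d i od12 G z * d j od21 G z + d i od21 G z * d j od12 G z)) &
      forall z, M z -> forall v, D z v -> oct_mul (G z) (valong (fun=> v) G z) = 0].

(* An automorphism of order 6 permuting the coordinates up to sign. *)
Definition oct_rotate (x : O) : O :=
  oct (oc22 x) (od22 x) (od11 x) (oc11 x) (- od12 x) (oc12 x) (- oc21 x) (od21 x).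

Lemma oct_rotate_linear : linear oct_rotate.
Proof. by move=> c x y; apply: octP; rewrite !(ocD, ocZ, octE); ring. Qed.

Lemma oct_rotate_mul x y : oct_rotate (oct_mul x y) = oct_mul (oct_rotate x) (oct_rotate y).
Proof. by rewrite !oct_mulE; apply: octP; rewrite !octE; ring. Qed.

Definition oct_rotate_lin : {linear O -> O} :=
  HB.pack oct_rotate (GRing.isLinear.Build _ _ _ _ _ oct_rotate_linear).

Lemma oct_rotate_fun : linfun oct_rotate_lin =1 oct_rotate.
Proof. exact: lfunE. Qed.

Hypothesis oM : open M.

Lemma cone_map_rotate G : cone_map G -> cone_map (fun z => oct_rotate (G z)).
Proof.
move=> [sG G0 Gn gE DG].
have GE z : linfun oct_rotate_lin (G z) = oct_rotate (G z) by exact: oct_rotate_fun.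
have sR : vsmooth M (fun z => oct_rotate (G z)).
  by refine (vsmooth_near oM _ (vsmooth_linear (linfun oct_rotate_lin) oM sG)) => z _.
split; first exact: sR.
- move=> z Mz; have [E1 E2] := G0 z Mz; rewrite /oct_rotate !octE E1 opprK; split=> //.
  by rewrite -[RHS]E2; ring.
- move=> z Mz; apply: contra_neq (Gn z Mz) => E0.
  have [c1 c2 c3 c4] : [/\ oc11 (G z) = 0, oc12 (G z) = 0, oc21 (G z) = 0 & oc22 (G z) = 0].
    have := congr1 oc11 E0; have := congr1 oc22 E0; have := congr1 od12 E0; have := congr1 od21 E0.
    by rewrite /oct_rotate !octE !oc0 => *; split=> //; apply/eqP; rewrite -oppr_eq0; apply/eqP.
  have := congr1 oc12 E0; have := congr1 oc21 E0; have := congr1 od11 E0; have := congr1 od22 E0.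
  rewrite /oct_rotate !octE !oc0 => e1 e2 e3 e4.
  apply: octP; rewrite ?c1 ?c2 ?c3 ?c4 ?e1 ?e3 ?e4 oc0 //.
  by apply/eqP; rewrite -oppr_eq0; apply/eqP.
- move=> z Mz i j; rewrite (gE z Mz).
  have [l11 l12 l21 l22] := @oc_linear R; have [m11 m12 m21 m22] := @od_linear R.
  have s l (ll : linear (l : O -> R^o)) := smooth_differentiable (smooth_functional oM ll sG) Mz.
  have E c c' (cE : forall x, c (oct_rotate x) = c' x) k : d k c (fun y => oct_rotate (G y)) z = d k c' G z.
    by congr (partial k _ z); apply/funext => y; exact: cE.
  have EN c c' (ll : linear (c' : O -> R^o)) (cE : forall x, c (oct_rotate x) = - c' x) k :
      d k c (fun y => oct_rotate (G y)) z = - d k c' G z.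
    refine (etrans _ (partialN k (s _ ll))).
    by congr (partial k _ z); apply/funext => y; exact: cE.
  have t22 k : d k oc22 G z = - d k oc11 G z.
    by rewrite -(partialN k (s _ l11)); apply: (partial_near k oM Mz) => y /G0[].
  have Es k := (E oc11 oc22 (fun x => (octE _ _ _ _ _ _ _ _).1.1.1.1.1.1.1) k,
                E oc12 od22 (fun x => (octE _ _ _ _ _ _ _ _).1.1.1.1.1.1.2) k,
                E oc21 od11 (fun x => (octE _ _ _ _ _ _ _ _).1.1.1.1.1.2) k,
                EN od11 od12 m12 (fun x => (octE _ _ _ _ _ _ _ _).1.1.1.2) k,
                E od12 oc12 (fun x => (octE _ _ _ _ _ _ _ _).1.1.2) k,
                EN od21 oc21 l21 (fun x => (octE _ _ _ _ _ _ _ _).1.2) k,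
                E od22 od21 (fun x => (octE _ _ _ _ _ _ _ _).2) k).
  rewrite !(Es i) !(Es j) !t22.
  move: (d i oc11 G z) (d i oc12 G z) (d i oc21 G z) (d i od11 G z) (d i od12 G z) (d i od21 G z) (d i od22
    G z).
  move: (d j oc11 G z) (d j oc12 G z) (d j oc21 G z) (d j od11 G z) (d j od12 G z) (d j od21 G z) (d j od22
    G z).
  by move=> *; ring.
move=> z Mz v Dv.
have -> : valong (fun=> v) (fun z => oct_rotate (G z)) z = oct_rotate (valong (fun=> v) G z).
  rewrite -oct_rotate_fun -(valong_linear _ _ oM sG Mz).
  by apply: (valong_near _ oM Mz) => y _; rewrite oct_rotate_fun.
rewrite -oct_rotate_mul DG //.
by apply: octP; rewrite octE !oc0 ?oppr0.
Qed.

Hypothesis gm_unit : forall z, M z -> gm z \in unitmx.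
Hypothesis D_plane : forall z, M z -> exists a b : pt, free [:: a; b] /\
  D z = [set v | v \in <<[:: a; b]>>%VS].

Section Normalise.
Variable G : pt -> O.
Hypothesis coneG : cone_map G.

Definition normal_domain : set pt := [set z | M z /\ oc12 (G z) != 0].
Definition normalised z : O := (oc12 (G z))^-1 *: G z.
Local Notation U := normal_domain.
Local Notation F := normalised.

Let sG : vsmooth M G. Proof. by case: coneG. Qed.

Lemma open_normal_domain : open U.
Proof.
have [_ l12 _ _] := @oc_linear R.
exact: (open_nonzero oM (fun z Mz => smooth_differentiable (smooth_functional oM l12 sG) Mz)).
Qed.
Let oU := open_normal_domain.
Let UM : U `<=` M. Proof. by move=> z []. Qed.
Let sGU : vsmooth U G. Proof. exact: vsmooth_sub UM sG. Qed.

Let sb : smooth U (fun z => oc12 (G z)).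
Proof. by have [_ l12 _ _] := @oc_linear R; exact: (smooth_functional oU l12 sGU). Qed.

Let sbV : smooth U (fun z => (oc12 (G z))^-1).
Proof. by apply: smoothV => // z []. Qed.

Lemma vsmooth_normalised : vsmooth U F.
Proof. exact: (vsmoothZ oU sbV sGU). Qed.

Lemma normalised_null z : U z ->
  [/\ oc12 (F z) = 1, oc22 (F z) = - ch F z & oc21 (F z) = - (ch F z * ch F z) - ce F z * ck F z + cf F z *
    cg F z].
Proof.
move=> [Mz b0]; have [_ G0 _ _ _] := coneG; have [E1 E2] := G0 z Mz.
rewrite /ch /ce /cf /cg /ck /normalised !ocZ E1.
move: (oc11 (G z)) (oc12 (G z)) (oc21 (G z)) (od11 (G z)) (od12 (G z)) (od21 (G z)) (od22 (G z)) b0 E2.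
move=> h b c e f g k b0 E2; split; [by rewrite mulVf|by rewrite mulrN|].
have Ec : c = b^-1 * (- (h * h) - e * k + f * g).
  by apply: (mulfI b0); rewrite mulrA mulfV // mul1r; lra.
by rewrite Ec; ring.
Qed.

Definition lam z : R := 6 * (oc12 (G z) * oc12 (G z)).

Lemma smooth_lam : smooth U lam.
Proof. by apply: smoothZ => //; exact: smoothM. Qed.

Lemma lam_neq0 z : U z -> lam z != 0.
Proof. by move=> [_ b0]; rewrite /lam !mulf_neq0 // pnatr_eq0. Qed.

(** Rescaling a section of a null cone multiplies the induced metric by the square of the factor,
    because F is null and orthogonal to dF. Hence 6 times the square of [oc12] in [lam]. *)
Lemma cone_metric_flat z : U z -> gm z = lam z *: flat_metric F z.
Proof.
move=> Uz; have [Mz b0] := Uz; have [_ G0 _ gE _] := coneG.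
have [l11 l12 l21 l22] := @oc_linear R; have [m11 m12 m21 m22] := @od_linear R.
have sF l (ll : linear (l : O -> R^o)) := smooth_functional oU ll vsmooth_normalised.
have FE y : U y -> G y = oc12 (G y) *: F y.
  by move=> [_ b0y]; rewrite /normalised scalerA mulfV // scale1r.
have hb i : has_partial i (fun y => oc12 (G y)) (d i oc12 G z) z.
  by split=> //; exact: smooth_differentiable sb Uz.
have hl i l (ll : linear (l : O -> R^o)) : has_partial i (fun y => l (F y)) (d i l F z) z.
  by split=> //; exact: smooth_differentiable (sF l ll) Uz.
have Pl i l (ll : linear (l : O -> R^o)) (lZ : forall a x, l (a *: x) = a * l x) :
    d i l G z = d i oc12 G z * l (F z) + oc12 (G z) * d i l F z.
  rewrite -(proj2 (has_partialM (hb i) (hl i l ll))).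
  by apply: (partial_near i oU Uz) => y Uy; rewrite {1}(FE y Uy) lZ.
have c21 i : d i oc21 F z = - (d i oc11 F z * ch F z + ch F z * d i oc11 F z)
    - (d i od11 F z * ck F z + ce F z * d i od22 F z) + (d i od12 F z * cg F z + cf F z * d i od21 F z).
  have H := has_partialD (has_partialB (has_partialN (has_partialM (hl i _ l11) (hl i _ l11)))
    (has_partialM (hl i _ m11) (hl i _ m22))) (has_partialM (hl i _ m12) (hl i _ m21)).
  rewrite -(proj2 H); apply: (partial_near i oU Uz) => y Uy.
  by have [_ _ ->] := normalised_null Uy.
have [F12 _ F21] := normalised_null Uz.
apply/matrixP => i j; rewrite (gE z Mz) [RHS]mxE flat_metric_entry.
have Es k := (Pl k oc11 l11 (fun a x => (ocZ a x).1.1.1.1.1.1.1), Pl k oc21 l21 (fun a x => (ocZ a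
  x).1.1.1.1.1.2),
  Pl k od11 m11 (fun a x => (ocZ a x).1.1.1.2), Pl k od12 m12 (fun a x => (ocZ a x).1.1.2),
  Pl k od21 m21 (fun a x => (ocZ a x).1.2), Pl k od22 m22 (fun a x => (ocZ a x).2)).
rewrite !(Es i) !(Es j) !c21 F21 /lam /ch /ce /cf /cg /ck.
move: (d i oc12 G z) (d j oc12 G z) (oc12 (G z)).
move: (oc11 (F z)) (od11 (F z)) (od12 (F z)) (od21 (F z)) (od22 (F z)).
move: (d i oc11 F z) (d i od11 F z) (d i od12 F z) (d i od21 F z) (d i od22 F z).
move: (d j oc11 F z) (d j od11 F z) (d j od12 F z) (d j od21 F z) (d j od22 F z).
by move=> *; field.
Qed.

Lemma null_chart_normalised : null_chart U F.
Proof.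
split; [exact: oU|exact: vsmooth_normalised|exact: normalised_null|move=> z Uz].
(* [B] is lambda times the matrix of the flat metric applied to the transposed Jacobian. The
   factorisation of [gm] transfers its invertibility to the Jacobian. *)
pose B : 'M[R]_5 := \matrix_(k, j) nth 0 [:: lam z * d j oc11 F z; lam z * (2^-1 * d j od22 F z);
  - (lam z * (2^-1 * d j od21 F z)); - (lam z * (2^-1 * d j od12 F z)); lam z * (2^-1 * d j od11 F z)] k.
have E : gm z = chart_jacobian F z *m B.
  have JE i k : chart_jacobian F z i k =
      nth 0 [:: d i oc11 F z; d i od11 F z; d i od12 F z; d i od21 F z; d i od22 F z] k by rewrite mxE.
  have BE k j : B k j = nth 0 [:: lam z * d j oc11 F z; lam z * (2^-1 * d j od22 F z);
    - (lam z * (2^-1 * d j od21 F z)); - (lam z * (2^-1 * d j od12 F z)); lam z * (2^-1 * d j od11 F z)] k.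
    by rewrite mxE.
  rewrite (cone_metric_flat Uz); apply/matrixP => i j; rewrite [LHS]mxE [RHS]mxE flat_metric_entry.
  rewrite sum5 !JE !BE /=.
  move: (lam z) (d i oc11 F z) (d i od11 F z) (d i od12 F z) (d i od21 F z) (d i od22 F z).
  move: (d j oc11 F z) (d j od11 F z) (d j od12 F z) (d j od21 F z) (d j od22 F z).
  by move=> *; ring.
by have := gm_unit (UM Uz); rewrite E unitmx_mul => /andP[].
Qed.

(** The derivative of the normalising factor contributes a multiple of the square of G, which is
    zero. *)
Lemma null_direction_normalised z v : U z -> D z v -> null_direction F z v.
Proof.
move=> Uz Dv; have [Mz b0] := Uz; have [_ G0 _ _ DG] := coneG.
have [E1 E2] := G0 z Mz.
rewrite /null_direction /normalised (valongZ _ sbV sGU Uz).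
have lr := oct_mul_linearr ((oc12 (G z))^-1 *: G z).
have ll w := oct_mul_linearl w.
have GG : oct_mul (G z) (G z) = 0.
  rewrite oct_mulE E1; move: E2.
  move: (oc11 (G z)) (oc12 (G z)) (oc21 (G z)) (od11 (G z)) (od12 (G z)) (od21 (G z)) (od22 (G z)).
  by move=> h b c e f g k E2; apply: octP; rewrite octE oc0; lra.
have l0 c w : oct_mul (c *: G z) w = c *: oct_mul (G z) w.
  rewrite !oct_mulE; apply: octP; rewrite !(ocZ, octE); ring.
have r0 c w : oct_mul (G z) (c *: w) = c *: oct_mul (G z) w.
  rewrite !oct_mulE; apply: octP; rewrite !(ocZ, octE); ring.
have rD w w' : oct_mul (G z) (w + w') = oct_mul (G z) w + oct_mul (G z) w'.
  rewrite !oct_mulE; apply: octP; rewrite !(ocD, octE); ring.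
by rewrite l0 rD !r0 (DG z Mz v Dv) GG !scaler0 addr0 scaler0.
Qed.

(** One inclusion is known from the cone map, and both sides are planes. *)
Lemma dist_normalised z : U z -> forall v, D z v <-> null_direction F z v.
Proof.
move=> Uz v; split; first exact: null_direction_normalised.
have [a [b [ab DE]]] := D_plane (UM Uz).
have chartF := null_chart_normalised.
(* [dist_frame] is applied to the distribution of all null directions, for which its hypothesis is a
   tautology. *)
have nullE := @dist_frame R U F (fun z => [set v | null_direction F z v]) chartF (fun z _ v => iff_refl _) z Uz.
have nE w : null_direction F z w <-> w \in <<[:: fA F z; fB F z]>>%VS.
  by move/seteqP: nullE => [s1 s2]; split; [exact: s1|exact: s2].
rewrite DE /= => /nE vn.
suff -> : <<[:: a; b]>>%VS = <<[:: fA F z; fB F z]>>%VS by [].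
have sub : (<<[:: a; b]>> <= <<[:: fA F z; fB F z]>>)%VS.
  apply/span_subvP => w wab; apply/nE; apply: null_direction_normalised => //.
  by rewrite DE /=; exact: memv_span.
apply/eqP; rewrite eqEdim sub /=.
by rewrite (eqP ab); exact: dim_span.
Qed.

End Normalise.

(** Iterating the rotation brings each of the six coordinates other than [oc11] and [oc22] to the
    place of [oc12], up to sign. If all six vanished, the null condition would kill [oc11] and then
    the whole octonion. *)
Lemma cone_map_chart G p : cone_map G -> M p -> exists G', cone_map G' /\ normal_domain G' p.
Proof.
move=> coneG Mp.
suff [n Hn] : exists n, oc12 (iter n oct_rotate (G p)) != 0.
  have coneN : cone_map (fun z => iter n oct_rotate (G z)).
    elim: n {Hn} => [|n IH]; first exact: coneG.
    exact: (cone_map_rotate IH).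
  have Np : normal_domain (fun z => iter n oct_rotate (G z)) p by exact: (conj Mp Hn).
  by exists (fun z => iter n oct_rotate (G z)); split; [exact: coneN|exact: Np].
apply: contrapT => H.
have E n : oc12 (iter n oct_rotate (G p)) = 0 by apply/eqP; apply: contra_notT H => Hn; exists n.
have [_ G0 Gn _ _] := coneG; have [E1 E2] := G0 p Mp.
have := E 0%N; have := E 1%N; have := E 2; have := E 3; have := E 4; have := E 5.
have rE x : (oc12 (oct_rotate x) = od22 x) * (od22 (oct_rotate x) = od21 x) *
    (od21 (oct_rotate x) = - oc21 x) * (oc21 (oct_rotate x) = od11 x) *
    (od11 (oct_rotate x) = - od12 x) * (od12 (oct_rotate x) = oc12 x).
  by rewrite /oct_rotate !octE.
rewrite /= !rE => e5 e4 e3 e2 e1 e0.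
have /eqP := Gn p Mp; apply.
have [f0 c0] : od12 (G p) = 0 /\ oc21 (G p) = 0 by split; lra.
have [k0 g0] : od22 (G p) = 0 /\ od21 (G p) = 0 by split; lra.
have e'0 : od11 (G p) = 0 by lra.
have h0 : oc11 (G p) = 0.
  by move: E2; rewrite e0 f0 e'0 !mul0r subr0 !addr0 => /eqP; rewrite mulf_eq0 orbb => /eqP.
by apply: octP; rewrite oc0 // E1 h0 oppr0.
Qed.

End ConeMaps.

(** * The rolling distributions and their annihilators *)

Section RollingDistribution.
Context {R : realType}.
Local Notation pt := 'rV[R]_5.
Local Notation O := (split_octonion R).
Local Notation M := (@domain R).
Implicit Types (z : pt) (v : pt).

Lemma pairingN v (w : 'cV[R]_5) : pairing v (- w) = - pairing v w.
Proof. by rewrite /pairing mulmxN mxE. Qed.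

Lemma pairingDl u v (w : 'cV[R]_5) : pairing (u + v) w = pairing u w + pairing v w.
Proof. by rewrite /pairing mulmxDl mxE. Qed.

Lemma pairingZl c v (w : 'cV[R]_5) : pairing (c *: v) w = c * pairing v w.
Proof. by rewrite /pairing -scalemxAl mxE. Qed.

Lemma pairingNl v (w : 'cV[R]_5) : pairing (- v) w = - pairing v w.
Proof. by rewrite /pairing mulNmx mxE. Qed.

Definition pairing_lin := (pairingDl, @pairingD R 4, pairingNl, pairingN, pairingZl, @pairingZ R 4).

Lemma pairing_deltal i (b : 'cV[R]_5) : pairing (delta_mx 0 i) b = b i 0.
Proof. by rewrite /pairing -rowE mxE. Qed.

Lemma pairing_delta i j : pairing (delta_mx 0 i : pt) (delta_mx j 0) = (i == j)%:R.
Proof. by rewrite pairing_deltal delta_col. Qed.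

Local Notation pr := pairing.

(** A product of equations in [Type] rather than a conjunction, so that a proof of it serves
    directly as a rewrite rule for all pairings. *)
Definition dual_to (e1 e2 e3 vx vq : pt) (s1 s2 s3 dx dq : 'cV[R]_5) : Type :=
  (((pr e1 s1 = 1) * (pr e1 s2 = 0) * (pr e1 s3 = 0)) *
  ((pr e2 s1 = 0) * (pr e2 s2 = 1) * (pr e2 s3 = 0)) *
  ((pr e3 s1 = 0) * (pr e3 s2 = 0) * (pr e3 s3 = 1))) *
  (((pr e1 dx = 0) * (pr e1 dq = 0)) * ((pr e2 dx = 0) * (pr e2 dq = 0)) *
   ((pr e3 dx = 0) * (pr e3 dq = 0))) *
  (((pr vx s1 = 0) * (pr vx s2 = 0) * (pr vx s3 = 0)) *
   ((pr vq s1 = 0) * (pr vq s2 = 0) * (pr vq s3 = 0))) *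
  ((pr vx dx = 1) * (pr vx dq = 0) * (pr vq dx = 0) * (pr vq dq = 1)).

Lemma dual_frame z : M z -> dual_to (E1 z) (E2 z) (E3 z) (@v_x R) (@v_q R)
  (sigma1 z) (sigma2 z) (sigma3 z) (@d_x R) (@d_q R).
Proof.
move=> [st0 _]; have := cos2sin2 (psi z); rewrite !expr2.
rewrite /dual_to /E1 /E2 /E3 /sigma1 /sigma2 /sigma3 !pairing_lin !pairing_delta /=.
move: (cos (psi z)) (sin (psi z)) (cos (theta z)) (sin (theta z)) st0 => c s ct st st0 E.
by do ?[split]; field: E.
Qed.

Lemma covector_eq0 z (b : 'cV[R]_5) : M z -> pr (E1 z) b = 0 -> pr (E2 z) b = 0 -> pr (E3 z) b = 0 ->
  pr (@v_x R) b = 0 -> pr (@v_q R) b = 0 -> b = 0.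
Proof.
move=> [st0 _].
rewrite /E1 /E2 /E3 !pairing_lin !pairing_deltal.
have Eb : [/\ b i_psi 0 = 0, b i_theta 0 = 0, b i_phi 0 = 0, b i_x 0 = 0 & b i_q 0 = 0] -> b = 0.
  by move=> [? ? ? ? ?]; apply/colP; apply: ord5; rewrite mxE.
have := cos2sin2 (psi z); rewrite !expr2.
move: (b i_psi 0) (b i_theta 0) (b i_phi 0) (b i_x 0) (b i_q 0) Eb.
move: (cos (psi z)) (sin (psi z)) (cos (theta z) / sin (theta z)) => c s ct b0 b1 b2 b3 b4 Eb E H1 H2 H3 H4 H5.
have st'0 : (sin (theta z))^-1 != 0 by rewrite invr_eq0.
have b00 : b0 = 0 by lra.
move: H1 H2; rewrite b00 !mulr0 !sub0r; move: (sin _)^-1 st'0 => t t0 H1 H2.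
have b10 : b1 = 0.
  have -> : b1 = c * (c * b1) + s * (s * b1) by rewrite !mulrA -mulrDl E subrK mul1r.
  have -> : c * b1 = s * - (t * b2) by lra.
  have -> : s * b1 = - (c * - (t * b2)) by lra.
  by ring.
have tb : t * b2 = 0.
  have -> : t * b2 = c * (c * (t * b2)) + s * (s * (t * b2)) by rewrite !mulrA -!mulrDl E subrK mul1r.
  have -> : c * (t * b2) = 0 by move: H1; rewrite b10; lra.
  have -> : s * (t * b2) = 0 by move: H2; rewrite b10; lra.
  by ring.
have b20 : b2 = 0 by apply: (mulfI t0); rewrite tb mulr0.
by apply: Eb.
Qed.

(** The coefficients [x], [c], [s] are kept free so that [D_R] and its sign-reversed companion
    [Dt_R] are both instances, with opposite signs of [x] and [c]. *)
Lemma dual_annihilator e1 e2 e3 vx vq (s1 s2 s3 dx dq a : 'cV[R]_5) (x c s : R) :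
  dual_to e1 e2 e3 vx vq s1 s2 s3 dx dq ->
  (forall b : 'cV[R]_5, pr e1 b = 0 -> pr e2 b = 0 -> pr e3 b = 0 -> pr vx b = 0 -> pr vq b = 0 -> b = 0) ->
  (forall v, v \in span [:: vx + x *: e2; vq + c *: e1 + s *: e3] -> v *m a = 0) <->
  a \in span [:: s1 - c *: dq; s2 - x *: dx; s3 - s *: dq].
Proof.
move=> dF b0; split=> [H|/span3P[t1 [t2 [t3 ->]]] v /span2P[u1 [u2 ->]]]; last first.
  by apply/pairing_eq0; rewrite !pairing_lin !dF; ring.
apply/span3P; exists (pr e1 a), (pr e2 a), (pr e3 a).
have aX : pr (vx + x *: e2) a = 0.
  by apply/pairing_eq0; apply: H; apply/span2P; exists 1, 0; rewrite scale1r scale0r addr0.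
have aY : pr (vq + c *: e1 + s *: e3) a = 0.
  by apply/pairing_eq0; apply: H; apply/span2P; exists 0, 1; rewrite scale1r scale0r add0r.
move: aX aY; rewrite !pairing_lin => aX aY.
apply/eqP; rewrite -subr_eq0; apply/eqP; apply: b0; rewrite !pairing_lin !dF;
  by move: (pr e1 a) (pr e2 a) (pr e3 a) (pr vx a) (pr vq a) aX aY => *; lra.
Qed.

Lemma D_R_annihilator : spans_annihilator M D_R [:: o1; o2; o3].
Proof.
move=> z Mz a; rewrite /D_R /X1 /X2 /o1 /o2 /o3 /=.
have := dual_annihilator a 1 (cos (xx z / 3)) (- (3^-1 * sin (xx z / 3))) (dual_frame Mz)
  (fun b => @covector_eq0 z b Mz).
by rewrite !scale1r !scaleNr opprK.
Qed.

Lemma Dt_R_annihilator : spans_annihilator M Dt_R [:: o1t; o2t; o3t].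
Proof.
move=> z Mz a; rewrite /Dt_R /X1t /X2t /o1t /o2t /o3t /o3 /=.
have := dual_annihilator a (-1) (- cos (xx z / 3)) (- (3^-1 * sin (xx z / 3))) (dual_frame Mz)
  (fun b => @covector_eq0 z b Mz).
by rewrite !scaleN1r !scaleNr !opprK.
Qed.

Lemma D_R_forms z v : M z -> D_R z v ->
  [/\ pr v (sigma1 z) = cos (xx z / 3) * pr v (@d_q R), pr v (sigma2 z) = pr v (@d_x R) &
      pr v (sigma3 z) = - (3^-1 * sin (xx z / 3)) * pr v (@d_q R)].
Proof.
move=> Mz; have dF := dual_frame Mz; rewrite /D_R /= => /span2P[x [y ->]].
rewrite /X1 /X2; move: (E1 z) (E2 z) (E3 z) (@v_x R) (@v_q R) (sigma1 z) (sigma2 z) (sigma3 z) (@d_x R)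
  (@d_q R) dF.
by move=> e1 e2 e3 vx vq s1 s2 s3 dx dq dF; rewrite !pairing_lin !dF; split; ring.
Qed.

Lemma D_R_plane z : M z -> exists a b : pt, free [:: a; b] /\ D_R z = [set v | v \in <<[:: a; b]>>%VS].
Proof.
move=> Mz; have dF := dual_frame Mz; exists (X1 z), (X2 z); split=> //.
have -> : [:: X1 z; X2 z] = [tuple X1 z; X2 z] by [].
apply/freeP => k; rewrite big_ord_recl big_ord1 /= => E.
have Ex := congr1 (pr ^~ (@d_x R)) E; have Eq := congr1 (pr ^~ (@d_q R)) E.
have p0 (w : 'cV[R]_5) : pr (0 : pt) w = 0 by rewrite /pairing mul0mx mxE.
move: Ex Eq; rewrite !p0 /X1 /X2 => Ex Eq.
have [k0 k1] : k 0 = 0 /\ k 1 = 0.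
  move: Ex Eq; move: (E1 z) (E2 z) (E3 z) (@v_x R) (@v_q R) (sigma1 z) (sigma2 z) (sigma3 z) (@d_x R) (@d_q
    R) dF.
  move=> e1 e2 e3 vx vq s1 s2 s3 dx dq dF; rewrite !pairing_lin !dF (_ : lift ord0 ord0 = 1); last exact:
    val_inj.
  by split; lra.
move=> i.
by case: (ord2 i) => ->.
Qed.

End RollingDistribution.

(** * The null octonion attached to a rolling configuration *)

Section RollingOctonion.
Context {R : realType}.
Local Notation pt := 'rV[R]_5.
Local Notation O := (split_octonion R).
Local Notation M := (@domain R).

Lemma vsmooth_oct U (a b c d e f g k : pt -> R) : open U -> smooth U a -> smooth U b -> smooth U c ->
  smooth U d -> smooth U e -> smooth U f -> smooth U g -> smooth U k ->
  vsmooth U (fun z => oct (a z) (b z) (c z) (d z) (e z) (f z) (g z) (k z)).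
Proof.
move=> oU sa sb sc sd se sf sg sk.
have S (x : pt -> R) (w : O) (sx : smooth U x) : vsmooth U (fun z => x z *: w).
  by apply: vsmoothZ => //; exact: vsmooth_cst.
have A F G sF sG := @vsmoothD R _ O U F G oU sF sG.
have H := A _ _ (A _ _ (A _ _ (A _ _ (A _ _ (A _ _ (A _ _ (S _ (oct 1 0 0 0 0 0 0 0) sa)
  (S _ (oct 0 1 0 0 0 0 0 0) sb)) (S _ (oct 0 0 1 0 0 0 0 0) sc)) (S _ (oct 0 0 0 1 0 0 0 0) sd))
  (S _ (oct 0 0 0 0 1 0 0 0) se)) (S _ (oct 0 0 0 0 0 1 0 0) sf)) (S _ (oct 0 0 0 0 0 0 1 0) sg))
  (S _ (oct 0 0 0 0 0 0 0 1) sk).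
apply: (vsmooth_near oU _ H) => z _.
move: (a z) (b z) (c z) (d z) (e z) (f z) (g z) (k z) => a' b' c' d' e' f' g' k'.
by apply: octP; rewrite !(ocD, ocZ, octE); ring.
Qed.

Definition rolling_entry (a : nat) (z : pt) : R :=
  cone_entry (rot0 z) (rot1 z) (rot2 z) (rot3 z) (eul0 z) (eul1 z) (eul2 z) (eul3 z) a.

Definition rolling_oct (z : pt) : O := oct_of_cone (rolling_entry^~ z).

Lemma smooth_rolling_entry U a : (a < 7)%N -> open U -> smooth U (rolling_entry a).
Proof. by move=> a7 oU; exact: (smooth_rolling_cone (Ordinal a7) oU). Qed.

Lemma has_partial_rolling i a z : (a < 7)%N -> has_partial i (rolling_entry a) (rolling_cone_d i a z) z.
Proof.
move=> a7; split; last exact: (partial_rolling_cone i (Ordinal a7) z).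
exact: (smooth_differentiable (smooth_rolling_entry a7 openT) I).
Qed.

Lemma vsmooth_rolling U : open U -> vsmooth U rolling_oct.
Proof.
move=> oU; have s a a7 := @smooth_rolling_entry U a a7 oU.
have B f g sf sg := @smoothB R 4 U f g oU sf sg; have N f sf := @smoothN R 4 U f oU sf.
have D f g sf sg := @smoothD R 4 U f g oU sf sg.
apply: (vsmooth_oct oU (s 3%N isT) (B _ _ (s 0%N isT) (s 4%N isT)) (B _ _ (N _ (s 0%N isT)) (s 4%N isT))
  (N _ (s 3%N isT)) (B _ _ (s 1%N isT) (s 5%N isT)) (D _ _ (s 2%N isT) (s 6%N isT)) (B _ _ (s 2%N isT) (s
    6%N isT))
  (B _ _ (N _ (s 1%N isT)) (s 5%N isT))).
Qed.

Lemma partial_rolling_oct i z (d := rolling_cone_d i ^~ z) :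
  ((partial i (fun y => oc11 (rolling_oct y)) z = d 3%N) *
   (partial i (fun y => oc12 (rolling_oct y)) z = d 0%N - d 4%N) *
   (partial i (fun y => oc21 (rolling_oct y)) z = - d 0%N - d 4%N) *
   (partial i (fun y => oc22 (rolling_oct y)) z = - d 3%N)) *
  ((partial i (fun y => od11 (rolling_oct y)) z = d 1%N - d 5%N) *
   (partial i (fun y => od12 (rolling_oct y)) z = d 2%N + d 6%N) *
   (partial i (fun y => od21 (rolling_oct y)) z = d 2%N - d 6%N) *
   (partial i (fun y => od22 (rolling_oct y)) z = - d 1%N - d 5%N)).
Proof.
have h a a7 := @has_partial_rolling i a z a7.
have P c (f : pt -> R) x : (forall y, c (rolling_oct y) = f y) -> has_partial i f x z ->
    partial i (fun y => c (rolling_oct y)) z = x.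
  by move=> cE [_ <-]; congr (partial i _ z); apply/funext.
have E y := octE (rolling_entry 3%N y) (rolling_entry 0%N y - rolling_entry 4%N y)
  (- rolling_entry 0%N y - rolling_entry 4%N y) (- rolling_entry 3%N y) (rolling_entry 1%N y -
    rolling_entry 5%N y)
  (rolling_entry 2%N y + rolling_entry 6%N y) (rolling_entry 2%N y - rolling_entry 6%N y) (- rolling_entry
    1%N y - rolling_entry 5%N y).
rewrite /d; split; do ?split.
- exact: (P _ _ _ (fun y => (E y).1.1.1.1.1.1.1) (h 3%N isT)).
- exact: (P _ _ _ (fun y => (E y).1.1.1.1.1.1.2) (has_partialB (h 0%N isT) (h 4%N isT))).
- exact: (P _ _ _ (fun y => (E y).1.1.1.1.1.2) (has_partialB (has_partialN (h 0%N isT)) (h 4%N isT))).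
- exact: (P _ _ _ (fun y => (E y).1.1.1.1.2) (has_partialN (h 3%N isT))).
- exact: (P _ _ _ (fun y => (E y).1.1.1.2) (has_partialB (h 1%N isT) (h 5%N isT))).
- exact: (P _ _ _ (fun y => (E y).1.1.2) (has_partialD (h 2%N isT) (h 6%N isT))).
- exact: (P _ _ _ (fun y => (E y).1.2) (has_partialB (h 2%N isT) (h 6%N isT))).
- exact: (P _ _ _ (fun y => (E y).2) (has_partialB (has_partialN (h 1%N isT)) (h 5%N isT))).
Qed.

(** [cone_entry_d] is linear in its last five arguments, so contracting with a vector can be done
    inside them. *)
Lemma cone_entry_d_sum n (r0 r1 r2 r3 s0 s1 s2 s3 : R) (v x1 x2 y1 y2 y3 : 'I_n -> R) a
    (d := cone_entry_d r0 r1 r2 r3 s0 s1 s2 s3) (s := fun f : 'I_n -> R => \sum_i v i * f i) :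
  \sum_i v i * d (x1 i) (x2 i) (y1 i) (y2 i) (y3 i) a = d (s x1) (s x2) (s y1) (s y2) (s y3) a.
Proof.
have L t1 t2 u1 u2 u3 : d t1 t2 u1 u2 u3 a = t1 * d 1 0 0 0 0 a + t2 * d 0 1 0 0 0 a
    + u1 * d 0 0 1 0 0 a + u2 * d 0 0 0 1 0 a + u3 * d 0 0 0 0 1 a.
  rewrite /d /cone_entry_d; case: a => [|[|[|[|[|[|[|a]]]]]]] /=; try by ring.
  by rewrite nth_nil; ring.
rewrite L /s !mulr_suml -!big_split; apply: eq_bigr => i _ /=; rewrite L.
move: (d 1 0 0 0 0 a) (d 0 1 0 0 0 a) (d 0 0 1 0 0 a) (d 0 0 0 1 0 a) (d 0 0 0 0 1 a) => A B C D E; ring.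
Qed.

Lemma valong_rolling (v : pt) z (s := fun f => \sum_i v 0 i * f z i) :
  valong (fun=> v) rolling_oct z = oct_of_cone (cone_entry_d (rot0 z) (rot1 z) (rot2 z) (rot3 z)
    (eul0 z) (eul1 z) (eul2 z) (eul3 z) (s rho1) (s rho2) (s eta1 - s rho1) (s eta2 - s rho2) (s eta3 - s
      rho3)).
Proof.
have sG := vsmooth_rolling (@openT pt).
have [l11 l12 l21 l22] := @oc_linear R; have [m11 m12 m21 m22] := @od_linear R.
have A l (ll : linear (l : O -> R^o)) := along_functional (fun=> v) openT ll sG (I : setT z).
have P i := partial_rolling_oct i z.
have E a : \sum_i v 0 i * rolling_cone_d i a z = cone_entry_d (rot0 z) (rot1 z) (rot2 z) (rot3 z)
    (eul0 z) (eul1 z) (eul2 z) (eul3 z) (s rho1) (s rho2) (s eta1 - s rho1) (s eta2 - s rho2) (s eta3 - s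
      rho3) a.
  rewrite /rolling_cone_d cone_entry_d_sum /s -!sumrB.
  by congr cone_entry_d; apply: eq_bigr => i _; rewrite mulrBr.
have sB (x y : 'I_5 -> R) : \sum_i v 0 i * (x i - y i) = \sum_i v 0 i * x i - \sum_i v 0 i * y i.
  by rewrite -sumrB; apply: eq_bigr => i _; rewrite mulrBr.
have sN (x : 'I_5 -> R) : \sum_i v 0 i * - x i = - \sum_i v 0 i * x i.
  by rewrite -sumrN; apply: eq_bigr => i _; rewrite mulrN.
have sD (x y : 'I_5 -> R) : \sum_i v 0 i * (x i + y i) = \sum_i v 0 i * x i + \sum_i v 0 i * y i.
  by rewrite -big_split; apply: eq_bigr => i _; rewrite mulrDr.
have Q l (f : 'I_5 -> R) : (forall i, partial i (fun y => l (rolling_oct y)) z = f i) ->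
    along (fun=> v) (fun y => l (rolling_oct y)) z = \sum_i v 0 i * f i.
  by move=> lE; apply: eq_bigr => i _; rewrite lE.
apply: octP; rewrite /oct_of_cone octE.
- by rewrite -(A _ l11) (Q _ _ (fun i => (P i).1.1.1.1)) (E 3%N).
- by rewrite -(A _ l12) (Q _ _ (fun i => (P i).1.1.1.2)) sB (E 0%N) (E 4%N).
- by rewrite -(A _ l21) (Q _ _ (fun i => (P i).1.1.2)) sB sN (E 0%N) (E 4%N).
- by rewrite -(A _ l22) (Q _ _ (fun i => (P i).1.2)) sN (E 3%N).
- by rewrite -(A _ m11) (Q _ _ (fun i => (P i).2.1.1.1)) sB (E 1%N) (E 5%N).
- by rewrite -(A _ m12) (Q _ _ (fun i => (P i).2.1.1.2)) sD (E 2%N) (E 6%N).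
- by rewrite -(A _ m21) (Q _ _ (fun i => (P i).2.1.2)) sB (E 2%N) (E 6%N).
- by rewrite -(A _ m22) (Q _ _ (fun i => (P i).2.2)) sB sN (E 1%N) (E 5%N).
Qed.

Lemma rolling_oct_null z v : M z -> D_R z v -> oct_mul (rolling_oct z) (valong (fun=> v) rolling_oct z) = 0.
Proof.
move=> Mz Dv; have [E1 E2 E3] := D_R_forms Mz Dv; rewrite valong_rolling.
have PE (w : 'cV[R]_5) (c : R) : \sum_i v 0 i * (c * w i 0) = c * pairing v w.
  by rewrite /pairing mxE mulr_sumr; apply: eq_bigr => i _; rewrite mulrCA.
have r1 : \sum_i v 0 i * rho1 z i = - (cos (xx z / 3) / 6) * pairing v (@d_q R).
  by rewrite -PE; apply: eq_bigr => i _; rewrite /rho1 mulNr.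
have r2 : \sum_i v 0 i * rho2 z i = - 6^-1 * pairing v (@d_x R).
  by rewrite -PE; apply: eq_bigr => i _; rewrite /rho2 mulNr [_ / 6]mulrC.
have r3 : \sum_i v 0 i * rho3 z i = sin (xx z / 3) / 6 * pairing v (@d_q R).
  by rewrite -PE.
have e1 : \sum_i v 0 i * eta1 z i = - 2^-1 * pairing v (sigma1 z).
  by rewrite -PE; apply: eq_bigr => i _; rewrite /eta1 mulNr [_ / 2]mulrC.
have e2 : \sum_i v 0 i * eta2 z i = - 2^-1 * pairing v (sigma2 z).
  by rewrite -PE; apply: eq_bigr => i _; rewrite /eta2 mulNr [_ / 2]mulrC.
have e3 : \sum_i v 0 i * eta3 z i = - 2^-1 * pairing v (sigma3 z).
  by rewrite -PE; apply: eq_bigr => i _; rewrite /eta3 mulNr [_ / 2]mulrC.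
(* On [D_R] the forms satisfy eta1 = 3 rho1, eta2 = 3 rho2 and eta3 = rho3, the 3 being the ratio of
   the radii. With y = eta - rho this is the hypothesis of [F], under which [cone_entry_null]
   applies. *)
have F x1 x2 y1 y2 y3 : y1 = 2 * x1 -> y2 = 2 * x2 -> y3 = 0 -> oct_mul (rolling_oct z)
    (oct_of_cone (cone_entry_d (rot0 z) (rot1 z) (rot2 z) (rot3 z) (eul0 z) (eul1 z) (eul2 z) (eul3 z)
      x1 x2 y1 y2 y3)) = 0.
  by move=> -> -> ->; exact: (cone_entry_null (rot_norm z) (eul_norm z) x1 x2).
rewrite r1 r2 r3 e1 e2 e3 E1 E2 E3.
move: (cos (xx z / 3)) (sin (xx z / 3)) (pairing v (@d_x R)) (pairing v (@d_q R)) => c s x q.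
by apply: F; field.
Qed.

Lemma rolling_oct_neq0 z : rolling_oct z != 0.
Proof.
apply/eqP => E0; have := cone_entry_v (rot_norm z) (eul_norm z).
have := congr1 oc11 E0; have := congr1 oc12 E0; have := congr1 oc21 E0; have := congr1 oc22 E0.
have := congr1 od11 E0; have := congr1 od12 E0; have := congr1 od21 E0; have := congr1 od22 E0.
rewrite /rolling_oct /oct_of_cone !octE !oc0 -!/(rolling_entry _ z).
move: (rolling_entry 0%N z) (rolling_entry 1%N z) (rolling_entry 2%N z) (rolling_entry 3%N z)
  (rolling_entry 4%N z) (rolling_entry 5%N z) (rolling_entry 6%N z) => y0 y1 y2 y3 y4 y5 y6.
move=> e1 e2 e3 e4 e5 e6 e7 e8.
have [-> ->] : y3 = 0 /\ y4 = 0 by split; lra.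
have [-> ->] : y5 = 0 /\ y6 = 0 by split; lra.
by rewrite !mulr0 !addr0 => /esym/eqP; rewrite oner_eq0.
Qed.

Lemma rolling_cone_map : cone_map M D_R g_R rolling_oct.
Proof.
split.
- exact: (vsmooth_rolling (@open_domain R)).
- move=> z _; rewrite /rolling_oct /oct_of_cone !octE; split=> //.
  have := cone_entry_u (eul0 z) (eul1 z) (eul2 z) (eul3 z) (rot_norm z).
  have := cone_entry_v (rot_norm z) (eul_norm z); rewrite -!/(rolling_entry _ z).
  by move: (rolling_entry 0%N z) (rolling_entry 1%N z) (rolling_entry 2%N z) (rolling_entry 3%N z)
    (rolling_entry 4%N z) (rolling_entry 5%N z) (rolling_entry 6%N z) => *; lra.
- by move=> z _; exact: rolling_oct_neq0.
- move=> z _ i j; rewrite !(partial_rolling_oct i z) !(partial_rolling_oct j z).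
  rewrite g_R_cone !cone_d_rolling; refine (etrans (ip_sgn7 (rolling_cone_d i ^~ z) (rolling_cone_d j ^~ z)) _).
  rewrite /=.
  move: (rolling_cone_d i 0%N z) (rolling_cone_d i 1%N z) (rolling_cone_d i 2%N z) (rolling_cone_d i 3%N z)
    (rolling_cone_d i 4%N z) (rolling_cone_d i 5%N z) (rolling_cone_d i 6%N z).
  by move: (rolling_cone_d j 0%N z) (rolling_cone_d j 1%N z) (rolling_cone_d j 2%N z) (rolling_cone_d j 3%N
    z) (rolling_cone_d j 4%N z) (rolling_cone_d j 5%N z) (rolling_cone_d j 6%N z) => *; ring.
by move=> z Mz v; exact: rolling_oct_null.
Qed.

End RollingOctonion.

(** * Transfer of the chart results to the rolling distribution *)

Section RollingCharts.
Context {R : realType}.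
Local Notation pt := 'rV[R]_5.
Local Notation O := (split_octonion R).
Local Notation M := (@domain R).

Lemma rolling_chart p : M p -> exists (U : set pt) (F : pt -> O) (l : pt -> R),
  [/\ [/\ null_chart U F, U p & U `<=` M], forall z, U z -> forall v, D_R z v <-> null_direction F z v,
      smooth U l & forall z, U z -> l z != 0 /\ g_R z = l z *: flat_metric F z].
Proof.
move=> Mp; have oM := @open_domain R.
have [G [coneG Gp]] := cone_map_chart oM (@rolling_cone_map R) Mp.
have gu : forall z, M z -> g_R z \in unitmx by move=> z; exact: g_R_unit.
exists (normal_domain M G), (normalised G), (lam G); split.
- split; [exact: (null_chart_normalised oM gu coneG)|exact: Gp|by move=> z []].
- move=> z Uz; exact: (dist_normalised oM gu (fun z => @D_R_plane R z) coneG Uz).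
- exact: (smooth_lam oM coneG).
by move=> z Uz; split; [exact: (lam_neq0 Uz)|exact: (cone_metric_flat oM coneG Uz)].
Qed.

Lemma mktuple2 (T : Type) (f : 'I_2 -> T) : [tuple f i | i < 2] = [tuple f 0; f 1].
Proof. by apply: eq_from_tnth => i; rewrite tnth_mktuple; case: (ord2 i) => ->. Qed.

Lemma mktuple3 (T : Type) (f : 'I_3 -> T) :
  [tuple f i | i < 3] = [tuple f (inord 0); f (inord 1); f (inord 2)].
Proof.
apply: eq_from_tnth => -[[|[|[|//]]] lt_i]; rewrite tnth_mktuple /tnth /=;
  by congr f; apply: val_inj; rewrite /= inordK.
Qed.

Lemma D_R_235 : is_235 M D_R.
Proof.
split=> [p Mp|p Mp|p Mp]; have [U [F [l [[chartF Up UM] nullD _ _]]]] := rolling_chart Mp;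
  have [sA sB sC _ _] := smooth_frame chartF; have [oU _ _ _] := chartF.
- exists U, (fun i : 'I_2 => if i == 0 then fA F else fB F); split=> //.
    by move=> i; case: ifP => _; [exact: sA|exact: sB].
  move=> y Uy; rewrite mktuple2 /=; split; last exact: (dist_frame chartF nullD Uy).
  apply/freeP => k; rewrite big_ord_recl big_ord1 /= => E.
  have [|k0 k1 _ _ _] := @frame_free _ _ _ chartF _ Uy (k 0) (k (lift ord0 ord0)) 0 0 0.
    by rewrite !scale0r !addr0.
  move=> i; case: (ord2 i) => -> //.
  by rewrite -k1; congr k; exact: val_inj.
- exists U, (fun i : 'I_3 => nth (fA F) [:: fA F; fB F; fC F] i); split=> //.
    by case=> -[|[|[|//]]] lt_i; [exact: sA|exact: sB|exact: sC].
  move=> y Uy; rewrite mktuple3 !inordK //=; split; last exact: (rank3_distribution chartF nullD Uy).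
  apply/freeP => k; rewrite !big_ord_recl big_ord0 /= addr0 addrA => E.
  have [|k0 k1 k2 _ _] := @frame_free _ _ _ chartF _ Uy (k 0) (k (lift ord0 ord0))
    (k (lift ord0 (lift ord0 ord0))) 0 0.
    by rewrite !scale0r !addr0.
  case=> -[|[|[|//]]] lt_i; [rewrite -k0|rewrite -k1|rewrite -k2];
    by congr k; exact: val_inj.
exact: (rank5_distribution chartF nullD Up).
Qed.

Lemma g_R_represents : represents_nurowski_class M D_R g_R.
Proof.
move=> p Mp; have [U [F [l [[chartF Up UM] nullD sl lE]]]] := rolling_chart Mp.
have [oU _ _ _] := chartF.
have [t1 [t2 [t3 [t4 [t5 [mu [cf smu muE]]]]]]] := represents_chart chartF nullD sl lE.
by exists U, t1, t2, t3, t4, t5, mu.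
Qed.

Lemma g_R_conformally_flat : conformally_flat M g_R.
Proof.
move=> p Mp; have [U [F [l [[chartF Up UM] _ sl lE]]]] := rolling_chart Mp.
exact: (conformally_flat_chart chartF Up UM sl lE).
Qed.

Lemma D_R_symmetries : local_symmetry_algebra M D_R (split_g2 R).
Proof.
move=> p Mp; have [U [F [l [[chartF Up UM] nullD _ _]]]] := rolling_chart Mp.
have [r [rho [[r0 rU] H1 H2 H3 H4]]] := local_symmetry_chart chartF nullD Up.
exists r, rho; split; [|exact: H1|exact: H2|exact: H3|exact: H4].
by split; [exact: r0|exact: subset_trans rU UM].
Qed.

Lemma derive1_h_roll (x : R) : derive1 h_roll x = - (3^-1 * sin (x / 3)).
Proof.
have H : is_derive x (1 : R) (fun t : R => 3^-1 *: t) (3^-1 *: 1) by exact: is_deriveZ.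
have -> : h_roll = cos \o (fun t : R => 3^-1 *: t).
  by apply/funext => t; rewrite /h_roll /= mulrC.
rewrite derive1E (@derive_val _ _ _ _ _ _ _ (is_derive1_comp (is_derive_cos _) H)).
change (- sin (3^-1 * x) * (3^-1 * 1) = - (3^-1 * sin (x / 3))).
by rewrite [x / 3]mulrC; move: (sin _) => s; ring.
Qed.

Lemma derive1_f_roll (x : R) : derive1 f_roll x = - cos x.
Proof. by rewrite derive1E; apply: derive_val. Qed.

(** [omega1] and [omega2] arise from [o1] and [o2] by an orthogonal matrix in the angle psi, and
    [omega3] is minus [o3]; the identity then amounts to expanding squares. *)
Lemma g_R_rolling z : M z -> g_R z = g_rolling z.
Proof.
move=> [st0 c0]; have := cos2sin2 (psi z); rewrite !expr2 => E.
rewrite /g_R /g_rolling /omega1 /omega2 /omega3 /o1t /o2t /o3t /o1 /o2 /o3 /o4 /o5 /chi1 /chi2 /chi3 /chi4.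
rewrite derive1_h_roll derive1_f_roll /h_roll /f_roll /sigma1 /sigma2 /sigma3.
move: (cos (xx z / 3)) c0 (sin (xx z / 3)) (cos (psi z)) (sin (psi z)) E (cos (theta z)) (sin (theta z)) st0.
move: (@d_psi R) (@d_theta R) (@d_phi R) (@d_x R) (@d_q R) => u1 u2 u3 u4 u5.
move=> c c0 s cp sp E ct st st0.
have {}E : cp * cp = 1 - sp * sp by lra.
apply/matrixP => i j; rewrite !mxE !big_ord1 !mxE.
move: (u1 i 0) (u2 i 0) (u3 i 0) (u4 i 0) (u5 i 0) (u1 j 0) (u2 j 0) (u3 j 0) (u4 j 0) (u5 j 0).
move=> a1 a2 a3 a4 a5 b1 b2 b3 b4 b5.
by field: E; rewrite st0 c0.
Qed.

End RollingCharts.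

Theorem theorem4p1 (R : realType) :
  let M : set 'rV[R]_5 := domain in
  spans_annihilator M D_R [:: o1; o2; o3] /\
  spans_annihilator M Dt_R [:: o1t; o2t; o3t] /\
  is_235 M D_R /\
  maximally_symmetric M D_R /\
  represents_nurowski_class M D_R g_R /\
  (forall p, M p -> g_R p = g_rolling p) /\
  conformally_flat M g_R /\
  local_symmetry_algebra M D_R (split_g2 R).
Proof.
move=> M; split; first exact: D_R_annihilator.
split; first exact: Dt_R_annihilator.
split; first exact: D_R_235.
split; first by exists g_R; split; [exact: g_R_represents|move=> *; exact: weyl_g_R].
split; first exact: g_R_represents.
split; first by move=> p; exact: g_R_rolling.
split; [exact: g_R_conformally_flat|exact: D_R_symmetries].
Qed.
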